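(* Let $\omega:[0,2]\to[0,\infty)$ be a continuous increasing function such that $\omega(0)=0$ and $$\int_{\delta}^{2}\frac{\omega(t)}{t^2}\,dt = O\Big(1+\frac{\omega(\delta)}{\delta}\Big),\qquad \delta\to 0^+.$$ Let $E\subset\mathbb{T}$ be nonempty and suppose that there exists a function $f\in\mathcal{D}$, $f\not\equiv 0$, such that $$|f(\zeta)|^2\le \omega\big(d(\zeta,E)\big)\qquad\text{for a.e. }\zeta\in\mathbb{T}.$$ Then every Blaschke sequence $(z_n)_{n\ge1}$ in $\mathbb{D}$ satisfying $$\sum_{n=1}^\infty \omega\big(2d(z_n,E)\big)<\infty$$ is a zero set for $\mathcal{D}$.
   Context: $\mathbb{D}$ is the open unit disk and $\mathbb{T}$ the unit circle in $\mathbb{C}$. The Dirichlet space $\mathcal{D}$ is the set of analytic functions $f=\sum_{n\ge0}a_nz^n$ on $\mathbb{D}$ with $\mathcal{D}(f)=\int_{\mathbb{D}}|f'(z)|^2\,dA(z)=\sum_{n\ge1}n|a_n|^2<\infty$, where $dA=dx\,dy/\pi$. For $f\in\mathcal{D}$ and $\zeta\in\mathbb{T}$, $f(\zeta)$ denotes the radial limit $\lim_{r\to1^-}f(r\zeta)$, which exists for a.e. $\zeta$ with respect to Lebesgue measure. A sequence $(z_n)_{n\ge1}$ in $\mathbb{D}$ is a zero set for $\mathcal{D}$ if there is $f\in\mathcal{D}$, $f\not\equiv0$, with $f(z_n)=0$ for all $n\ge1$. A Blaschke sequence is a sequence in $\mathbb{D}$ with $\sum_n(1-|z_n|)<\infty$.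 For $z\in\mathbb{C}$, $d(z,E)=\inf_{\xi\in E}|z-\xi|$ is the Euclidean distance. Convention: $\omega(t):=\omega(2)$ for $t>2$, so that $\omega(2d(z_n,E))$ is always defined. *)

(* Defs.v *)
From HB Require Import structures.
From mathcomp Require Import all_boot all_order all_algebra.
From mathcomp Require Import complex.
From mathcomp Require Import all_classical all_reals all_analysis.

Set Implicit Arguments.
Unset Strict Implicit.
Unset Printing Implicit Defensive.

Import Order.TTheory GRing.Theory Num.Theory.
Import numFieldNormedType.Exports.

Local Open Scope classical_set_scope.
Local Open Scope ring_scope.
Local Open Scope complex_scope.

(* The field of complex numbers is [R[i]].  Its topology and complex
   differentiability are those of the normed module [R[i]^o] over itself.
   The norm of [R[i]] takes its values in [R[i]], hence the real-valued
   [cmod]. *)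
Definition cmod (R : realType) (z : R[i]) : R := ComplexField.Normc.normc z.

Definition unit_disk (R : realType) : set R[i] := [set z | cmod z < 1].

Definition unit_circle (R : realType) : set R[i] := [set z | cmod z = 1].

Definition cis (R : realType) (t : R) : R[i] := cos t +i* sin t.

(* Elements of the Dirichlet space are functions on the whole of [R[i]];
   every notion below only depends on their values in the unit disk. *)
Definition analytic_on_disk (R : realType) (f : R[i] -> R[i]) : Prop :=
  exists a : nat -> R[i], forall z, unit_disk z ->
    (series (fun n => a n * z ^+ n) : nat -> R[i]^o) @ \oo --> (f z : R[i]^o).

Definition complex_derive (R : realType) (f : R[i] -> R[i]) : R[i] -> R[i] :=
  derive1 (f : R[i]^o -> R[i]^o).

Definition dirichlet_integral (R : realType) (f : R[i] -> R[i]) : \bar R :=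
  (\int[lebesgue_measure \x lebesgue_measure]_(p in
      [set p : R * R | unit_disk (p.1 +i* p.2)])
    (cmod (complex_derive f (p.1 +i* p.2)) ^+ 2 / pi)%:E)%E.

Definition dirichlet_space (R : realType) : set (R[i] -> R[i]) :=
  [set f | analytic_on_disk f /\ (dirichlet_integral f < +oo)%E].

Definition nonzero_on_disk (R : realType) (f : R[i] -> R[i]) : Prop :=
  exists2 z, unit_disk z & f z != 0.

(* When the limit does not exist, [lim] returns an unspecified default; for
   [f] in the Dirichlet space this happens only for almost no [zeta]. *)
Definition radial_limit (R : realType) (f : R[i] -> R[i]) (zeta : R[i]) : R[i] :=
  lim ((f (r%:C * zeta) : R[i]^o) @[r --> (1 : R)^'-]).

Definition ae_circle (R : realType) (P : R[i] -> Prop) : Prop :=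
  {ae lebesgue_measure, forall t : R, t \in `[0, 2 * pi] -> P (cis t)}.

Definition dist (R : realType) (z : R[i]) (E : set R[i]) : R :=
  inf [set cmod (z - xi) | xi in E].

Definition blaschke_sequence (R : realType) (z : nat -> R[i]) : Prop :=
  (forall n, unit_disk (z n)) /\ cvgn (series (fun n => 1 - cmod (z n))).

Definition zero_set (R : realType) (z : nat -> R[i]) : Prop :=
  (forall n, unit_disk (z n)) /\
  exists f, [/\ dirichlet_space f, nonzero_on_disk f & forall n, f (z n) = 0].

(* Main.v *)
Require Import Defs.
From HB Require Import structures.
From mathcomp Require Import all_boot all_order all_algebra.
From mathcomp Require Import complex ring lra.
From mathcomp Require Import all_classical all_reals all_analysis.
From mathcomp Require Import measurable_realfun.
Set Implicit Arguments.
Unset Strict Implicit.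
Unset Printing Implicit Defensive.
Import Order.TTheory GRing.Theory Num.Theory.
Import numFieldNormedType.Exports.
Local Open Scope classical_set_scope.
Local Open Scope ring_scope.

(** Let [f] be the given function, [c] its Taylor coefficients, and [B] the Blaschke
    product with zeros [z k]. The function [z B f] vanishes at every [z k], and the
    point is that its Dirichlet integral, that is [\sum_n n |a_n|^2] for its
    coefficients, is finite.

    For a single factor [b(z) = (z - a) / (1 - conj a z)], put
    [h = f / (1 - conj a z)]. The coefficients satisfy
    [|(b f)_n|^2 - |f_n|^2 = (1 - |a|^2) (|h_(n-1)|^2 - |h_n|^2)]; multiplying by [n]
    and summing, the Dirichlet sum grows by at most
    [(1 - |a|^2) \sum_n |h_n|^2] ([sum_weighted_sqr_blaschke_mul_le]). As other
    Blaschke factors can only decrease this norm of [h], the growth caused by a finite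
    product is at most the sum of these quantities over its zeros
    ([sum_weighted_sqr_blaschke_prod_le]).

    On the circle, [|1 - conj a z| = |z - a|], so that [(1 - |a|^2) \sum_n |h_n|^2] is
    a Poisson integral of [|f|^2] at [a], and the hypothesis bounds it by the Poisson
    integral of [omega (d (., E))]. Within distance [s = d (a, E)] of [a], the
    integrand is at most [omega (2 s)]; at the other points [d (z, E) <= 2 |z - a|],
    and the condition on the integral of [omega t / t ^+ 2] applies. The result is a
    bound by a constant times [omega (2 d (a, E)) + 1 - |a|] ([poisson_majorant]),
    which is summable over the zeros. A limit of the finite products is then a
    function with the required properties ([blaschke_limit], [zero_set_of_coef]).

    Two transfers between functions and coefficients are needed. The Dirichlet
    integral is comparable to [\sum_n n |a_n|^2]: the rotation invariance of plane
    measure makes the monomials orthogonal on the disk, through averages over finitely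
    many rotates, and scaling determines the size of their norms
    ([dirichlet_coef_bound], [dirichlet_of_coef]). Bessel's inequality for [h] in terms
    of the radial limits of [f] uses the partial sums of [f] of length [4 ^ k]: the
    Dirichlet bound makes them converge geometrically almost everywhere ([dyadic_cvg]),
    and Fejér's comparison of partial and Abel sums identifies their limit with the
    radial limit ([radial_limitE], [kernel_div_integral_bound]). *)

(** * Real sequences and sums *)

Section RealSequences.
Context (R : realType).

Lemma bernoulli_le (x : R) n : x <= 1 -> 1 - n%:R * x <= (1 - x) ^+ n.
Proof.
move=> x1; elim: n => [|n ih]; first by rewrite mul0r subr0 expr0.
rewrite exprS (@le_trans _ _ ((1 - x) * (1 - n%:R * x)))//.
  have : 0 <= n%:R * x ^+ 2 by apply: mulr_ge0 => //; exact: sqr_ge0.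
  by rewrite -natr1 expr2; lra.
by rewrite ler_wpM2l// subr_ge0.
Qed.

Lemma cvg0_squeeze (T : Type) (F : set_system T) {FF : Filter F}
  (u v : T -> R) : (forall x, 0 <= u x <= v x) ->
  v x @[x --> F] --> (0 : R) -> u x @[x --> F] --> (0 : R).
Proof.
move=> uv v0; apply: (@squeeze_cvgr _ F _ _ (fun=> 0) v u _ _ _ v0).
  exact: nearW.
exact: cvg_cst.
Qed.

Lemma cvg_sum_ord (T : Type) (F : set_system T) {FF : Filter F}
  (u : nat -> T -> R) (l : nat -> R) N : (forall n, u n x @[x --> F] --> l n) ->
  \sum_(n < N) u n x @[x --> F] --> \sum_(n < N) l n.
Proof.
move=> h; elim: N => [|N ih].
  by rewrite big_ord0; under eq_fun do rewrite big_ord0; exact: cvg_cst.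
rewrite big_ord_recr /=; under eq_fun do rewrite big_ord_recr /=.
by apply: cvgD => //; exact: h.
Qed.

Lemma nondecreasing_sum (u : nat -> R) : (forall n, 0 <= u n) ->
  nondecreasing_seq (fun N => \sum_(0 <= n < N) u n).
Proof.
by move=> u0 n m nm; rewrite [leRHS](big_cat_nat (leq0n n) nm)/= lerDl sumr_ge0.
Qed.

Lemma series_bounded (u : nat -> R) : (forall n, 0 <= u n) -> cvgn (series u) ->
  forall N, \sum_(n < N) u n <= limn (series u).
Proof.
move=> u0 cu N; rewrite -(big_mkord xpredT u).
exact: nondecreasing_cvgn_le (nondecreasing_sum u0) cu N.
Qed.

Lemma bounded_sum_tail (u : nat -> R) M e : (forall n, 0 <= u n) ->
  (forall N, \sum_(0 <= n < N) u n <= M) -> 0 < e ->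
  exists n0, forall N, (n0 <= N)%N -> \sum_(n0 <= n < N) u n <= e.
Proof.
move=> u0 hM e0; pose s N := \sum_(0 <= n < N) u n.
have nd : nondecreasing_seq s := nondecreasing_sum u0.
have cs : cvgn s.
  by apply: nondecreasing_is_cvgn => //; exists M => _ [N _ <-]; exact: hM.
have lt : limn s - e < limn s by lra.
have [n0 _ h] := cvgr_gt _ cs _ lt; have := h n0 (leqnn n0) => /= hn0.
exists n0 => N nN; have := nondecreasing_cvgn_le nd cs N.
by rewrite /s (big_cat_nat (leq0n n0) nN)/= -/(s n0); lra.
Qed.

End RealSequences.

(** * The modulus of a complex number *)

Section Modulus.
Context (R : realType).
Implicit Types z w : R[i].

Lemma cmod_ge0 z : 0 <= cmod z.
Proof. by case: z => a b; exact: sqrtr_ge0. Qed.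

Lemma cmodE z : (cmod z)%:C%C = `|z|.
Proof. by case: z. Qed.

Lemma cmod0 : cmod (0 : R[i]) = 0.
Proof. exact: ComplexField.Normc.normc0. Qed.

Lemma cmod1 : cmod (1 : R[i]) = 1.
Proof. exact: ComplexField.Normc.normc1. Qed.

Lemma cmodM z w : cmod (z * w) = cmod z * cmod w.
Proof. exact: ComplexField.Normc.normcM. Qed.

Lemma cmodX z n : cmod (z ^+ n) = cmod z ^+ n.
Proof.
by elim: n => [|n ih]; rewrite ?expr0 ?cmod1// !exprS cmodM ih.
Qed.

Lemma cmodV z : cmod z^-1 = (cmod z)^-1.
Proof. exact: ComplexField.Normc.normcV. Qed.

Lemma cmodN z : cmod (- z) = cmod z.
Proof. exact: normcN. Qed.

Lemma ler_cmodD z w : cmod (z + w) <= cmod z + cmod w.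
Proof. exact: le_normcD. Qed.

Lemma ler_cmodB z w : cmod (z - w) <= cmod z + cmod w.
Proof. by rewrite -(cmodN w) ler_cmodD. Qed.

Lemma cmodBC z w : cmod (z - w) = cmod (w - z).
Proof. by rewrite -cmodN opprB. Qed.

Lemma ler_cmod_dist z w : cmod z - cmod w <= cmod (z - w).
Proof. by rewrite lerBlDr -{1}(subrK w z) ler_cmodD. Qed.

Lemma cmod_eq0 z : (cmod z == 0) = (z == 0).
Proof.
apply/eqP/eqP => [|->]; last exact: cmod0.
exact: ComplexField.Normc.eq0_normc.
Qed.

Lemma cmod_gt0 z : (0 < cmod z) = (z != 0).
Proof. by rewrite lt0r cmod_eq0 cmod_ge0 andbT. Qed.

Lemma cmod_sqr z : cmod z ^+ 2 = complex.Re z ^+ 2 + complex.Im z ^+ 2.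
Proof. by case: z => a b /=; rewrite sqr_sqrtr// addr_ge0 ?sqr_ge0. Qed.

Lemma cmod_conj z : cmod z^*%C = cmod z.
Proof. by case: z => a b /=; rewrite sqrrN. Qed.

Lemma cmod_real (x : R) : cmod x%:C%C = `|x|.
Proof. by rewrite /cmod /= expr0n addr0 sqrtr_sqr. Qed.

Lemma cmod_nat n : cmod (n%:R : R[i]) = n%:R.
Proof.
by rewrite -(rmorph_nat (real_complex R)) cmod_real ger0_norm// ler0n.
Qed.

Lemma Re_le_cmod z : `|complex.Re z| <= cmod z.
Proof. by rewrite -lecR cmodE normc_ge_Re. Qed.

Lemma Im_le_cmod z : `|complex.Im z| <= cmod z.
Proof.
case: z => a b; have := Re_le_cmod (b +i* a)%C.
by rewrite /cmod /= addrC.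
Qed.

Lemma cmod_le_ReIm z : cmod z <= `|complex.Re z| + `|complex.Im z|.
Proof.
rewrite -(ler_pXn2r (ltn0Sn 1)) ?nnegrE ?addr_ge0 ?cmod_ge0//.
rewrite cmod_sqr -(real_normK (num_real (complex.Re z))).
rewrite -(real_normK (num_real (complex.Im z))) sqrrD lerD2r lerDl.
by rewrite mulrn_wge0// mulr_ge0.
Qed.

Lemma ler_cmod_sum (I : Type) (r : seq I) (P : pred I) (F : I -> R[i]) :
  cmod (\sum_(i <- r | P i) F i) <= \sum_(i <- r | P i) cmod (F i).
Proof.
elim/big_ind2: _ => [|x1 x2 y1 y2 h1 h2|//]; first by rewrite cmod0.
by rewrite (le_trans (ler_cmodD _ _))// lerD.
Qed.

Lemma sqr_cmodD z w : cmod (z + w) ^+ 2 <= 2 * cmod z ^+ 2 + 2 * cmod w ^+ 2.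
Proof.
have : cmod (z + w) ^+ 2 <= (cmod z + cmod w) ^+ 2.
  by rewrite ler_pXn2r ?nnegrE ?addr_ge0 ?cmod_ge0// ler_cmodD.
have := sqr_ge0 (cmod z - cmod w); nra.
Qed.

Lemma cmod_cis t : cmod (cis t : R[i]) = 1.
Proof. by rewrite /cmod /cis /= cos2Dsin2 sqrtr1. Qed.

Lemma cisD s t : cis (s + t) = cis s * cis t :> R[i].
Proof. by rewrite /cis cosD sinD; simpc; congr (_ +i* _)%C; ring. Qed.

(** Both squares expand to [1 - 2 Re (z * conj a) + |a|^2] when [|z| = 1]. *)
Lemma cmod_sub_circle a z : cmod z = 1 -> cmod (1 - a^*%C * z) = cmod (z - a).
Proof.
move=> z1; apply/eqP; rewrite -(eqrXn2 (ltn0Sn 1)) ?cmod_ge0//; apply/eqP.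
have := cmod_sqr z; rewrite z1 !cmod_sqr; case: a z {z1} => a b [x y] /= e.
by move: e; simpc => /= e; nra.
Qed.

End Modulus.

Arguments cmod : simpl never.

(** * Blaschke factors acting on coefficient sequences *)

Section Blaschke.
Context (R : realType).
Implicit Types (a w : R[i]) (f : nat -> R[i]).

(** Coefficients of [f / (1 - conj a * z)]. *)
Fixpoint kernel_div a f n : R[i] :=
  if n is m.+1 then f n + a^*%C * kernel_div a f m else f 0.

Definition shift_seq f n : R[i] := if n is m.+1 then f m else 0.

(** Coefficients of [f] times the Blaschke factor [(z - a) / (1 - conj a z)]. *)
Definition blaschke_mul a f n : R[i] :=
  shift_seq (kernel_div a f) n - a * kernel_div a f n.

Lemma kernel_divK a f n :
  f n = kernel_div a f n - a^*%C * shift_seq (kernel_div a f) n.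
Proof. by case: n => [|n] /=; rewrite ?mulr0 ?subr0 // addrK. Qed.

(** With [x] and [y] the coefficients of index [n - 1] and [n] of
    [f / (1 - conj a z)], this is
    [|x - a y|^2 - |y - conj a x|^2 = (1 - |a|^2) (|x|^2 - |y|^2)]. *)
Lemma sqr_blaschke_mul a f n : cmod (blaschke_mul a f n) ^+ 2 =
  cmod (f n) ^+ 2 + (1 - cmod a ^+ 2) *
   (cmod (shift_seq (kernel_div a f) n) ^+ 2
     - cmod (kernel_div a f n) ^+ 2).
Proof.
rewrite [in RHS](kernel_divK a f n) /blaschke_mul.
move: (kernel_div a f n) (shift_seq _ n) => x y.
rewrite !cmod_sqr; case: a x y => [a b] [x1 x2] [y1 y2] /=; simpc => /=; ring.
Qed.

Lemma sum_sqr_blaschke_mul a f N : \sum_(n < N.+1) cmod (blaschke_mul a f n) ^+ 2 =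
  \sum_(n < N.+1) cmod (f n) ^+ 2
    - (1 - cmod a ^+ 2) * cmod (kernel_div a f N) ^+ 2.
Proof.
elim: N => [|N ih].
  by rewrite !big_ord1 sqr_blaschke_mul /= cmod0; ring.
by rewrite big_ord_recr /= ih [in RHS]big_ord_recr /= sqr_blaschke_mul; ring.
Qed.

(** The correction terms of [sqr_blaschke_mul] telescope; summed by parts against
    the weight [n], they leave the squared norm of [f / (1 - conj a z)]. The effect
    of a Blaschke factor on the Dirichlet integral is thus explicit. *)
Lemma sum_weighted_sqr_blaschke_mul a f N :
  \sum_(n < N.+1) n%:R * cmod (blaschke_mul a f n) ^+ 2 =
  \sum_(n < N.+1) n%:R * cmod (f n) ^+ 2 + (1 - cmod a ^+ 2) *
   (\sum_(n < N) cmod (kernel_div a f n) ^+ 2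
     - N%:R * cmod (kernel_div a f N) ^+ 2).
Proof.
elim: N => [|N ih].
  by rewrite !big_ord1 big_ord0 /=; ring.
rewrite big_ord_recr /= ih [in RHS]big_ord_recr /= sqr_blaschke_mul.
rewrite (big_ord_recr N (fun n : 'I_N.+1 => cmod (kernel_div a f n) ^+ 2)) /=.
by rewrite -natr1; ring.
Qed.

Lemma sqr_cmod_lt1 a : cmod a < 1 -> 0 <= 1 - cmod a ^+ 2.
Proof. by move=> a1; rewrite subr_ge0 expr_le1 ?cmod_ge0// ltW. Qed.

Lemma sum_sqr_blaschke_mul_le a f N : cmod a < 1 ->
  \sum_(n < N) cmod (blaschke_mul a f n) ^+ 2 <= \sum_(n < N) cmod (f n) ^+ 2.
Proof.
move=> a1; case: N => [|N]; first by rewrite !big_ord0.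
rewrite sum_sqr_blaschke_mul lerBlDr lerDl.
by rewrite mulr_ge0 ?sqr_ge0 ?sqr_cmod_lt1.
Qed.

Lemma sum_weighted_sqr_blaschke_mul_le a f N : cmod a < 1 ->
  \sum_(n < N.+1) n%:R * cmod (blaschke_mul a f n) ^+ 2 <=
  \sum_(n < N.+1) n%:R * cmod (f n) ^+ 2
   + (1 - cmod a ^+ 2) * \sum_(n < N) cmod (kernel_div a f n) ^+ 2.
Proof.
move=> a1; rewrite sum_weighted_sqr_blaschke_mul lerD2l ler_wpM2l ?sqr_cmod_lt1//.
by rewrite lerBlDr lerDl mulr_ge0 ?sqr_ge0.
Qed.

(** The recursion says that [(1 - conj a z) u = f]; solving it uniquely makes the
    operators below commute as multiplications by power series do. *)
Lemma kernel_div_uniq a f u :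
  (forall n, u n = f n + a^*%C * shift_seq u n) -> u = kernel_div a f.
Proof.
move=> h; apply/funext; elim=> [|n ih]; rewrite h /= ?mulr0 ?addr0//.
by rewrite ih.
Qed.

Lemma kernel_div_shift a f :
  kernel_div a (shift_seq f) = shift_seq (kernel_div a f).
Proof.
apply/esym/kernel_div_uniq; case=> [|n] /=; first by rewrite mulr0 addr0.
by rewrite {1}(kernel_divK a f n) subrK.
Qed.

Lemma kernel_div_lin a f g c :
  kernel_div a (fun n => f n - c * g n) =
  (fun n => kernel_div a f n - c * kernel_div a g n).
Proof.
apply/esym/kernel_div_uniq => n.
rewrite {1}(kernel_divK a f n) {1}(kernel_divK a g n).
by case: n => [|n] /=; ring.
Qed.

Lemma kernel_div_comm a b f :
  kernel_div a (kernel_div b f) = kernel_div b (kernel_div a f).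
Proof.
apply: kernel_div_uniq => n; set u := kernel_div a _.
suff -> : kernel_div a f = (fun n => u n - b^*%C * shift_seq u n) by rewrite subrK.
rewrite /u -kernel_div_shift -kernel_div_lin; congr kernel_div.
by apply/funext => m; exact: kernel_divK.
Qed.

Lemma kernel_div_blaschke_mul a b f :
  kernel_div a (blaschke_mul b f) = blaschke_mul b (kernel_div a f).
Proof.
by rewrite /blaschke_mul kernel_div_lin kernel_div_shift kernel_div_comm.
Qed.

(** Dividing out a further factor [b] first can only decrease the correction due
    to [a]: this keeps the corrections of a product bounded by those computed from
    the initial function. *)
Lemma sum_sqr_kernel_div_blaschke_mul_le a b f N : cmod b < 1 ->
  \sum_(n < N) cmod (kernel_div a (blaschke_mul b f) n) ^+ 2 <=
  \sum_(n < N) cmod (kernel_div a f n) ^+ 2.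
Proof. by move=> b1; rewrite kernel_div_blaschke_mul sum_sqr_blaschke_mul_le. Qed.

End Blaschke.

(** * Invariance of plane Lebesgue measure under scalings and rotations *)

Section Affine.
Local Open Scope ereal_scope.
Context (R : realType).
Local Notation mu := (@lebesgue_measure R).
Local Notation T := (measurableTypeR R).

Lemma measurable_affine (a b : R) :
  measurable_fun [set: T] (fun x : T => (a * x + b)%R : T).
Proof. by apply: measurable_funD => //; exact: measurable_funM. Qed.

(** The image measure under the affine map, multiplied by its slope, gives every
    interval its length, hence it is Lebesgue measure. *)
Lemma ge0_integral_affine (a b : R) (f : T -> \bar R) : (0 < a)%R ->
  measurable_fun [set: T] f -> (forall x, 0 <= f x) ->
  \int[mu]_x f x = a%:E * \int[mu]_x f (a * x + b)%R.
Proof.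
move=> a0 mf f0; pose g : T -> T := fun x => (a * x + b)%R.
have mg : measurable_fun [set: T] g by exact: measurable_affine.
have [m mE] : exists m : {measure set T -> \bar R},
    m = mscale (NngNum (ltW a0)) (pushforward mu g) :> (set T -> \bar R).
  by eexists; exact: erefl.
transitivity (\int[m]_x f x); last first.
  rewrite mE ge0_integral_mscale//; congr (_ * _).
  by rewrite (ge0_integral_pushforward mg)// preimage_setT.
apply: eq_measure_integral => A mA _.
apply: lebesgue_measure_unique => // _ [[c d] /= cd] <-.
rewrite mE /mscale/= /pushforward.
have -> : g @^-1` `]c, d]%classic = `]((c - b) / a)%R, ((d - b) / a)%R]%classic.
  apply/seteqP; split => x /=; rewrite !in_itv/= ltr_pdivrMr// ler_pdivlMr//;
  by rewrite ltrBlDr lerBrDr mulrC.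
rewrite !lebesgue_measure_itv/= !lte_fin ltr_pM2r ?invr_gt0// ltrD2r.
case: ifPn => _; last by rewrite mule0.
rewrite -!EFinB -EFinM; congr EFin.
by rewrite -mulrBl mulrCA mulfV ?gt_eqF// mulr1; ring.
Qed.

Lemma ge0_integral_translate (b : R) (f : T -> \bar R) :
  measurable_fun [set: T] f -> (forall x, 0 <= f x) ->
  \int[mu]_x f (x + b)%R = \int[mu]_x f x.
Proof.
move=> mf f0; rewrite [RHS](@ge0_integral_affine 1 b)// mul1e.
by apply: eq_integral => x _; rewrite mul1r.
Qed.

End Affine.

Section Plane.
Local Open Scope ereal_scope.
Context (R : realType).
Local Notation mu := (@lebesgue_measure R).
Local Notation T := (measurableTypeR R).
Local Notation mu2 := (mu \x mu).
Implicit Types F : T * T -> \bar R.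

Lemma measurable_plane_linear (a b c d : R) : measurable_fun [set: T * T]
  (fun p : T * T => ((a * p.1 + b * p.2)%R : T, (c * p.1 + d * p.2)%R : T)).
Proof.
apply/measurable_fun_pair => /=; apply: measurable_funD;
  by apply: measurable_funM.
Qed.

Lemma integral_shear1 (a : R) F : measurable_fun setT F -> (forall p, 0 <= F p) ->
  \int[mu2]_p F ((1 * p.1 + a * p.2)%R, (0 * p.1 + 1 * p.2)%R) = \int[mu2]_p F p.
Proof.
move=> mF F0; rewrite !fubini_tonelli2//; last first.
  by apply: measurableT_comp => //; exact: measurable_plane_linear.
apply: eq_integral => y _; rewrite /fubini_G /=.
rewrite -[RHS](@ge0_integral_translate R (a * y)%R)//.
  by apply: eq_integral => x _; rewrite mul1r mul0r add0r mul1r.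
exact: measurableT_comp mF (pair2_measurable _).
Qed.

Lemma integral_shear2 (a : R) F : measurable_fun setT F -> (forall p, 0 <= F p) ->
  \int[mu2]_p F ((1 * p.1 + 0 * p.2)%R, (a * p.1 + 1 * p.2)%R) = \int[mu2]_p F p.
Proof.
move=> mF F0; rewrite !fubini_tonelli1//; last first.
  by apply: measurableT_comp => //; exact: measurable_plane_linear.
apply: eq_integral => x _; rewrite /fubini_F /=.
rewrite -[RHS](@ge0_integral_translate R (a * x)%R)//.
  by apply: eq_integral => y _; rewrite !mul1r mul0r addr0 addrC.
exact: measurableT_comp mF (pair1_measurable _).
Qed.

Lemma integral_scale (r : R) F : (0 < r)%R -> measurable_fun setT F ->
  (forall p, 0 <= F p) ->
  \int[mu2]_p F p = (r ^+ 2)%:E * \int[mu2]_p F ((r * p.1)%R, (r * p.2)%R).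
Proof.
move=> r0 mF F0.
have mF' : measurable_fun setT (fun p : T * T => F ((r * p.1)%R, (r * p.2)%R)).
  apply: measurableT_comp => //.
  by apply/measurable_fun_pair; exact: measurable_funM.
rewrite !fubini_tonelli2//.
rewrite (@ge0_integral_affine R r 0%R)//; last 2 first.
  exact: measurable_fun_fubini_tonelli_G.
  by move=> y; exact: integral_ge0.
rewrite expr2 EFinM -muleA; congr (_ * _).
rewrite -ge0_integralZl//; last 3 first.
  by apply: measurable_fun_fubini_tonelli_G.
  by move=> y _; exact: integral_ge0.
  by rewrite lee_fin ltW.
apply: eq_integral => y _; rewrite /fubini_G /= addr0.
rewrite [LHS](@ge0_integral_affine R r 0%R)//; last exact: measurableT_comp mF (pair2_measurable _).
by congr (_ * _); apply: eq_integral => x _; rewrite addr0.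
Qed.

(** A rotation is the product of three shears, with parameters
    [- tan (t / 2)], [sin t] and [- tan (t / 2)], and a shear is a translation in
    each line of one direction. The half-angle tangent excludes the half-turn. *)
Lemma integral_rotate (c s : R) F : (c ^+ 2 + s ^+ 2 = 1)%R -> (1 + c != 0)%R ->
  measurable_fun setT F -> (forall p, 0 <= F p) ->
  \int[mu2]_p F ((c * p.1 + (- s) * p.2)%R, (s * p.1 + c * p.2)%R) =
  \int[mu2]_p F p.
Proof.
move=> cs c1 mF F0; pose t := (s / (1 + c))%R.
have tc : (t * (1 + c) = s)%R by rewrite mulrVK// unitfE.
have ts : (t * s = 1 - c)%R.
  by apply: (mulIf c1); rewrite mulrAC tc; nra.
have msh a : measurable_fun setT
    (fun p : T * T => F ((1 * p.1 + a * p.2)%R, (0 * p.1 + 1 * p.2)%R)).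
  by apply: measurableT_comp => //; exact: measurable_plane_linear.
rewrite -[RHS](@integral_shear1 (- t)%R)//.
rewrite -[RHS](@integral_shear2 s)//.
rewrite -[RHS](@integral_shear1 (- t)%R)//; last first.
  by apply: measurableT_comp (msh _) _; exact: measurable_plane_linear.
apply: eq_integral => -[x y] _ /=; congr F; congr pair.
  transitivity ((1 - t * s) * x + (- (t * (1 + (1 - t * s)))) * y)%R; last by ring.
  have e : (1 - t * s = c)%R by rewrite ts; ring.
  by rewrite e tc.
transitivity (s * x + (1 - t * s) * y)%R; last by ring.
by congr (_ + _ * _)%R; rewrite ts; ring.
Qed.

End Plane.

(** * Parseval's identity on finitely many rotates *)

Section DiscreteParseval.
Context (R : realType).

Definition root_of_unity (m : nat) : R[i] := cis (2 * pi / m%:R).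

Arguments root_of_unity : simpl never.

Lemma cisX (t : R) n : cis t ^+ n = cis (n%:R * t) :> R[i].
Proof.
elim: n => [|n ih]; first by rewrite expr0 mul0r /cis cos0 sin0.
by rewrite exprS ih -cisD -natr1; congr cis; ring.
Qed.

Lemma cis2pi : cis (2 * pi) = 1 :> R[i].
Proof.
by rewrite /cis mulr_natl cos2pi sin2pi.
Qed.

(** The real part of [1 - cis t] is [2 sin (t / 2) ^ 2]. *)
Lemma cis_neq1 (t : R) : 0 < t < 2 * pi -> cis t != 1 :> R[i].
Proof.
move=> /andP[t0 tpi]; apply/negP => /eqP e.
have s0 : 0 < sin (t / 2) by apply: sin_gt0_pi; lra.
have := congr1 (@complex.Re R) e; rewrite /cis /=.
have -> : t = t / 2 + t / 2 by lra.
rewrite cosD => c1.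
by have := cos2Dsin2 (t / 2); nra.
Qed.

Lemma root_of_unity_prim m : (0 < m)%N -> m.-primitive_root (root_of_unity m).
Proof.
move=> m0; have m0' : 0 < m%:R :> R by rewrite ltr0n.
have rm : root_of_unity m ^+ m = 1.
  by rewrite /root_of_unity cisX mulrC divfK ?gt_eqF// cis2pi.
apply/andP; split => //; apply/forallP => -[i im] /=.
rewrite unity_rootE; apply/eqP; have [e|ne] := eqVneq i.+1 m.
  by rewrite e rm eqxx.
apply/negP; rewrite /root_of_unity cisX; apply/negP/cis_neq1.
rewrite mulrA divr_gt0 ?mulr_gt0 ?pi_gt0//=.
rewrite ltr_pdivrMr// mulrC ltr_pM2l ?mulr_gt0 ?pi_gt0// ltr_nat.
by rewrite ltn_neqAle ne.
Qed.

Lemma cmod_root_of_unity m : cmod (root_of_unity m) = 1.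
Proof. exact: cmod_cis. Qed.

Lemma sqr_cmodE (z : R[i]) : (cmod z ^+ 2)%:C%C = z * z^*%C.
Proof. by rewrite rmorphXn /= cmodE sqr_normc. Qed.

Lemma sum_root_of_unity_powers m n l : (n < m)%N -> (l < m)%N ->
  \sum_(k < m) (root_of_unity m ^+ n * (root_of_unity m)^*%C ^+ l) ^+ k =
  if n == l then m%:R else 0.
Proof.
move=> nm lm; have m0 : (0 < m)%N by case: (m) nm.
have pr := root_of_unity_prim m0; set w := root_of_unity m in pr *.
have ww : w * w^*%C = 1 by rewrite -sqr_cmodE cmod_root_of_unity expr1n.
have [<-|nl] := eqVneq n l.
  rewrite -exprMn ww expr1n; under eq_bigr do rewrite expr1n.
  by rewrite sumr_const card_ord.
set q := _ * _; have q1 : q != 1.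
  apply/eqP => e; have : w ^+ n = w ^+ l.
    have := congr1 (fun x => x * w ^+ l) e.
    by rewrite /q -mulrA -exprMn [w^*%C * w]mulrC ww expr1n mulr1 mul1r.
  by move/eqP; rewrite (eq_prim_root_expr pr) !modn_small//; apply/negP.
apply: (@mulfI _ (q - 1)); first by rewrite subr_eq0.
rewrite -subrX1 mulr0 /q exprMn -!exprM ![(_ * m)%N]mulnC !exprM.
rewrite (prim_expr_order pr) expr1n mul1r.
rewrite -rmorphXn /= (prim_expr_order pr) rmorph1 expr1n subrr//.
Qed.

(** Averaging over the [m] rotates of [z] kills the products of distinct
    monomials of degree less than [m]. *)
Lemma discrete_parseval m (c : nat -> R[i]) (z : R[i]) :
  \sum_(k < m) cmod (\sum_(n < m) c n * (root_of_unity m ^+ k * z) ^+ n) ^+ 2 =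
  m%:R * \sum_(n < m) cmod (c n) ^+ 2 * cmod z ^+ (2 * n).
Proof.
apply: (@complexI R); rewrite rmorph_sum rmorphM rmorph_nat rmorph_sum /=.
set w := root_of_unity m; pose d n := c n * z ^+ n.
transitivity (\sum_(k < m) \sum_(n < m) \sum_(l < m)
    (d n * (d l)^*%C) * (w ^+ n * w^*%C ^+ l) ^+ k).
  apply: eq_bigr => k _; rewrite sqr_cmodE.
  rewrite big_distrl /=; apply: eq_bigr => n _.
  rewrite rmorph_sum big_distrr /=; apply: eq_bigr => l _.
  rewrite /d !(rmorphM, rmorphXn) /= !exprMn.
  by rewrite -!exprM ![(k * _)%N]mulnC; ring.
rewrite exchange_big /= mulr_sumr; apply: eq_bigr => n _.
rewrite exchange_big /= (bigD1 n)//= [X in _ + X]big1 ?addr0.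
  rewrite -mulr_sumr sum_root_of_unity_powers// eqxx /d.
  rewrite -[LHS]mulrC; congr (_ * _).
  rewrite -sqr_cmodE cmodM cmodX exprMn -exprM [(n * 2)%N]mulnC.
  by rewrite rmorphM.
move=> l nl; rewrite -mulr_sumr sum_root_of_unity_powers//.
by rewrite val_eqE eq_sym (negPf nl) mulr0.
Qed.

End DiscreteParseval.

(** * Measurability of complex-valued functions *)

Section ComplexMeasurable.
Context d (T : measurableType d) (R : realType).
Implicit Types f g : T -> R[i].

Definition measurable_cplx f := measurable_fun setT (fun x => complex.Re (f x)) /\
  measurable_fun setT (fun x => complex.Im (f x)).

Lemma measurable_cplx_cst c : measurable_cplx (fun=> c).
Proof. by split; exact: measurable_cst. Qed.

Lemma measurable_cplxD f g : measurable_cplx f -> measurable_cplx g ->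
  measurable_cplx (fun x => f x + g x).
Proof.
move=> [f1 f2] [g1 g2]; split.
  apply: eq_measurable_fun (measurable_funD f1 g1) => x _ /=.
  by case: (f x) (g x) => [a b] [a' b'].
apply: eq_measurable_fun (measurable_funD f2 g2) => x _ /=.
by case: (f x) (g x) => [a b] [a' b'].
Qed.

Lemma measurable_cplxM f g : measurable_cplx f -> measurable_cplx g ->
  measurable_cplx (fun x => f x * g x).
Proof.
move=> [f1 f2] [g1 g2]; split.
  apply: eq_measurable_fun (measurable_funB (measurable_funM f1 g1)
    (measurable_funM f2 g2)) => x _ /=.
  by case: (f x) (g x) => [a b] [a' b'].
apply: eq_measurable_fun (measurable_funD (measurable_funM f1 g2)
  (measurable_funM f2 g1)) => x _ /=.
by case: (f x) (g x) => [a b] [a' b'].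
Qed.

Lemma measurable_cplxX f n : measurable_cplx f -> measurable_cplx (fun x => f x ^+ n).
Proof.
move=> mf; elim: n => [|n ih]; first exact: measurable_cplx_cst.
by under eq_fun do rewrite exprS; exact: measurable_cplxM.
Qed.

Lemma measurable_cplx_sum n (F : nat -> T -> R[i]) :
  (forall i, measurable_cplx (F i)) ->
  measurable_cplx (fun x => \sum_(i < n) F i x).
Proof.
move=> mF; elim: n => [|n ih].
  by under eq_fun do rewrite big_ord0; exact: measurable_cplx_cst.
by under eq_fun do rewrite big_ord_recr /=; exact: measurable_cplxD.
Qed.

Lemma measurable_cplx_poly f (c : nat -> R[i]) n : measurable_cplx f ->
  measurable_cplx (fun x => \sum_(i < n) c i * f x ^+ i).
Proof.
move=> mf; apply: (measurable_cplx_sum n (F := fun i x => c i * f x ^+ i)) => i.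
by apply: measurable_cplxM; [exact: measurable_cplx_cst|exact: measurable_cplxX].
Qed.

Lemma measurable_sqr_cmod f : measurable_cplx f ->
  measurable_fun setT (fun x => cmod (f x) ^+ 2).
Proof.
move=> [f1 f2]; under eq_fun do rewrite cmod_sqr.
by apply: measurable_funD; exact: measurable_funX.
Qed.

End ComplexMeasurable.

(** * The Dirichlet integral of a polynomial *)

Section DiskIntegral.
Local Open Scope ereal_scope.
Context (R : realType).
Local Notation mu := (@lebesgue_measure R).
Local Notation T := (measurableTypeR R).
Local Notation mu2 := (mu \x mu).

Definition plane_point (p : T * T) : R[i] := (p.1 +i* p.2)%C.
Local Notation pt := plane_point.

Definition plane_disk (r : R) : set (T * T) := [set p | (cmod (pt p) < r)%R].

Lemma measurable_plane_point : measurable_cplx plane_point.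
Proof. by split; [exact: measurable_fst|exact: measurable_snd]. Qed.

Lemma measurable_plane_disk r : (0 < r)%R -> measurable (plane_disk r).
Proof.
move=> r0; have -> : plane_disk r =
    setT `&` (fun p => cmod (pt p) ^+ 2)%R @^-1` `]-oo, (r ^+ 2)%R[%classic.
  rewrite setTI; apply/seteqP; split => p /=; rewrite in_itv/=;
  by rewrite ltr_pXn2r// nnegrE ?cmod_ge0 ?ltW.
apply: measurable_sqr_cmod => //; exact: measurable_plane_point.
Qed.

Lemma pt_rotate (w : R[i]) (p : T * T) :
  pt ((complex.Re w * p.1 + - complex.Im w * p.2)%R,
      (complex.Im w * p.1 + complex.Re w * p.2)%R) = (w * pt p)%R.
Proof. by case: w p => [a b] [x y]; rewrite /pt /=; simpc; congr (_ +i* _)%C; ring. Qed.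

Lemma measurable_comp_rotate (w : R[i]) (h : R[i] -> \bar R) :
  measurable_fun setT (h \o pt) ->
  measurable_fun setT (fun p => h (w * pt p)%R).
Proof.
move=> mh; under eq_fun do rewrite -pt_rotate.
apply: (measurableT_comp mh); exact: measurable_plane_linear.
Qed.

Lemma integral_disk_rotate (w : R[i]) r (h : R[i] -> \bar R) : (0 < r)%R ->
  cmod w = 1%R -> (1 + complex.Re w != 0)%R -> measurable_fun setT (h \o pt) ->
  (forall z, 0 <= h z) ->
  \int[mu2]_(p in plane_disk r) h (w * pt p)%R =
  \int[mu2]_(p in plane_disk r) h (pt p).
Proof.
move=> r0 w1 w2 mh h0; rewrite integral_mkcond [RHS]integral_mkcond.
rewrite -[RHS](@integral_rotate R (complex.Re w) (complex.Im w))//; first last.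
- by move=> p; rewrite patchE; case: ifP.
- apply/(measurable_restrictT _ (measurable_plane_disk r0)).
  exact: measurable_funTS.
- by rewrite -cmod_sqr w1 expr1n.
apply: eq_integral => p _; rewrite !patchE pt_rotate.
have -> : (((complex.Re w * p.1 + - complex.Im w * p.2)%R,
   (complex.Im w * p.1 + complex.Re w * p.2)%R) \in plane_disk r) =
   (p \in plane_disk r).
  apply/idP/idP; rewrite !inE /plane_disk /= pt_rotate cmodM w1 mul1r//.
by [].
Qed.

Lemma integral_disk_rotateX (w : R[i]) r (h : R[i] -> \bar R) k : (0 < r)%R ->
  cmod w = 1%R -> (1 + complex.Re w != 0)%R -> measurable_fun setT (h \o pt) ->
  (forall z, 0 <= h z) ->
  \int[mu2]_(p in plane_disk r) h (w ^+ k * pt p)%R =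
  \int[mu2]_(p in plane_disk r) h (pt p).
Proof.
move=> r0 w1 w2 mh h0; elim: k => [|k ih].
  by apply: eq_integral => p _; rewrite expr0 mul1r.
rewrite -ih; under eq_integral do rewrite exprSr -mulrA.
rewrite (@integral_disk_rotate w r (fun z => h (w ^+ k * z)%R))//.
exact: measurable_comp_rotate.
Qed.

Lemma pmule_inj (x : R) (A B : \bar R) : (0 < x)%R -> x%:E * A = x%:E * B -> A = B.
Proof.
move=> x0 e; have K C : C = (x^-1)%:E * (x%:E * C).
  by rewrite muleA -EFinM mulVf ?mul1e ?gt_eqF.
by rewrite (K A) e -K.
Qed.

Definition disk_moment r n : \bar R :=
  \int[mu2]_(p in plane_disk r) (cmod (pt p) ^+ (2 * n))%:E.

Lemma measurable_cmod_pow n :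
  measurable_fun setT (fun p => cmod (pt p) ^+ (2 * n))%R.
Proof.
under eq_fun do rewrite exprM.
apply: measurable_funX; apply: measurable_sqr_cmod; exact: measurable_plane_point.
Qed.

(** The integral over the disk is unchanged when the integrand is replaced by its
    average over [m] rotates, which [discrete_parseval] computes. With at least
    three rotates the angle [2 pi / m] is less than [pi], as [integral_rotate]
    requires. *)
Lemma integral_disk_poly m (c : nat -> R[i]) r : (2 < m)%N -> (0 < r)%R ->
  \int[mu2]_(p in plane_disk r) (cmod (\sum_(n < m) c n * pt p ^+ n)%R ^+ 2)%:E =
  \sum_(n < m) (cmod (c n) ^+ 2)%:E * disk_moment r n.
Proof.
move=> m3n r0; pose w : R[i] := root_of_unity R m.
pose h (z : R[i]) : \bar R := (cmod (\sum_(n < m) c n * z ^+ n)%R ^+ 2)%:E.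
have h0 z : 0 <= h z by rewrite lee_fin sqr_ge0.
have mh : measurable_fun setT (h \o pt).
  apply/measurable_EFinP/measurable_sqr_cmod/measurable_cplx_poly.
  exact: measurable_plane_point.
have m3 : (3 <= m%:R :> R)%R by rewrite ler_nat.
have m0 : (0 < m%:R :> R)%R by lra.
have w2 : (1 + complex.Re w != 0)%R.
  rewrite /w /root_of_unity /cis /=; apply/eqP => c1.
  have s0 : (0 < sin (2 * pi / m%:R) :> R)%R.
    have p0 := pi_gt0 R.
    apply: sin_gt0_pi; rewrite divr_gt0 ?mulr_gt0//=.
    rewrite ltr_pdivrMr//.
    by rewrite mulrC ltr_pM2l// ltr_nat.
  have := cos2Dsin2 (2 * pi / m%:R : R).
  have -> : (cos (2 * pi / m%:R) = -1 :> R)%R by lra.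
  by rewrite sqrrN expr1n; nra.
have mD := measurable_plane_disk r0.
suff e : m%:R%:E * \int[mu2]_(p in plane_disk r) h (pt p) =
    m%:R%:E * \sum_(n < m) (cmod (c n) ^+ 2)%:E * disk_moment r n.
  exact: (pmule_inj m0 e).
transitivity (\sum_(k < m) \int[mu2]_(p in plane_disk r) h (w ^+ k * pt p)%R).
  rewrite (eq_bigr (fun=> \int[mu2]_(p in plane_disk r) h (pt p))); last first.
    by move=> k _; rewrite integral_disk_rotateX// cmod_root_of_unity.
  have -> : m%:R%:E = \sum_(k < m) 1%:E :> \bar R.
    by rewrite sumEFin sumr_const card_ord.
  by rewrite ge0_sume_distrl//; apply: eq_bigr => k _; rewrite mul1e.
have mk k : measurable_fun setT (fun p => h (w ^+ k * pt p)%R).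
  exact: measurable_comp_rotate.
rewrite -ge0_integral_sum//; last by move=> k; exact: measurable_funTS.
transitivity (\int[mu2]_(p in plane_disk r) (\sum_(n < m)
    (m%:R * cmod (c n) ^+ 2)%:E * (cmod (pt p) ^+ (2 * n))%:E)).
  apply: eq_integral => p _; rewrite /h sumEFin discrete_parseval.
  rewrite mulr_sumr -sumEFin; apply: eq_bigr => n _.
  by rewrite -EFinM mulrA.
rewrite ge0_integral_sum//; last 2 first.
- move=> n; apply: measurable_funTS; apply/measurable_EFinP.
  by apply: measurable_funM => //; exact: measurable_cmod_pow.
- by move=> n p _; rewrite -EFinM lee_fin !mulr_ge0 ?exprn_ge0 ?cmod_ge0.
rewrite ge0_sume_distrr; last first.
  move=> n _; rewrite mule_ge0 ?lee_fin ?sqr_ge0//.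
  by apply: integral_ge0 => p _; rewrite lee_fin exprn_ge0// cmod_ge0.
apply: eq_bigr => n _; rewrite ge0_integralZl//; last 3 first.
- by apply: measurable_funTS; apply/measurable_EFinP; exact: measurable_cmod_pow.
- by move=> p _; rewrite lee_fin exprn_ge0// cmod_ge0.
- by rewrite lee_fin mulr_ge0// sqr_ge0.
by rewrite muleA -EFinM.
Qed.

End DiskIntegral.

(** * Moments of the disk *)

Section DiskMoment.
Local Open Scope ereal_scope.
Context (R : realType).
Local Notation mu := (@lebesgue_measure R).
Local Notation T := (measurableTypeR R).
Local Notation mu2 := (mu \x mu).
Local Notation pt := (@plane_point R).
Local Notation D := (@plane_disk R).
Local Notation I := (@disk_moment R).

Let m_pow n A : measurable_fun A (fun p => (cmod (pt p) ^+ (2 * n))%:E).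
Proof.
apply: measurable_funTS; apply/measurable_EFinP; exact: measurable_cmod_pow.
Qed.

Let pow_ge0 n p : 0 <= (cmod (pt p) ^+ (2 * n))%:E.
Proof. by rewrite lee_fin exprn_ge0// cmod_ge0. Qed.

Lemma disk_moment_scale r n : (0 < r)%R -> I r n = (r ^+ (2 * n.+1))%:E * I 1 n.
Proof.
move=> r0; rewrite /disk_moment integral_mkcond [in RHS]integral_mkcond.
rewrite (@integral_scale R r)//; last 2 first.
- apply/(measurable_restrictT _ (measurable_plane_disk r0)); exact: m_pow.
- by move=> p; rewrite patchE; case: ifP.
have -> : (r ^+ (2 * n.+1) = r ^+ 2 * r ^+ (2 * n))%R by rewrite mulnS exprD.
rewrite (EFinM (r ^+ 2)) -muleA; congr (_ * _).
rewrite -ge0_integralZl//; last 3 first.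
- apply/(measurable_restrictT _ (measurable_plane_disk ltr01)); exact: m_pow.
- by move=> p _; rewrite patchE; case: ifP.
- by rewrite lee_fin exprn_ge0// ltW.
apply: eq_integral => p _; rewrite !patchE.
have cs : cmod (pt ((r * p.1)%R, (r * p.2)%R)) = (r * cmod (pt p))%R.
  have -> : pt ((r * p.1)%R, (r * p.2)%R) = (r%:C%C * pt p)%R.
    by apply/eqP; rewrite eq_complex /= !mul0r subr0 addr0 !eqxx.
  by rewrite cmodM cmod_real gtr0_norm.
have -> : (((r * p.1)%R, (r * p.2)%R) \in D r) = (p \in D 1).
  by apply/idP/idP; rewrite !inE /plane_disk /= cs gtr_pMr.
by case: ifP => _; rewrite ?mule0// cs exprMn EFinM.
Qed.

Lemma disk_moment_ge0 r n : 0 <= I r n.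
Proof. exact: integral_ge0. Qed.

Lemma disk_measure_fin : mu2 (D 1) < +oo.
Proof.
apply: (@le_lt_trans _ _ (mu2 (`[(-1)%R, 1%R] `*` `[(-1)%R, 1%R]))).
  apply: le_measure; rewrite ?inE.
  - exact: measurable_plane_disk.
  - exact: measurableX.
  move=> p /= h; split => /=; rewrite in_itv/= -ler_norml.
    exact: le_trans (Re_le_cmod (pt p)) (ltW h).
  exact: le_trans (Im_le_cmod (pt p)) (ltW h).
rewrite product_measure1E//= !lebesgue_measure_itv/= !lte_fin.
by rewrite ifT ?ltry//; lra.
Qed.

Lemma disk_measure_gt0 : 0 < mu2 (D 1).
Proof.
apply: (@lt_le_trans _ _ (mu2 (`[0%R, 2^-1%R] `*` `[0%R, 2^-1%R]))).
  rewrite product_measure1E//= !lebesgue_measure_itv/= !lte_fin.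
  by rewrite ifT ?invr_gt0// -EFinB -EFinM lte_fin; lra.
apply: le_measure; rewrite ?inE.
- exact: measurableX.
- exact: measurable_plane_disk.
move=> p /= [] /=; rewrite !in_itv/= => /andP[a1 a2] /andP[b1 b2].
rewrite /plane_disk /= -(ltr_pXn2r (ltn0Sn 1)) ?nnegrE ?cmod_ge0//.
by rewrite cmod_sqr expr1n /plane_point /=; nra.
Qed.

Lemma disk_moment0 r : (0 < r)%R -> I r 0 = mu2 (D r).
Proof.
move=> r0; rewrite /disk_moment; under eq_integral do rewrite muln0 expr0.
by rewrite integral_cst ?mul1e//; exact: measurable_plane_disk.
Qed.

Lemma disk_moment_le0 n : I 1 n <= I 1 0.
Proof.
apply: ge0_le_integral => //; first exact: measurable_plane_disk.
move=> p /= Dp; rewrite lee_fin muln0 expr0.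
by rewrite exprn_ile1// ?cmod_ge0// ltW.
Qed.

Lemma disk_moment_fin n : I 1 n \is a fin_num.
Proof.
rewrite ge0_fin_numE ?disk_moment_ge0//.
by rewrite (le_lt_trans (disk_moment_le0 n))// disk_moment0// disk_measure_fin.
Qed.

(** The moment of the annulus [r <= |z| < 1] is on the one hand
    [(1 - r^(2n+2)) I_n] by scaling, on the other hand between [r^(2n)] and [1]
    times the area of the annulus, which is [(1 - r^2) I_0]. *)
Lemma disk_moment_annulus r n : (0 < r < 1)%R ->
  (r ^+ (2 * n) * ((1 - r ^+ 2) * fine (I 1 0)) <=
   (1 - r ^+ (2 * n.+1)) * fine (I 1 n) <= (1 - r ^+ 2) * fine (I 1 0))%R.
Proof.
move=> /andP[r0 r1].
pose A n := \int[mu2]_(p in D 1 `\` D r) (cmod (pt p) ^+ (2 * n))%:E.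
have mD1 := measurable_plane_disk (@ltr01 R).
have mDr := measurable_plane_disk r0.
have mA : measurable (D 1 `\` D r) by exact: measurableD.
have split k : I 1 k = I r k + A k.
  rewrite /disk_moment /A -ge0_integral_setU//; first last.
  - by apply/disj_setPS => p [? [_]].
  congr integral; apply/esym/setDUK => p /= h; exact: lt_trans h r1.
have IE k : I 1 k = (fine (I 1 k))%:E by rewrite fineK// disk_moment_fin.
have Ar k : A k = ((1 - r ^+ (2 * k.+1)) * fine (I 1 k))%:E.
  have := split k; rewrite (disk_moment_scale _ r0); move: (IE k).
  set i := fine _ => -> e.
  by rewrite mulrBl mul1r EFinB e -EFinM addeAC subee// add0e.
have A0_le : A n <= A 0%N.
  apply: ge0_le_integral => // p /= [Dp _]; rewrite lee_fin muln0 expr0.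
  by rewrite exprn_ile1// ?cmod_ge0// ltW.
have le_A0 : (r ^+ (2 * n))%:E * A 0%N <= A n.
  rewrite /A -ge0_integralZl//; last by rewrite lee_fin exprn_ge0// ltW.
  apply: ge0_le_integral => //.
  - by move=> p _; rewrite mule_ge0// lee_fin exprn_ge0// ltW.
  - exact: measurable_funeM.
  move=> p /= [_ /negP]; rewrite -leNgt => Dp.
  by rewrite muln0 expr0 mule1 lee_fin lerXn2r// nnegrE ?cmod_ge0// ltW.
by move: A0_le le_A0; rewrite !Ar -EFinM !lee_fin muln1 => -> ->.
Qed.

(** The exact value is [pi / (n + 1)]; its order of magnitude follows from
    [disk_moment_annulus] with an inner radius within [1 / n] of the boundary, and
    suffices to compare the Dirichlet integral with the coefficients. *)
Lemma disk_moment_bounds : exists2 v : R, (0 < v)%R & forall n,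
  (v / (2 * n.+1%:R))%:E <= I 1 n <= (2 * v / n.+1%:R)%:E.
Proof.
exists (fine (I 1 0)).
  by rewrite fine_gt0// disk_moment0// disk_measure_gt0 disk_measure_fin.
move=> n; set v := fine (I 1 0); set N := n.+1.
have v0 : (0 <= v)%R by rewrite fine_ge0// disk_moment_ge0.
have N0 : (0 < N%:R :> R)%R by rewrite ltr0n.
rewrite -(fineK (disk_moment_fin n)) !lee_fin; set i := fine (I 1 n).
have i0 : (0 <= i)%R by rewrite fine_ge0// disk_moment_ge0.
(* the square of the inner radius; its powers up to n are at least 1/2 *)
pose x : R := (1 - (2 * N%:R)^-1)%R.
have d0 : (0 < (2 * N%:R)^-1 :> R)%R by rewrite invr_gt0 mulr_gt0.
have d1 : ((2 * N%:R)^-1 <= 2^-1 :> R)%R.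
  by rewrite lef_pV2 ?posrE ?mulr_gt0// ler_peMr// ler1n.
have [x0 x1] : (0 < x)%R /\ (x < 1)%R by rewrite /x; lra.
have xp j : (j <= N)%N -> (2^-1 <= x ^+ j)%R.
  move=> jN; have -> : (2^-1 = 1 - N%:R * (2 * N%:R)^-1 :> R)%R.
    rewrite invfM mulrCA mulfV ?gt_eqF//; lra.
  apply: (@le_trans _ _ (1 - j%:R * (2 * N%:R)^-1)%R).
    by rewrite lerD2l lerN2 ler_pM2r ?ler_nat//; lra.
  by apply: bernoulli_le; lra.
pose r := Num.sqrt x; have r0 : (0 < r)%R by rewrite sqrtr_gt0.
have r2 : (r ^+ 2 = x)%R by rewrite sqr_sqrtr// ltW.
have r1 : (r < 1)%R by rewrite -(ltr_pXn2r (ltn0Sn 1)) ?nnegrE ?ltW// r2 expr1n.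
have := @disk_moment_annulus r n; rewrite !exprM r2 -/v -/i r0 r1.
move=> /(_ isT)/andP[h1 h2].
have geo : (1 - x ^+ N = (1 - x) * \sum_(j < N) x ^+ j)%R.
  by rewrite -opprB subrX1; ring.
have S1 : (\sum_(j < N) x ^+ j <= N%:R)%R.
  apply: (@le_trans _ _ (\sum_(j < N) 1)%R); last by rewrite sumr_const card_ord.
  by apply: ler_sum => j _; rewrite exprn_ile1// ltW.
have S2 : (N%:R * 2^-1 <= \sum_(j < N) x ^+ j)%R.
  apply: (@le_trans _ _ (\sum_(j < N) 2^-1)%R).
    by rewrite sumr_const card_ord mulr_natl.
  by apply: ler_sum => j _; apply: xp; exact: ltnW.
move: h1 h2; rewrite geo; set S := (\sum_(j < N) _)%R in S1 S2 *.
have xn := xp n (leqnSn n); have x1' : (0 < 1 - x)%R by lra.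
rewrite mulrCA -!mulrA !ler_pM2l// => h1 h2.
apply/andP; split.
  by rewrite ler_pdivrMr ?mulr_gt0//; nra.
by rewrite mulrA ler_pdivlMr//; nra.
Qed.

End DiskMoment.

(** * Power series in the unit disk *)

Section ComplexLimit.
Context (R : realType).

(** The norm of [R[i]] is valued in [R[i]]; convergence is expressed by the
    real-valued modulus instead. *)
Lemma cplx_cvgP (T : Type) (F : set_system T) {FF : Filter F} (u : T -> R[i]) (l : R[i]) :
  ((u x : R[i]^o) @[x --> F] --> (l : R[i]^o)) <->
  (cmod (u x - l) @[x --> F] --> (0 : R)).
Proof.
split=> [/cvgrPdist_lt h|/cvgrPdist_lt h]; apply/cvgrPdist_lt => e e0.
  have /h : 0 < e%:C%C by rewrite ltcR.
  apply: filterS => x; rewrite -cmodE ltcR sub0r normrN ger0_norm ?cmod_ge0//.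
  by rewrite cmodBC.
move: (e0); rewrite ltcE /= => /andP[/eqP e1 e2].
have {}e1 : e = (complex.Re e)%:C%C by case: e e0 e1 e2 => a b /= _ ->.
move: (h _ e2); apply: filterS => x; rewrite sub0r normrN ger0_norm ?cmod_ge0//.
by rewrite e1 -cmodE ltcR cmodBC.
Qed.

Lemma le_of_cvg0 (T : Type) (F : set_system T) {FF : ProperFilter F}
  (u : T -> R) (x B : R) : u t @[t --> F] --> (0 : R) ->
  (\forall t \near F, x <= B + u t) -> x <= B.
Proof.
move=> u0 h; apply/ler_addgt0Pr => e e0.
near F => t.
have h1 : u t <= e by near: t; exact: (cvgr_le _ u0 _ e0).
have h2 : x <= B + u t by near: t.
by rewrite (le_trans h2)// lerD2l.
Unshelve. all: by end_near. Qed.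

Lemma cplx_cvg_unique (T : Type) (F : set_system T) {FF : ProperFilter F}
  (u : T -> R[i]) (l m : R[i]) :
  cmod (u x - l) @[x --> F] --> (0 : R) ->
  cmod (u x - m) @[x --> F] --> (0 : R) -> l = m.
Proof.
move=> ul um; apply/eqP; rewrite -subr_eq0 -cmod_eq0 eq_le cmod_ge0 andbT.
have h : cmod (u x - l) + cmod (u x - m) @[x --> F] --> (0 : R).
  by rewrite -[X in _ --> X](addr0 0); exact: cvgD.
apply: (le_of_cvg0 h); apply: nearW => x; rewrite add0r.
have -> : l - m = (u x - m) - (u x - l) by ring.
by rewrite [leRHS]addrC ler_cmodB.
Qed.

Lemma cvg_Re_Im (T : Type) (F : set_system T) {FF : Filter F}
  (u : T -> R[i]) (x y : R) : complex.Re (u t) @[t --> F] --> x ->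
  complex.Im (u t) @[t --> F] --> y ->
  cmod (u t - (x +i* y)%C) @[t --> F] --> (0 : R).
Proof.
have dist0 (v : T -> R) (l : R) : v @ F --> l -> `|v t - l| @[t --> F] --> (0 : R).
  by move=> /subr_cvg0/cvg_norm; rewrite normr0.
move=> /dist0 hx /dist0 hy.
have h : `|complex.Re (u t) - x| + `|complex.Im (u t) - y| @[t --> F] --> (0 : R).
  by rewrite -[X in _ --> X](addr0 0); exact: cvgD.
apply: cvg0_squeeze h => t.
by rewrite cmod_ge0 (le_trans (cmod_le_ReIm _))//; case: (u t).
Qed.

Lemma cvg_sqr_cmod (T : Type) (F : set_system T) {FF : Filter F}
  (u : T -> R[i]) l : cmod (u t - l) @[t --> F] --> (0 : R) ->
  cmod (u t) ^+ 2 @[t --> F] --> cmod l ^+ 2.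
Proof.
move=> h; suff h1 : cmod (u t) @[t --> F] --> cmod l.
  by rewrite expr2; under eq_fun do rewrite expr2; exact: cvgM.
apply/subr_cvg0; apply/norm_cvg0P; apply: cvg0_squeeze h => t.
rewrite normr_ge0 ler_norml ler_cmod_dist andbT.
by rewrite lerNl opprB cmodBC ler_cmod_dist.
Qed.

(** Completeness of the plane, from that of the line for the real and imaginary
    parts. *)
Lemma cplx_cauchy_cvg (u : nat -> R[i]) (del : nat -> R) : del @ \oo --> (0 : R) ->
  (forall N M, (N <= M)%N -> cmod (u M - u N) <= del N) ->
  exists l, cmod (u N - l) @[N --> \oo] --> (0 : R).
Proof.
move=> T0 hu.
have cauchy_part (g : R[i] -> R) : (forall x y, g (x - y) = g x - g y) ->
    (forall x, `|g x| <= cmod x) -> cvgn (fun N => g (u N)).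
  move=> gB gle; apply/cauchy_cvgP/cauchy_exP => e e0.
  have [N _ hN] := cvgr_lt _ T0 _ e0; exists (g (u N)); exists N => // n /= Nn.
  rewrite -ball_normE /= distrC -gB (le_lt_trans (gle _))//.
  by rewrite (le_lt_trans _ (hN N (leqnn N)))// hu.
have cre : cvgn (fun N => complex.Re (u N)).
  apply: cauchy_part => [[x1 x2] [y1 y2]//|x]; exact: Re_le_cmod.
have cim : cvgn (fun N => complex.Im (u N)).
  apply: cauchy_part => [[x1 x2] [y1 y2]//|x]; exact: Im_le_cmod.
by eexists; exact: (cvg_Re_Im cre cim).
Qed.

End ComplexLimit.

Section PowerSeries.
Context (R : realType).
Implicit Types (a : nat -> R[i]) (z w : R[i]).

Definition psum a N z : R[i] := \sum_(n < N) a n * z ^+ n.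

Definition psum_cvg a z l := cmod (psum a N z - l) @[N --> \oo] --> (0 : R).

Definition deriv_coef a n : R[i] := n.+1%:R * a n.+1.

Lemma psumS a N z : psum a N.+1 z = psum a N z + a N * z ^+ N.
Proof. by rewrite /psum big_ord_recr. Qed.

Definition coef_bounded a s A := forall n, cmod (a n) * s ^+ n <= A.

Lemma psum_cvgP a z l : psum_cvg a z l <->
  ((series (fun n => a n * z ^+ n) : nat -> R[i]^o) @ \oo --> (l : R[i]^o)).
Proof.
have -> : series (fun n => a n * z ^+ n) = (fun N => psum a N z) :> (nat -> R[i]^o).
  by apply/funext => N; rewrite /series /= big_mkord.
by apply: iff_sym; exact: cplx_cvgP.
Qed.

Lemma cvg0_lt (u : nat -> R) e : u @ \oo --> (0 : R) -> 0 < e ->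
  exists N, forall n, (N <= n)%N -> u n < e.
Proof.
move=> u0 e0; have [N _ h] := cvgr_lt _ u0 _ e0.
by exists N => n Nn; exact: h.
Qed.

Lemma coef_bounded_of_cvg a s l : 0 <= s -> psum_cvg a s%:C%C l ->
  exists A, coef_bounded a s A.
Proof.
move=> s0 h; have [N hN] := cvg0_lt h ltr01.
have t0 n : 0 <= cmod (a n) * s ^+ n by rewrite mulr_ge0 ?cmod_ge0 ?exprn_ge0.
exists (2 + \sum_(n < N) cmod (a n) * s ^+ n) => n.
have [nN|Nn] := ltnP n N.
  by rewrite (bigD1 (Ordinal nN))//= addrCA lerDl addr_ge0 ?sumr_ge0.
rewrite (@le_trans _ _ 2)//; last by rewrite lerDl sumr_ge0.
have -> : cmod (a n) * s ^+ n = cmod (a n * s%:C%C ^+ n).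
  by rewrite cmodM cmodX cmod_real ger0_norm.
have -> : a n * s%:C%C ^+ n = (psum a n.+1 s%:C%C - l) - (psum a n s%:C%C - l).
  by rewrite psumS; ring.
have := ler_cmodB (psum a n.+1 s%:C%C - l) (psum a n s%:C%C - l).
by have := hN n Nn; have := hN n.+1 (leqW Nn); lra.
Qed.

Lemma geo_sum_le (t : R) N : 0 <= t < 1 -> \sum_(n < N) t ^+ n <= (1 - t)^-1.
Proof.
move=> /andP[t0 t1]; have t1' : 0 < 1 - t by lra.
rewrite -[leRHS]mul1r ler_pdivlMr// mulrC.
have := subrX1 t N; have := exprn_ge0 N t0; lra.
Qed.

Lemma geo_sum_tail_le (t : R) N M : 0 <= t < 1 ->
  \sum_(N <= n < M) t ^+ n <= t ^+ N / (1 - t).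
Proof.
move=> t01; have [NM|MN] := leqP N M; last first.
  by rewrite big_geq ?(ltnW MN)// divr_ge0 ?exprn_ge0//; lra.
rewrite -[N in leLHS]add0n big_addn big_mkord.
under eq_bigr do rewrite exprD mulrC.
rewrite -mulr_sumr ler_wpM2l ?geo_sum_le// exprn_ge0//; lra.
Qed.

Lemma psum_diff a N M z : (N <= M)%N ->
  psum a M z - psum a N z = \sum_(N <= n < M) a n * z ^+ n.
Proof.
move=> NM; rewrite /psum -(big_mkord xpredT (fun n => a n * z ^+ n)).
rewrite (big_cat_nat (leq0n N) NM)/= -(big_mkord xpredT (fun n => a n * z ^+ n)).
by rewrite addrAC subrr add0r.
Qed.

Lemma coef_bounded_ge0 a s A : coef_bounded a s A -> 0 <= A.
Proof. by move=> /(_ 0%N); apply: le_trans; rewrite expr0 mulr1 cmod_ge0. Qed.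

Lemma psum_tail_le a s A N M z r : 0 < s -> coef_bounded a s A ->
  cmod z <= r -> r < s -> (N <= M)%N ->
  cmod (psum a M z - psum a N z) <= A * ((r / s) ^+ N / (1 - r / s)).
Proof.
move=> s0 hA zr rs NM; rewrite psum_diff//.
have r0 : 0 <= r by rewrite (le_trans (cmod_ge0 z)).
have t01 : 0 <= r / s < 1 by rewrite divr_ge0 ?(ltW s0)//= ltr_pdivrMr// mul1r.
rewrite (le_trans (ler_cmod_sum _ _ _))//.
apply: (@le_trans _ _ (\sum_(N <= n < M) A * (r / s) ^+ n)); last first.
  by rewrite -mulr_sumr ler_wpM2l ?geo_sum_tail_le// (coef_bounded_ge0 hA).
apply: ler_sum => n _; rewrite cmodM cmodX.
apply: (@le_trans _ _ (cmod (a n) * r ^+ n)).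
  by rewrite ler_wpM2l ?cmod_ge0// lerXn2r ?nnegrE ?cmod_ge0.
have -> : r ^+ n = s ^+ n * (r / s) ^+ n.
  by rewrite -exprMn mulrCA mulfV ?mulr1// gt_eqF.
by rewrite mulrA ler_wpM2r ?exprn_ge0//; case/andP: t01.
Qed.

Lemma psum_cvg_tail a s A N z l r : 0 < s -> coef_bounded a s A ->
  cmod z <= r -> r < s -> psum_cvg a z l ->
  cmod (l - psum a N z) <= A * ((r / s) ^+ N / (1 - r / s)).
Proof.
move=> s0 hA zr rs h; apply: (le_of_cvg0 h).
near=> M; have NM : (N <= M)%N by near: M; exact: nbhs_infty_ge.
have -> : l - psum a N z = (psum a M z - psum a N z) - (psum a M z - l) by ring.
rewrite (le_trans (ler_cmodB _ _))// lerD2r; exact: psum_tail_le.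
Unshelve. all: by end_near. Qed.

Lemma geo_bound_cvg0 (C t : R) : 0 <= t < 1 ->
  (fun N => C * (t ^+ N / (1 - t))) @ \oo --> (0 : R).
Proof.
move=> /andP[t0 t1]; rewrite -[X in _ --> X](mulr0 C); apply: cvgMr.
rewrite -[X in _ --> X](mul0r (1 - t)^-1); apply: cvgMl.
by apply: cvg_expr; rewrite ger0_norm.
Qed.

Lemma psum_is_cvg a s A z : coef_bounded a s A -> cmod z < s ->
  exists l, psum_cvg a z l.
Proof.
move=> hA zs; have s0 := le_lt_trans (cmod_ge0 z) zs.
have t01 : 0 <= cmod z / s < 1.
  by rewrite divr_ge0 ?cmod_ge0 ?(ltW s0)//= ltr_pdivrMr// mul1r.
apply: (cplx_cauchy_cvg (geo_bound_cvg0 A t01)) => N M NM; exact: psum_tail_le.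
Qed.

(** * Termwise differentiation *)

Lemma nat_geo_bounded (q : R) : 0 < q < 1 -> exists B, forall n, n%:R * q ^+ n <= B.
Proof.
move=> /andP[q0 q1]; have iq : 1 < q^-1 by rewrite invf_gt1.
exists (q^-1 - 1)^-1 => n.
have bern : 1 + n%:R * (q^-1 - 1) <= q^-1 ^+ n.
  have x1 : 1 - q^-1 <= 1 by lra.
  have := bernoulli_le n x1; rewrite (_ : 1 - (1 - q^-1) = q^-1); last by ring.
  by rewrite -mulrN opprB.
have qn : 0 < q ^+ n by rewrite exprn_gt0.
have e : q^-1 ^+ n * q ^+ n = 1 by rewrite -exprMn mulVf ?expr1n// gt_eqF.
rewrite -[leRHS]mul1r ler_pdivlMr; last by lra.
have : n%:R * (q^-1 - 1) * q ^+ n <= q^-1 ^+ n * q ^+ n by rewrite ler_pM2r//; lra.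
by rewrite e; lra.
Qed.

Lemma coef_bounded_deriv a s A s' : coef_bounded a s A -> 0 < s' < s ->
  exists A', coef_bounded (deriv_coef a) s' A'.
Proof.
move=> hA /andP[s'0 s's]; have s0 := lt_trans s'0 s's.
have q01 : 0 < s' / s < 1 by rewrite divr_gt0//= ltr_pdivrMr// mul1r.
have [B hB] := nat_geo_bounded q01; exists (A * B / s') => n.
rewrite ler_pdivlMr// -mulrA -exprSr /deriv_coef cmodM cmod_nat.
have -> : s' ^+ n.+1 = s ^+ n.+1 * (s' / s) ^+ n.+1.
  by rewrite -exprMn mulrCA mulfV ?mulr1// gt_eqF.
have -> : n.+1%:R * cmod (a n.+1) * (s ^+ n.+1 * (s' / s) ^+ n.+1) =
    (cmod (a n.+1) * s ^+ n.+1) * (n.+1%:R * (s' / s) ^+ n.+1) by ring.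
apply: (@le_trans _ _ (A * (n.+1%:R * (s' / s) ^+ n.+1))).
  by rewrite ler_wpM2r// mulr_ge0// exprn_ge0//; case/andP: q01 => /ltW.
by rewrite ler_wpM2l// (coef_bounded_ge0 hA).
Qed.

Lemma power_taylor_le z h r n : cmod z <= r -> cmod (z + h) <= r ->
  cmod ((z + h) ^+ n.+2 - z ^+ n.+2 - n.+2%:R * h * z ^+ n.+1) <=
  n.+2%:R * n.+1%:R * cmod h ^+ 2 * r ^+ n.
Proof.
move=> zr zhr; have r0 := le_trans (cmod_ge0 z) zr.
elim: n => [|n ih].
  have -> : (z + h) ^+ 2 - z ^+ 2 - 2%:R * h * z ^+ 1 = h ^+ 2 by ring.
  by rewrite cmodX expr0 !mulr1 ler_peMl ?sqr_ge0// ler1n.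
pose E := (z + h) ^+ n.+2 - z ^+ n.+2 - n.+2%:R * h * z ^+ n.+1.
have -> : (z + h) ^+ n.+3 - z ^+ n.+3 - n.+3%:R * h * z ^+ n.+2 =
    (z + h) * E + n.+2%:R * h ^+ 2 * z ^+ n.+1.
  by rewrite /E -(natr1 n.+2) !(exprS _ n.+2) !(exprS _ n.+1); ring.
rewrite (le_trans (ler_cmodD _ _))//.
have h1 : cmod ((z + h) * E) <= r * (n.+2%:R * n.+1%:R * cmod h ^+ 2 * r ^+ n).
  by rewrite cmodM; apply: ler_pM; rewrite ?cmod_ge0.
have h2 : cmod (n.+2%:R * h ^+ 2 * z ^+ n.+1) <= n.+2%:R * cmod h ^+ 2 * r ^+ n.+1.
  rewrite !cmodM cmod_nat !cmodX; apply: ler_wpM2l.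
    by rewrite mulr_ge0 ?sqr_ge0.
  by apply: lerXn2r; rewrite ?nnegrE ?cmod_ge0.
rewrite (le_trans (lerD h1 h2))//.
have -> : r * (n.+2%:R * n.+1%:R * cmod h ^+ 2 * r ^+ n) +
    n.+2%:R * cmod h ^+ 2 * r ^+ n.+1 =
    (n.+1%:R + 1) * n.+2%:R * cmod h ^+ 2 * r ^+ n.+1 by rewrite (exprS r n); ring.
by rewrite natr1 !ler_wpM2r ?exprn_ge0 ?sqr_ge0 ?ler_nat ?cmod_ge0.
Qed.

Lemma psum_taylor a z h N :
  psum a N.+2 (z + h) - psum a N.+2 z - h * psum (deriv_coef a) N.+1 z =
  \sum_(n < N) a n.+2 * ((z + h) ^+ n.+2 - z ^+ n.+2 - n.+2%:R * h * z ^+ n.+1).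
Proof.
rewrite /psum !big_ord_recl /= !expr0 !expr1.
rewrite /deriv_coef /bump /= !mul1r.
transitivity (\sum_(i < N) a i.+2 * (z + h) ^+ i.+2 - \sum_(i < N) a i.+2 * z ^+ i.+2
   - h * \sum_(i < N) i.+2%:R * a i.+2 * z ^+ i.+1).
  by rewrite !mulr1; ring.
rewrite mulr_sumr -!sumrB; apply: eq_bigr => i _; ring.
Qed.

Lemma psum_taylor_le a s A z h r N : coef_bounded (deriv_coef (deriv_coef a)) s A ->
  0 < s -> cmod z <= r -> cmod (z + h) <= r -> r < s ->
  cmod (psum a N.+2 (z + h) - psum a N.+2 z - h * psum (deriv_coef a) N.+1 z) <=
  cmod h ^+ 2 * (A / (1 - r / s)).
Proof.
move=> hA s0 zr zhr rs; have r0 := le_trans (cmod_ge0 z) zr.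
have t01 : 0 <= r / s < 1 by rewrite divr_ge0 ?(ltW s0)//= ltr_pdivrMr// mul1r.
rewrite psum_taylor (le_trans (ler_cmod_sum _ _ _))//.
apply: (@le_trans _ _ (\sum_(n < N) cmod h ^+ 2 * A * (r / s) ^+ n)); last first.
  rewrite -mulr_sumr mulrA ler_wpM2l ?geo_sum_le//.
  by rewrite mulr_ge0 ?sqr_ge0 ?(coef_bounded_ge0 hA).
apply: ler_sum => n _; rewrite cmodM.
have h1 := power_taylor_le n zr zhr.
have h2 := ler_wpM2l (cmod_ge0 (a n.+2)) h1.
rewrite (le_trans h2)//.
have -> : cmod (a n.+2) * (n.+2%:R * n.+1%:R * cmod h ^+ 2 * r ^+ n) =
    cmod h ^+ 2 * (cmod (deriv_coef (deriv_coef a) n) * r ^+ n).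
  by rewrite /deriv_coef !cmodM !cmod_nat; ring.
rewrite -mulrA ler_wpM2l ?sqr_ge0//.
have -> : r ^+ n = s ^+ n * (r / s) ^+ n.
  by rewrite -exprMn mulrCA mulfV ?mulr1// gt_eqF.
by rewrite mulrA ler_wpM2r ?exprn_ge0//; case/andP: t01.
Qed.

(** Second-order Taylor bounds on the partial sums, uniform in their length, pass
    to the limit and give [|f (z + h) - f z - h l| <= K |h|^2]. *)
Lemma complex_deriveE (f : R[i] -> R[i]) a s A z l : coef_bounded a s A ->
  cmod z < s -> (forall w, cmod w < s -> psum_cvg a w (f w)) ->
  psum_cvg (deriv_coef a) z l -> complex_derive f z = l.
Proof.
move=> hA zs hf hl; have zn := cmod_ge0 z.
have [A1 hA1] : exists A', coef_bounded (deriv_coef a) ((s + (s + cmod z) / 2) / 2) A'.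
  by apply: (coef_bounded_deriv hA); apply/andP; split; lra.
pose s2 := (s + cmod z) / 2.
have [A2 hA2] : exists A', coef_bounded (deriv_coef (deriv_coef a)) s2 A'.
  by apply: (coef_bounded_deriv hA1); rewrite /s2; apply/andP; split; lra.
pose r := (cmod z + s2) / 2.
have s20 : 0 < s2 by rewrite /s2; lra.
have rs2 : r < s2 by rewrite /r /s2; lra.
have zr : cmod z < r by rewrite /r /s2; lra.
have rs : r < s by rewrite /r /s2; lra.
pose K := A2 / (1 - r / s2).
have key h : cmod h < r - cmod z -> cmod (f (h + z) - f z - h * l) <= cmod h ^+ 2 * K.
  move=> hh; have zh : cmod (z + h) <= r.
    by rewrite (le_trans (ler_cmodD _ _))//; lra.
  rewrite [h + z]addrC.
  have c1 := hf (z + h) (le_lt_trans zh rs); have c2 := hf z zs.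
  have c3 : cmod (psum a N.+2 (z + h) - f (z + h)) + cmod (psum a N.+2 z - f z)
      + cmod h * cmod (psum (deriv_coef a) N.+1 z - l) @[N --> \oo] --> (0 : R).
    have -> : 0 = 0 + 0 + cmod h * 0 :> R by ring.
    apply: cvgD; [apply: cvgD|apply: cvgMr].
    - by have := c1; rewrite /psum_cvg -(cvg_shiftn 2); under eq_fun do rewrite addn2.
    - by have := c2; rewrite /psum_cvg -(cvg_shiftn 2); under eq_fun do rewrite addn2.
    - by have := hl; rewrite /psum_cvg -(cvg_shiftn 1); under eq_fun do rewrite addn1.
  apply: (le_of_cvg0 c3); apply: nearW => N.
  have := psum_taylor_le N hA2 s20 (ltW zr) zh rs2.
  set P1 := psum a _ (z + h); set P2 := psum a _ z; set P3 := psum _ _ z => h1.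
  have -> : f (z + h) - f z - h * l =
    (P1 - P2 - h * P3) - ((P1 - f (z + h)) - (P2 - f z) - h * (P3 - l)) by ring.
  have := ler_cmodB (P1 - P2 - h * P3) ((P1 - f (z + h)) - (P2 - f z) - h * (P3 - l)).
  have := ler_cmodB ((P1 - f (z + h)) - (P2 - f z)) (h * (P3 - l)).
  have := ler_cmodB (P1 - f (z + h)) (P2 - f z).
  by rewrite cmodM -/K in h1 *; lra.
rewrite /complex_derive /derive1; pose g : R[i]^o -> R[i]^o := f.
suff H : h^-1 *: (g (h + z) - g z) @[h --> (0 : R[i]^o)^'] --> (l : R[i]^o).
  exact: (cvg_lim (@norm_hausdorff _ _) H).
apply/cplx_cvgP; rewrite /g.
have K0 : (fun h : R[i]^o => cmod h * K) @ 0^' --> (0 : R).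
  rewrite -[X in _ --> X](mul0r K); apply: cvgMl.
  apply: cvg_within_filter; apply/cvgrPdist_lt => e e0.
  have e0' : 0 < e%:C%C by rewrite ltcR.
  apply: filterS (nbhsx_ballx (0 : R[i]^o) _ e0') => h.
  rewrite -ball_normE /= !sub0r !normrN => he.
  by rewrite ger0_norm ?cmod_ge0// -ltcR cmodE.
apply: (squeeze_cvgr _ (cvg_cst 0) K0).
have rz : 0 < (r - cmod z)%:C%C by rewrite ltcR subr_gt0.
near=> h.
have h0 : h != 0 by near: h; exact: nbhs_dnbhs_neq.
have hr : cmod h < r - cmod z.
  rewrite -ltcR cmodE; near: h; apply: dnbhs0_lt.
  by [].
rewrite cmod_ge0 /=.
have -> : h^-1 *: (f (h + z) - f z) - l = h^-1 * (f (h + z) - f z - h * l).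
  by rewrite /GRing.scale /= [in RHS]mulrBr mulKf.
have hp : 0 < cmod h by rewrite cmod_gt0.
rewrite cmodM cmodV mulrC ler_pdivrMr// (le_trans (key _ hr))//.
by rewrite expr2; lra.
Unshelve. all: by end_near. Qed.

End PowerSeries.

(** * The Dirichlet integral in terms of Taylor coefficients *)

Section DirichletCoefficients.
Context (R : realType).
Local Notation mu := (@lebesgue_measure R).
Local Notation T := (measurableTypeR R).
Local Notation mu2 := (mu \x mu)%E.
Local Notation pt := (@plane_point R).
Local Notation D := (@plane_disk R).
Implicit Types (a : nat -> R[i]) (f : R[i] -> R[i]).

Definition is_taylor a f := forall z, cmod z < 1 -> psum_cvg a z (f z).

Lemma taylor_coef_bounded a f s : is_taylor a f -> 0 < s < 1 ->
  exists A, coef_bounded a s A.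
Proof.
move=> h /andP[s0 s1].
apply: (coef_bounded_of_cvg (l := f s%:C%C) (ltW s0)); apply: h.
by rewrite cmod_real ger0_norm// ltW.
Qed.

Lemma taylor_deriv a f : is_taylor a f ->
  is_taylor (deriv_coef a) (complex_derive f).
Proof.
move=> h z z1; have z0 := cmod_ge0 z.
have [A hA] : exists A, coef_bounded a ((3 + cmod z) / 4) A.
  by apply: (taylor_coef_bounded h); apply/andP; split; lra.
have [A' hA'] : exists A, coef_bounded (deriv_coef a) ((1 + cmod z) / 2) A.
  by apply: (coef_bounded_deriv hA); apply/andP; split; lra.
have zr : cmod z < (1 + cmod z) / 2 by lra.
have [l hl] := psum_is_cvg hA' zr.
rewrite (complex_deriveE hA (l := l))//; first by lra.
by move=> w w1; apply: h; lra.
Qed.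

Lemma measurable_psum a N A :
  measurable_fun A (fun p => cmod (psum a N (pt p)) ^+ 2).
Proof.
apply: measurable_funTS; apply: measurable_sqr_cmod; apply: measurable_cplx_poly.
exact: measurable_plane_point.
Qed.

Lemma measurable_taylor a f r : is_taylor a f -> 0 < r <= 1 ->
  measurable_fun (D r) (fun p => cmod (f (pt p)) ^+ 2).
Proof.
move=> h /andP[r0 r1]; apply: (@measurable_fun_cvg _ _ _ _
  (fun N p => cmod (psum a N (pt p)) ^+ 2)) => [N|p /= Dp].
  exact: measurable_psum.
by apply: cvg_sqr_cmod; apply: h; exact: lt_le_trans Dp r1.
Qed.

Lemma integral_disk_psum a N r : (2 < N)%N -> 0 < r ->
  (\int[mu2]_(p in D r) (cmod (psum a N (pt p)) ^+ 2)%:E =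
  \sum_(n < N) (cmod (a n) ^+ 2)%:E * disk_moment r n)%E.
Proof. exact: integral_disk_poly. Qed.

(** Fatou's lemma along the Taylor polynomials. *)
Lemma integral_disk_taylor_le a f (M : R) : is_taylor a f ->
  (forall N, (\sum_(n < N) (cmod (a n) ^+ 2)%:E * disk_moment 1 n <= M%:E)%E) ->
  (\int[mu2]_(p in D 1) (cmod (f (pt p)) ^+ 2)%:E <= M%:E)%E.
Proof.
move=> h hM; have mD := measurable_plane_disk (@ltr01 R).
pose F N p : \bar R := (cmod (psum a (N + 3) (pt p)) ^+ 2)%:E.
have -> : (\int[mu2]_(p in D 1) (cmod (f (pt p)) ^+ 2)%:E =
    \int[mu2]_(p in D 1) limn_einf (F ^~ p))%E.
  apply: eq_integral => p; rewrite inE => Dp; apply/esym.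
  apply: (cvg_limn_einf_sup _).1; apply/fine_cvgP; split; first exact: nearW.
  have h1 : cmod (psum a N (pt p)) ^+ 2 @[N --> \oo] --> cmod (f (pt p)) ^+ 2.
    by apply: cvg_sqr_cmod; exact: h.
  by move: h1; rewrite -(cvg_shiftn 3).
apply: (le_trans (fatou _ mD _ _)).
- move=> N; apply/measurable_EFinP; exact: measurable_psum.
- by move=> N p _; rewrite lee_fin sqr_ge0.
rewrite limn_einf_lim; apply: lime_le; first exact: is_cvg_einfs.
apply: nearW => N; apply: (@le_trans _ _ (\int[mu2]_(p in D 1) F N p)%E).
  by apply: ereal_inf_lbound; exists N => //=.
by rewrite /F integral_disk_psum ?addn3.
Qed.

(** On a smaller disk the Taylor polynomials converge uniformly, so that Bessel's
    inequality passes to the limit. *)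
Lemma bessel_disk a f r N0 : is_taylor a f -> 0 < r < 1 ->
  (\sum_(n < N0) (cmod (a n) ^+ 2)%:E * disk_moment r n <=
   2%:E * \int[mu2]_(p in D 1) (cmod (f (pt p)) ^+ 2)%:E)%E.
Proof.
move=> h /andP[r0 r1]; set I := (\int[mu2]_(p in D 1) _)%E.
have mDr := measurable_plane_disk r0; have mD1 := measurable_plane_disk (@ltr01 R).
have I0 : (0 <= I)%E by apply: integral_ge0 => p _; rewrite lee_fin sqr_ge0.
have [[J IJ]|->] : (exists J, I = J%:E) \/ I = +oo%E.
- by case: I I0 => [J _|_|//]; [left; exists J|right].
2: by rewrite mulry gtr0_sg// mul1e leey.
pose s := (1 + r) / 2; have s0 : 0 < s by rewrite /s; lra.
have rs : r < s by rewrite /s; lra.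
have [A hA] : exists A, coef_bounded a s A.
  by apply: (taylor_coef_bounded h); rewrite s0 /s; lra.
have t01 : 0 <= r / s < 1 by rewrite divr_ge0 ?ltW//= ltr_pdivrMr// mul1r.
pose del N := A * ((r / s) ^+ N / (1 - r / s)).
have m0n n : (disk_moment r n = (fine (disk_moment r n))%:E)%E.
  by rewrite fineK// disk_moment_scale// fin_numM// disk_moment_fin.
have mr : exists V : R, mu2 (D r) = V%:E.
  by exists (fine (disk_moment r 0)); rewrite -m0n disk_moment0.
case: mr => V muV.
have main N : (N0 <= N)%N -> (2 < N)%N ->
    (\sum_(n < N0) (cmod (a n) ^+ 2)%:E * disk_moment r n <=
     (2 * J + 2 * del N ^+ 2 * V)%:E)%E.
  move=> NN N2; apply: (@le_trans _ _ (\sum_(n < N) (cmod (a n) ^+ 2)%:E * disk_moment r n)%E).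
    rewrite -!(big_mkord xpredT (fun n => (cmod (a n) ^+ 2)%:E * disk_moment r n)%E).
    rewrite [leRHS](big_cat_nat (leq0n N0) NN)/= leeDl// sume_ge0// => n _.
    by rewrite mule_ge0 ?lee_fin ?sqr_ge0 ?disk_moment_ge0.
  rewrite -integral_disk_psum//.
  have mf : measurable_fun (D r) (fun p => (cmod (f (pt p)) ^+ 2)%:E).
    by apply/measurable_EFinP; apply: (measurable_taylor h); rewrite r0 ltW.
  apply: (@le_trans _ _ (\int[mu2]_(p in D r) (2%:E * (cmod (f (pt p)) ^+ 2)%:E +
      cst (2 * del N ^+ 2)%:E p))%E).
    apply: ge0_le_integral => //.
    - by move=> p _; rewrite lee_fin sqr_ge0.
    - by apply/measurable_EFinP; exact: measurable_psum.
    - by apply: emeasurable_funD => //; exact: measurable_funeM.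
    move=> p /= Dp; rewrite -EFinM -EFinD lee_fin.
    have zl : psum_cvg a (pt p) (f (pt p)) by apply: h; exact: lt_trans Dp r1.
    have d1 := psum_cvg_tail N s0 hA (ltW Dp) rs zl.
    have := sqr_cmodD (f (pt p)) (psum a N (pt p) - f (pt p)).
    rewrite addrC subrK => h2; rewrite (le_trans h2)// lerD2l ler_pM2l//.
    by rewrite lerXn2r ?nnegrE ?cmod_ge0 ?(le_trans (cmod_ge0 _) d1)// cmodBC.
  rewrite ge0_integralD//; last 3 first.
  - by move=> p _; rewrite mule_ge0// lee_fin sqr_ge0.
  - exact: measurable_funeM.
  - by move=> p _; rewrite lee_fin mulr_ge0// sqr_ge0.
  rewrite [X in (_ + X <= _)%E]integral_cst//.
  rewrite [X in (_ + _ * X <= _)%E](_ : _ = V%:E)// ge0_integralZl//; last first.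
    by move=> p _; rewrite lee_fin sqr_ge0.
  rewrite (EFinD (2 * J)) (EFinM 2 J) -IJ; apply: leeD; last by rewrite EFinM.
  rewrite lee_pmul2l//; apply: ge0_subset_integral => //.
  - by apply/measurable_EFinP; apply: (measurable_taylor h); rewrite ltr01 lexx.
  - by move=> p _; rewrite lee_fin sqr_ge0.
  - by move=> p /= Dp; exact: lt_trans Dp r1.
rewrite IJ -EFinM.
under eq_bigr do rewrite m0n -EFinM.
rewrite sumEFin lee_fin.
have d0 : (fun N => 2 * del N ^+ 2 * V) @ \oo --> (0 : R).
  have -> : 0 = 2 * (0 * 0) * V by ring.
  apply: cvgMl; apply: cvgMr; under eq_fun do rewrite expr2.
  by apply: cvgM; exact: geo_bound_cvg0.
apply: (le_of_cvg0 d0); near=> N.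
have : (\sum_(n < N0) (cmod (a n) ^+ 2)%:E * disk_moment r n <=
     (2 * J + 2 * del N ^+ 2 * V)%:E)%E.
  by apply: main; near: N; exact: nbhs_infty_ge.
by under eq_bigr do rewrite m0n -EFinM; rewrite sumEFin lee_fin.
Unshelve. all: by end_near. Qed.

Lemma dirichlet_integralE a f : is_taylor a f -> dirichlet_integral f =
  ((pi^-1)%:E * \int[mu2]_(p in D 1) (cmod (complex_derive f (pt p)) ^+ 2)%:E)%E.
Proof.
move=> h; rewrite -ge0_integralZl//; last 4 first.
- exact: measurable_plane_disk.
- apply/measurable_EFinP; apply: (measurable_taylor (taylor_deriv h)).
  by rewrite ltr01 lexx.
- by move=> p _; rewrite lee_fin sqr_ge0.
- by rewrite lee_fin invr_ge0 pi_ge0.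
by apply: eq_integral => p _; rewrite -EFinM mulrC.
Qed.

Lemma sum_deriv_coef a N : \sum_(n < N) n.+1%:R * cmod (a n.+1) ^+ 2 =
  \sum_(n < N.+1) n%:R * cmod (a n) ^+ 2.
Proof. by rewrite big_ord_recl /= mul0r add0r. Qed.

(** Bessel's inequality for the derivative on a disk whose radius depends on the
    number of coefficients, with constants that do not. *)
Lemma dirichlet_coef_bound a f : is_taylor a f -> (dirichlet_integral f < +oo)%E ->
  exists M, forall N, \sum_(n < N) n%:R * cmod (a n) ^+ 2 <= M.
Proof.
move=> h; rewrite (dirichlet_integralE h); set I := (\int[mu2]_(p in D 1) _)%E => Ioo.
have I0 : (0 <= I)%E by apply: integral_ge0 => p _; rewrite lee_fin sqr_ge0.
have [J IJ] : exists J, I = J%:E.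
  case: I I0 Ioo => [J _ _|_|//]; first by exists J.
  by rewrite mulry gtr0_sg ?invr_gt0 ?pi_gt0// mul1e ltxx.
have [v v0 hv] := disk_moment_bounds R.
exists (8 * J / v) => N; case: N => [|N].
  by rewrite big_ord0 divr_ge0 ?(ltW v0)// mulr_ge0// -lee_fin -IJ.
rewrite -sum_deriv_coef.
(* radius close enough to 1 for the weights r^(2n+2), n < N, to be at least 1/2 *)
pose x : R := (4 * N.+1%:R)^-1.
have N0 : 0 < N.+1%:R :> R by rewrite ltr0n.
have x0 : 0 < x by rewrite invr_gt0 mulr_gt0.
have x1 : x <= 4^-1 by rewrite lef_pV2 ?posrE ?mulr_gt0// ler_peMr// ler1n.
have xN : N.+1%:R * x = 4^-1 by rewrite /x invfM mulrCA mulfV ?mulr1// gt_eqF.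
have r01 : 0 < 1 - x < 1 by apply/andP; split; lra.
have := bessel_disk N (taylor_deriv h) r01; rewrite -/I IJ -EFinM => hb.
have m0n n : (disk_moment (1 - x) n = (fine (disk_moment (1 - x) n))%:E)%E.
  case/andP: r01 => r0 _.
  by rewrite fineK// disk_moment_scale// fin_numM// disk_moment_fin.
move: hb; under eq_bigr do rewrite m0n -EFinM; rewrite sumEFin lee_fin => hb.
rewrite ler_pdivlMr// mulrC -(ler_pM2l (x := 4^-1))//.
have -> : 4^-1 * (8 * J) = 2 * J by lra.
apply: le_trans hb; rewrite mulrA mulr_sumr; apply: ler_sum => n _.
rewrite /deriv_coef cmodM cmod_nat exprMn.
have n0 : 0 < n.+1%:R :> R by rewrite ltr0n.
suff : v / (4 * n.+1%:R) <= fine (disk_moment (1 - x) n).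
  rewrite ler_pdivrMr ?mulr_gt0// => hm.
  have a0 := sqr_ge0 (cmod (a n.+1)).
  have a1 : 0 <= n.+1%:R * cmod (a n.+1) ^+ 2 by rewrite mulr_ge0.
  by have := ler_wpM2l a1 hm; lra.
rewrite -lee_fin -m0n disk_moment_scale; last by case/andP: r01.
apply: (@le_trans _ _ ((2^-1)%:E * (v / (2 * n.+1%:R))%:E)%E).
  rewrite -EFinM lee_fin (_ : v / _ = 2^-1 * (v / (2 * n.+1%:R)))//.
  by field; rewrite gt_eqF.
apply: lee_pmul; rewrite ?lee_fin ?divr_ge0 ?mulr_ge0 ?(ltW v0)//; last first.
  by case/andP: (hv n).
apply: (@le_trans _ _ (1 - (2 * n.+1)%:R * x)); last first.
  by apply: bernoulli_le; lra.
have : n.+1%:R <= N.+1%:R :> R by rewrite ler_nat ltnS ltnW.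
by rewrite natrM; nra.
Qed.

Lemma dirichlet_of_coef a f M : is_taylor a f ->
  (forall N, \sum_(n < N) n%:R * cmod (a n) ^+ 2 <= M) ->
  (dirichlet_integral f < +oo)%E.
Proof.
move=> h hM; rewrite (dirichlet_integralE h).
have [v v0 hv] := disk_moment_bounds R.
apply: (@le_lt_trans _ _ ((pi^-1)%:E * (2 * v * M)%:E)%E); last first.
  by rewrite -EFinM ltry.
apply: lee_wpmul2l; first by rewrite lee_fin invr_ge0 pi_ge0.
apply: (integral_disk_taylor_le (taylor_deriv h)) => N.
apply: (@le_trans _ _ (\sum_(n < N) (2 * v * (n.+1%:R * cmod (a n.+1) ^+ 2))%:E)%E).
  apply: lee_sum => n _; case/andP: (hv n) => _ h2.
  apply: (@le_trans _ _ ((cmod (deriv_coef a n) ^+ 2)%:E * (2 * v / n.+1%:R)%:E)%E).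
    by apply: lee_wpmul2l => //; rewrite lee_fin sqr_ge0.
  have n0 : 0 < n.+1%:R :> R by rewrite ltr0n.
  rewrite -EFinM lee_fin /deriv_coef cmodM cmod_nat exprMn le_eqVlt.
  by apply/orP; left; apply/eqP; field; rewrite gt_eqF.
rewrite sumEFin lee_fin -mulr_sumr ler_wpM2l ?mulr_ge0 ?(ltW v0)//.
by rewrite sum_deriv_coef.
Qed.

End DirichletCoefficients.

(** * Parseval's identity on the circle for polynomials *)

Section CircleParseval.
Local Open Scope ereal_scope.
Context (R : realType).
Local Notation mu := (@lebesgue_measure R).
Local Notation T := (measurableTypeR R).
Implicit Types (c : nat -> R[i]) (g : T -> \bar R).

Lemma integral_itv_translate (a b th : R) g :
  measurable_fun setT g -> (forall t, 0 <= g t) ->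
  \int[mu]_(t in `[a, b[) g (t + th)%R =
  \int[mu]_(t in `[(a + th)%R, (b + th)%R[) g t.
Proof.
move=> mg g0; rewrite integral_mkcond [RHS]integral_mkcond.
rewrite -[RHS](@ge0_integral_translate R th)//; last 2 first.
- by apply/(measurable_restrictT g (measurable_itv _)); exact: measurable_funTS.
- by move=> t; rewrite patchE; case: ifP.
apply: eq_integral => t _; rewrite !patchE.
have -> : ((t + th)%R \in `[(a + th)%R, (b + th)%R[%classic) = (t \in `[a, b[%classic).
  by apply/idP/idP; rewrite !inE /= !in_itv /= lerD2r ltrD2r.
by [].
Qed.

Lemma integral_period_translate (th : R) g : (0 <= th < 2 * pi)%R ->
  measurable_fun setT g -> (forall t, 0 <= g t) ->
  (forall t, g (t + 2 * pi)%R = g t) ->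
  \int[mu]_(t in `[0%R, (2 * pi)%R[) g (t + th)%R =
  \int[mu]_(t in `[0%R, (2 * pi)%R[) g t.
Proof.
move=> /andP[th0 th1] mg g0 gp; rewrite integral_itv_translate// add0r.
have itvU (x y z : R) : (x <= y)%R -> (y <= z)%R ->
    \int[mu]_(t in `[x, z[) g t = \int[mu]_(t in `[x, y[) g t + \int[mu]_(t in `[y, z[) g t.
  move=> xy yz; rewrite -ge0_integral_setU//; last 2 first.
  - exact: measurable_funTS.
  - apply/disj_setPS => t [] /=; rewrite !in_itv/= => /andP[_ h1] /andP[h2 _].
    by move: (lt_le_trans h1 h2); rewrite ltxx.
  congr integral; rewrite -itv_bndbnd_setU//.
rewrite (itvU th (2 * pi)%R)//; [|exact: ltW|by rewrite lerDl].
rewrite [RHS](itvU 0%R th)//; last exact: ltW.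
rewrite addeC; congr (_ + _).
have -> : `[(2 * pi)%R, (2 * pi + th)%R[%classic =
    `[(0 + 2 * pi)%R, (th + 2 * pi)%R[%classic :> set R by rewrite add0r addrC.
rewrite -integral_itv_translate//.
by apply: eq_integral => t _; rewrite gp.
Qed.

Lemma measurable_cis : measurable_cplx (fun t : T => cis t).
Proof.
by split; [apply: continuous_measurable_fun; exact: continuous_cos|
  apply: continuous_measurable_fun; exact: continuous_sin].
Qed.

Lemma measurable_psum_cis c N A :
  measurable_fun A (fun t : T => cmod (psum c N (cis t)) ^+ 2)%R.
Proof.
apply: measurable_funTS; apply: measurable_sqr_cmod; apply: measurable_cplx_poly.
exact: measurable_cis.
Qed.

(** As on the disk: the integrand may be replaced by its average over rotations
    through multiples of [2 pi / N], which is constant by [discrete_parseval]. *)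
Lemma circle_parseval c N :
  \int[mu]_(t in `[0%R, (2 * pi)%R]) (cmod (psum c N (cis t)) ^+ 2)%:E =
  (2 * pi * \sum_(n < N) cmod (c n) ^+ 2)%:E.
Proof.
have p0 := pi_gt0 R.
case: N => [|m'].
  rewrite big_ord0 mulr0 integral0_eq// => t _.
  by rewrite /psum big_ord0 cmod0 expr0n.
move: m'.+1 (ltn0Sn m') => m m0n; have m0 : (0 < m%:R :> R)%R by rewrite ltr0n.
pose g (t : T) : \bar R := (cmod (psum c m (cis t)) ^+ 2)%:E.
have mg : measurable_fun setT g by apply/measurable_EFinP; exact: measurable_psum_cis.
have g0 t : 0 <= g t by rewrite lee_fin sqr_ge0.
rewrite -integral_itv_bndo_bndc; last exact: measurable_funTS.
apply: (pmule_inj m0).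
pose th k : R := (k%:R * (2 * pi / m%:R))%R.
transitivity (\sum_(k < m) \int[mu]_(t in `[0%R, (2 * pi)%R[) g (t + th k)%R).
  rewrite (eq_bigr (fun=> \int[mu]_(t in `[0%R, (2 * pi)%R[) g t)); last first.
    move=> k _; rewrite integral_period_translate//.
      rewrite /th mulr_ge0 ?divr_ge0 ?mulr_ge0 ?(ltW p0) ?(ltW m0)//=.
      rewrite mulrA ltr_pdivrMr// mulrC ltr_pM2l ?mulr_gt0//.
      by rewrite ltr_nat ltn_ord.
    by move=> t; rewrite /g cisD cis2pi mulr1.
  have -> : m%:R%:E = \sum_(k < m) 1%:E :> \bar R.
    by rewrite sumEFin sumr_const card_ord.
  by rewrite ge0_sume_distrl//; apply: eq_bigr => k _; rewrite mul1e.
have mgt k : measurable_fun setT (fun t : T => g ((t : R) + th k)%R).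
  by apply: measurableT_comp mg _; exact: measurable_funD.
rewrite -ge0_integral_sum//; last by move=> k; exact: measurable_funTS.
transitivity (\int[mu]_(t in `[0%R, (2 * pi)%R[)
    cst (m%:R * \sum_(n < m) cmod (c n) ^+ 2)%R%:E t).
  apply: eq_integral => t _; rewrite /g sumEFin; congr EFin.
  rewrite -[RHS](_ : m%:R * (\sum_(n < m) cmod (c n) ^+ 2 * cmod (cis t) ^+ (2 * n)) = _)%R.
    rewrite -discrete_parseval; apply: eq_bigr => k _.
    congr (cmod _ ^+ 2)%R; apply: eq_bigr => n _; congr (_ * _ ^+ _)%R.
    by rewrite addrC cisD /root_of_unity cisX.
  by congr (_ * _)%R; apply: eq_bigr => n _; rewrite cmod_cis expr1n mulr1.
rewrite integral_cst//= lebesgue_measure_itv/= lte_fin mulr_gt0// -EFinD -!EFinM.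
by congr EFin; ring.
Qed.

End CircleParseval.

(** * Boundary values *)

Section BoundaryValues.
Context (R : realType).
Local Notation mu := (@lebesgue_measure R).
Local Notation T := (measurableTypeR R).
Variables (a : nat -> R[i]) (M : R).
Hypothesis hM : forall N, \sum_(n < N) n%:R * cmod (a n) ^+ 2 <= M.

Lemma weighted_bound_ge0 : 0 <= M.
Proof. by have := hM 0; rewrite big_ord0. Qed.

(** Frequencies of a block are at least [4 ^ j], so that its squared norm on the
    circle is at most [4 ^ - j] times the Dirichlet sum: this leaves room for the
    factor [2 ^ j] in the oscillation below. *)
Definition dyadic_block j z := psum a (4 ^ j.+1) z - psum a (4 ^ j) z.

Lemma dyadic_blockE j z :
  dyadic_block j z = psum (fun n => if (4 ^ j <= n)%N then a n else 0) (4 ^ j.+1) z.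
Proof.
have le4 : (4 ^ j <= 4 ^ j.+1)%N by rewrite leq_exp2l.
rewrite /dyadic_block psum_diff// /psum -(big_mkord xpredT
  (fun n => (if (4 ^ j <= n)%N then a n else 0) * z ^+ n)).
rewrite [RHS](big_cat_nat (leq0n _) le4)/= [X in _ = X + _]big_nat_cond.
rewrite [X in _ = X + _]big1 ?add0r => [|n /andP[/andP[_ nj] _]]; last first.
  by rewrite leqNgt nj mul0r.
by rewrite big_nat [RHS]big_nat; apply: eq_bigr => n /andP[-> _].
Qed.

Lemma measurable_dyadic_block j A :
  measurable_fun A (fun t : T => cmod (dyadic_block j (cis t)) ^+ 2).
Proof. by under eq_fun do rewrite dyadic_blockE; exact: measurable_psum_cis. Qed.

Lemma integral_dyadic_block j :
  (\int[mu]_(t in `[0%R, (2 * pi)%R]) (cmod (dyadic_block j (cis t)) ^+ 2)%:E <=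
  (2 * pi * M * 4^-1 ^+ j)%:E)%E.
Proof.
under eq_integral do rewrite dyadic_blockE.
rewrite circle_parseval lee_fin -!mulrA !ler_pM2l ?pi_gt0// exprVn.
rewrite ler_pdivlMr ?exprn_gt0// mulrC mulr_sumr.
apply: le_trans (hM (4 ^ j.+1)); apply: ler_sum => n _.
case: ifPn => [jn|_]; last by rewrite cmod0 expr0n mulr0 mulr_ge0 ?sqr_ge0.
by rewrite ler_wpM2r ?sqr_ge0// -natrX ler_nat.
Qed.

(** Finiteness of this sum forces the dyadic partial sums to converge at a
    geometric rate; its integral is controlled by the Dirichlet integral. *)
Definition dyadic_oscillation (t : R) : \bar R :=
  (\sum_(0 <= j <oo) (2 ^+ j * cmod (dyadic_block j (cis t)) ^+ 2)%:E)%E.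

Local Notation osc := dyadic_oscillation.

Let osc_term_ge0 j (t : R) : (0 <= (2 ^+ j * cmod (dyadic_block j (cis t)) ^+ 2)%:E)%E.
Proof. by rewrite lee_fin mulr_ge0 ?sqr_ge0 ?exprn_ge0. Qed.

Lemma dyadic_oscillation_ge0 t : (0 <= osc t)%E.
Proof. by apply: nneseries_ge0 => j _ _; exact: osc_term_ge0. Qed.

Lemma measurable_dyadic_oscillation A : measurable_fun A (osc : T -> \bar R).
Proof.
apply: ge0_emeasurable_sum => [j t _ _|j _]; first exact: osc_term_ge0.
by apply/measurable_EFinP/measurable_funM => //; exact: measurable_dyadic_block.
Qed.

Lemma integral_dyadic_oscillation :
  (\int[mu]_(t in `[0%R, (2 * pi)%R]) osc t <= (4 * pi * M)%:E)%E.
Proof.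
rewrite integral_nneseries//; last first.
  by move=> j; apply/measurable_EFinP/measurable_funM => //; exact: measurable_dyadic_block.
have tj j : (\int[mu]_(t in `[0%R, (2 * pi)%R])
    (2 ^+ j * cmod (dyadic_block j (cis t)) ^+ 2)%:E <= (2 * pi * M * 2^-1 ^+ j)%:E)%E.
  under eq_integral do rewrite EFinM.
  rewrite ge0_integralZl//; last 2 first.
  - by apply/measurable_EFinP; exact: measurable_dyadic_block.
  - by move=> t _; rewrite lee_fin sqr_ge0.
  apply: (@le_trans _ _ ((2 ^+ j)%:E * (2 * pi * M * 4^-1 ^+ j)%:E)%E).
    by rewrite lee_wpmul2l ?lee_fin ?exprn_ge0 ?integral_dyadic_block.
  rewrite -EFinM lee_fin mulrCA ler_wpM2l ?mulr_ge0 ?pi_ge0 ?weighted_bound_ge0//.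
  rewrite -exprMn (_ : 2 * 4^-1 = 2^-1 :> R)//; lra.
apply: lime_le.
  by apply: is_cvg_nneseries => j _ _; apply: integral_ge0 => t _; exact: osc_term_ge0.
apply: nearW => N.
apply: (@le_trans _ _ (\sum_(0 <= j < N) (2 * pi * M * 2^-1 ^+ j)%:E)%E).
  by apply: lee_sum => j _; exact: tj.
rewrite sumEFin lee_fin -mulr_sumr big_mkord.
have -> : 4 * pi * M = 2 * pi * M * 2 by ring.
rewrite ler_wpM2l ?mulr_ge0 ?pi_ge0 ?weighted_bound_ge0//.
have := @geo_sum_le R 2^-1 N; rewrite (_ : (1 - 2^-1)^-1 = 2 :> R).
  by apply; apply/andP; split; lra.
have -> : 1 - 2^-1 = 2^-1 :> R by lra.
by rewrite invrK.
Qed.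

(** Each use of [|u + v|^2 <= 2 |u|^2 + 2 |v|^2], splitting off the first block,
    doubles the remainder, which the weights [2 ^ j] compensate. *)
Lemma dyadic_diff_le z k l : cmod (psum a (4 ^ (k + l)) z - psum a (4 ^ k) z) ^+ 2 <=
  2 * 2^-1 ^+ k * \sum_(k <= j < k + l) 2 ^+ j * cmod (dyadic_block j z) ^+ 2.
Proof.
elim: l k => [|l ih] k.
  by rewrite addn0 subrr cmod0 expr0n big_geq// mulr0.
rewrite addnS -addSn big_ltn; last by rewrite addSn ltnS leq_addr.
have := sqr_cmodD (dyadic_block k z) (psum a (4 ^ (k.+1 + l)) z - psum a (4 ^ k.+1) z).
have -> : dyadic_block k z + (psum a (4 ^ (k.+1 + l)) z - psum a (4 ^ k.+1) z) =
  psum a (4 ^ (k.+1 + l)) z - psum a (4 ^ k) z by rewrite /dyadic_block; ring.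
move=> /le_trans; apply; rewrite mulrDr; apply: lerD.
  have e : 2^-1 ^+ k * 2 ^+ k = 1 :> R by rewrite -exprMn mulVf// expr1n.
  set X := cmod _ ^+ 2; set h := 2^-1 ^+ k in e *; set h' := 2 ^+ k in e *.
  have -> : 2 * h * (h' * X) = (h * h') * (2 * X) by ring.
  by rewrite e mul1r.
have := ih k.+1; set S := \sum_(_ <= j < _) _; rewrite (exprS _ k).
set x := cmod _ ^+ 2; set y := 2^-1 ^+ k; lra.
Qed.

Lemma dyadic_cvg t g : osc t = g%:E -> exists L,
  cmod (psum a (4 ^ k) (cis t) - L) @[k --> \oo] --> (0 : R) /\
  forall k, cmod (psum a (4 ^ k) (cis t) - L) ^+ 2 <= 2 * 2^-1 ^+ k * g.
Proof.
move=> tg; have g0 : 0 <= g by rewrite -lee_fin -tg dyadic_oscillation_ge0.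
have h2 k l : (k <= l)%N ->
    cmod (psum a (4 ^ l) (cis t) - psum a (4 ^ k) (cis t)) ^+ 2 <= 2 * 2^-1 ^+ k * g.
  move=> kl; rewrite -(subnKC kl); apply: (le_trans (dyadic_diff_le _ _ _)).
  rewrite ler_wpM2l ?mulr_ge0 ?exprn_ge0 ?invr_ge0//.
  rewrite subnKC// -lee_fin -tg -sumEFin.
  apply: (@le_trans _ _ (\sum_(0 <= j < l) (2 ^+ j * cmod (dyadic_block j (cis t)) ^+ 2)%:E)%E).
    by rewrite [leRHS](big_cat_nat (leq0n k) kl)/= leeDr// sume_ge0.
  by apply: nneseries_lim_ge => *; exact: osc_term_ge0.
pose q : R := Num.sqrt 2^-1; have q2 : q ^+ 2 = 2^-1 by rewrite sqr_sqrtr// invr_ge0.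
have q0 : 0 <= q by rewrite sqrtr_ge0.
have q1 : q < 1 by rewrite -(ltr_pXn2r (ltn0Sn 1)) ?nnegrE// q2 expr1n; lra.
pose del k := Num.sqrt (2 * g) * q ^+ k.
have d0 : del @ \oo --> (0 : R).
  rewrite -[X in _ --> X](mulr0 (Num.sqrt (2 * g))); apply: cvgMr.
  by apply: cvg_expr; rewrite ger0_norm.
have d2 k : del k ^+ 2 = 2 * 2^-1 ^+ k * g.
  rewrite exprMn sqr_sqrtr ?mulr_ge0// -exprM mulnC exprM q2; ring.
have del0 k : 0 <= del k by rewrite mulr_ge0 ?sqrtr_ge0 ?exprn_ge0.
have h1 k l : (k <= l)%N ->
    cmod (psum a (4 ^ l) (cis t) - psum a (4 ^ k) (cis t)) <= del k.
  move=> kl; rewrite -(ler_pXn2r (ltn0Sn 1)) ?nnegrE ?cmod_ge0// d2; exact: h2.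
have [L hL] := cplx_cauchy_cvg d0 h1.
exists L; split => // k; rewrite -d2 lerXn2r ?nnegrE ?cmod_ge0//.
apply: (le_of_cvg0 hL); near=> l.
have kl : (k <= l)%N by near: l; exact: nbhs_infty_ge.
set u := psum a (4 ^ k) _; set v := psum a (4 ^ l) _.
have -> : u - L = (v - L) - (v - u) by ring.
by rewrite (le_trans (ler_cmodB _ _))// addrC lerD2r h1.
Unshelve. all: by end_near. Qed.

End BoundaryValues.

Section RadialLimit.
Context (R : realType).
Variables (a : nat -> R[i]) (M : R).
Hypothesis hM : forall N, \sum_(n < N) n%:R * cmod (a n) ^+ 2 <= M.

Lemma sum_nat_le N : \sum_(0 <= n < N) n%:R <= N%:R ^+ 2 :> R.
Proof.
elim: N => [|N ih]; first by rewrite big_geq// expr0n.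
rewrite big_nat_recr//= (le_trans (lerD ih (lexx _)))// -natr1 expr2.
by have : 0 <= N%:R :> R by []; nra.
Qed.

(** Fejér's comparison of Abel and partial sums, the Cauchy-Schwarz inequality
    being replaced by the arithmetic-geometric one with parameter [e]. *)
Lemma abel_partial_sum_le (e d : R) n0 N K (z : R[i]) : 0 < e -> cmod z = 1 ->
  0 < d < 1 -> (n0 <= N)%N -> (0 < N)%N -> (N <= K)%N ->
  N%:R * d <= 1 -> 1 <= 4 * (N%:R * d) ->
  \sum_(n0 <= n < K) n%:R * cmod (a n) ^+ 2 <= e ^+ 2 ->
  cmod (psum a K ((1 - d)%:C%C * z) - psum a N z) <=
  d * \sum_(0 <= n < n0) n%:R * cmod (a n) + 3 * e.
Proof.
move=> e0 z1 /andP[d0 d1] nN N0 NK Nd1 Nd4 htail.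
pose r := 1 - d; have r0 : 0 < r by rewrite /r; lra.
have r1 : r < 1 by rewrite /r; lra.
have N0' : 0 < N%:R :> R by rewrite ltr0n.
have rn n : 1 - n%:R * d <= r ^+ n by exact/bernoulli_le/ltW.
have rC n : (r ^+ n)%:C%C = r%:C%C ^+ n by exact: rmorphXn.
have rC1 n : (r ^+ n - 1)%:C%C = r%:C%C ^+ n - 1.
  by rewrite -rC -(rmorph1 (real_complex R)) -rmorphB.
have -> : psum a K (r%:C%C * z) - psum a N z =
    \sum_(0 <= n < N) a n * z ^+ n * (r ^+ n - 1)%:C%C
    + \sum_(N <= n < K) a n * z ^+ n * (r ^+ n)%:C%C.
  rewrite -[psum a K _](subrK (psum a N (r%:C%C * z))) psum_diff//.
  rewrite -addrA addrC; congr (_ + _).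
    rewrite /psum -sumrB big_mkord; apply: eq_bigr => n _.
    by rewrite exprMn rC1; ring.
  by apply: eq_bigr => n _; rewrite exprMn rC; ring.
rewrite (le_trans (ler_cmodD _ _))//.
have cz n : cmod (a n * z ^+ n) = cmod (a n) by rewrite cmodM cmodX z1 expr1n mulr1.
have head n : cmod (a n * z ^+ n * (r ^+ n - 1)%:C%C) <= d * (n%:R * cmod (a n)).
  rewrite cmodM cz cmod_real ler0_norm; last by rewrite subr_le0 exprn_ile1// ltW.
  by rewrite (mulrA d) [leLHS]mulrC ler_wpM2r ?cmod_ge0//; have := rn n; lra.
have S1 : cmod (\sum_(0 <= n < N) a n * z ^+ n * (r ^+ n - 1)%:C%C) <=
    d * (\sum_(0 <= n < n0) n%:R * cmod (a n)) +
    \sum_(n0 <= n < N) (n%:R * cmod (a n) ^+ 2 / (2 * e)) + e / 2.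
  rewrite (le_trans (ler_cmod_sum _ _ _))// (big_cat_nat (leq0n n0) nN)/= -addrA.
  apply: lerD; first by rewrite mulr_sumr; apply: ler_sum => n _; exact: head.
  apply: (@le_trans _ _ (\sum_(n0 <= n < N) (n%:R * cmod (a n) ^+ 2 / (2 * e)
     + e * d ^+ 2 / 2 * n%:R))).
    apply: ler_sum => n _; rewrite (le_trans (head n))//.
    have n0' : 0 <= n%:R :> R by [].
    rewrite -subr_ge0; have -> : n%:R * cmod (a n) ^+ 2 / (2 * e) + e * d ^+ 2 / 2 * n%:R
      - d * (n%:R * cmod (a n)) = n%:R * (cmod (a n) - e * d) ^+ 2 / (2 * e).
      by field; rewrite gt_eqF.
    apply: divr_ge0; first by apply: mulr_ge0 => //; exact: sqr_ge0.
    by rewrite mulr_ge0// ltW.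
  rewrite big_split /= lerD2l -mulr_sumr.
  apply: (@le_trans _ _ (e * d ^+ 2 / 2 * N%:R ^+ 2)).
    apply: ler_wpM2l; first by rewrite divr_ge0 ?mulr_ge0 ?sqr_ge0 ?ltW.
    apply: le_trans (sum_nat_le N) => //.
    rewrite [leRHS](big_cat_nat (leq0n n0) nN)/= lerDr; exact: sumr_ge0.
  have : (N%:R * d) ^+ 2 <= 1 by rewrite expr_le1// mulr_ge0 ?ltW.
  rewrite exprMn => h.
  have := ler_wpM2l (ltW e0) h; lra.
have S2 : cmod (\sum_(N <= n < K) a n * z ^+ n * (r ^+ n)%:C%C) <=
    \sum_(N <= n < K) (n%:R * cmod (a n) ^+ 2 / (2 * e)) + 2 * e.
  rewrite (le_trans (ler_cmod_sum _ _ _))//.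
  apply: (@le_trans _ _ (\sum_(N <= n < K) (n%:R * cmod (a n) ^+ 2 / (2 * e)
     + e / (2 * N%:R) * r ^+ n))).
    rewrite big_nat [leRHS]big_nat; apply: ler_sum => n /andP[Nn _].
    have n0' : 0 < n%:R :> R by rewrite ltr0n (leq_trans N0).
    have rn0 : 0 < r ^+ n by rewrite exprn_gt0.
    rewrite cmodM cz cmod_real gtr0_norm//.
    apply: (@le_trans _ _ (n%:R * cmod (a n) ^+ 2 / (2 * e) + e / (2 * n%:R) * r ^+ n)).
      apply: (@le_trans _ _ (n%:R * cmod (a n) ^+ 2 / (2 * e)
          + e / (2 * n%:R) * (r ^+ n) ^+ 2)); last first.
        rewrite lerD2l ler_wpM2l//; first by rewrite divr_ge0 ?mulr_ge0 ?ltW.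
        by rewrite expr2 ler_piMr ?(ltW rn0)// exprn_ile1// ltW.
      rewrite -subr_ge0.
      have -> : n%:R * cmod (a n) ^+ 2 / (2 * e) + e / (2 * n%:R) * (r ^+ n) ^+ 2
        - cmod (a n) * r ^+ n = n%:R / (2 * e) * (cmod (a n) - e / n%:R * r ^+ n) ^+ 2.
        by field; rewrite !gt_eqF.
      apply: mulr_ge0; last exact: sqr_ge0.
      by rewrite divr_ge0 ?mulr_ge0// ltW.
    rewrite lerD2l ler_wpM2r ?(ltW rn0)// ler_pM2l//.
    by rewrite lef_pV2 ?posrE ?mulr_gt0// ler_pM2l// ler_nat.
  rewrite big_split /= lerD2l -mulr_sumr.
  apply: (@le_trans _ _ (e / (2 * N%:R) * (d^-1))).
    apply: ler_wpM2l; first by rewrite divr_ge0 ?mulr_ge0 ?ltW.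
    have := @geo_sum_tail_le R r N K; rewrite (_ : 1 - r = d); last by rewrite /r; lra.
    move=> h; apply: (le_trans (h _)); first by rewrite r1 ltW.
    by rewrite ler_pdivrMr// mulVf ?gt_eqF// exprn_ile1// ltW.
  rewrite -[leLHS](_ : e / (2 * (N%:R * d)) = _); last first.
    by field; rewrite !gt_eqF.
  rewrite ler_pdivrMr ?mulr_gt0//.
  by have := ler_wpM2l (ltW e0) Nd4; lra.
apply: (le_trans (lerD S1 S2)).
have : (\sum_(n0 <= n < K) n%:R * cmod (a n) ^+ 2) / (2 * e) <= e / 2.
  rewrite ler_pdivrMr ?mulr_gt0//; apply: (le_trans htail).
  by rewrite expr2; lra.
rewrite (big_cat_nat nN NK)/= mulrDl !mulr_suml; lra.
Qed.

Lemma pow4_bracket (d : R) k0 : 0 < d -> (4 ^ k0)%:R * d <= 1 ->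
  exists k, [/\ (k0 <= k)%N, (4 ^ k)%:R * d <= 1 & 1 <= 4 * ((4 ^ k)%:R * d)].
Proof.
move=> d0 h0.
have ex : exists j, 1 < (4 ^ (k0 + j).+1)%:R * d.
  exists (Num.bound d^-1); set n := Num.bound _.
  have hn : d^-1 < n%:R by apply: archi_boundP; rewrite invr_ge0 ltW.
  rewrite -ltr_pdivrMr// mul1r (lt_le_trans hn)// ler_nat.
  rewrite (leq_trans (ltnW (@ltn_expl 4 n _)))// leq_exp2l//.
  by rewrite (leq_trans (leq_addl k0 n))// leqnSn.
case: (ex_minnP ex) => j hj jmin; exists (k0 + j)%N; split.
- exact: leq_addr.
- case: j hj jmin => [|j] hj jmin; first by rewrite addn0.
  by rewrite leNgt; apply/negP; rewrite addnS => /jmin; rewrite ltnn.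
- by apply: ltW; rewrite mulrA -natrM -expnS.
Qed.

(** The value at radius [1 - d] is compared with the partial sum of length [4 ^ k],
    where [4 ^ k] is the power of [4] closest below [1 / d]: a power series with
    finite Dirichlet integral has a radial limit wherever its partial sums of these
    lengths converge. *)
Lemma radial_limitE f z L : is_taylor a f -> cmod z = 1 ->
  cmod (psum a (4 ^ k) z - L) @[k --> \oo] --> (0 : R) -> radial_limit f z = L.
Proof.
move=> h z1 hL.
suff H : (f (r%:C%C * z) : R[i]^o) @[r --> (1 : R)^'-] --> (L : R[i]^o).
  exact: (cvg_lim (@norm_hausdorff _ _) H).
apply/cplx_cvgP; apply/cvgrPdist_le => e e0.
pose e' := e / 8; have e'0 : 0 < e' by rewrite /e'; lra.
have [n0 hn0] : exists n0, forall N, (n0 <= N)%N ->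
    \sum_(n0 <= n < N) n%:R * cmod (a n) ^+ 2 <= e' ^+ 2.
  apply: (bounded_sum_tail (M := M)); last exact: exprn_gt0.
    by move=> n; apply: mulr_ge0 => //; exact: sqr_ge0.
  by move=> N; rewrite big_mkord.
pose C := \sum_(0 <= n < n0) n%:R * cmod (a n).
have C0 : 0 <= C by apply: sumr_ge0 => n _; rewrite mulr_ge0 ?cmod_ge0.
have [k1 hk1] := cvg0_lt hL e'0.
pose k0 := maxn k1 n0.
pose d0 : R := Num.min (4 ^ k0)%:R^-1 (e' / (C + 1)).
have p0 : 0 < (4 ^ k0)%:R :> R by rewrite ltr0n expn_gt0.
have d00 : 0 < d0 by rewrite lt_min invr_gt0 p0 divr_gt0//; lra.
near=> r.
have r1 : r < 1 by near: r; exact: nbhs_left_lt.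
have rd : 1 - d0 < r by near: r; apply: nbhs_left_gt; rewrite gtrBl.
have r0 : 0 < r by near: r; apply: nbhs_left_gt.
pose d := 1 - r; have dpos : 0 < d by rewrite /d; lra.
have dd : d < d0 by rewrite /d; lra.
have [dd1 dd2] : d <= (4 ^ k0)%:R^-1 /\ d <= e' / (C + 1).
  by move: (ltW dd); rewrite /d0 le_min => /andP.
have hd1 : (4 ^ k0)%:R * d <= 1 by rewrite mulrC -ler_pdivlMr// mul1r.
have hd2 : d * C <= e'.
  have c1 : 0 < C + 1 by lra.
  by move: dd2; rewrite ler_pdivlMr//; nra.
have [k [k0k Nd1 Nd4]] := pow4_bracket dpos hd1.
set N := (4 ^ k)%N in Nd1 Nd4.
have nN : (n0 <= N)%N.
  apply: (leq_trans (leq_maxr k1 n0)); apply: (leq_trans k0k).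
  by rewrite ltnW// ltn_expl.
have kL : cmod (psum a N z - L) < e'.
  by apply: hk1; apply: leq_trans k0k; exact: leq_maxl.
have fr : psum_cvg a (r%:C%C * z) (f (r%:C%C * z)).
  by apply: h; rewrite cmodM z1 mulr1 cmod_real gtr0_norm.
rewrite sub0r normrN ger0_norm ?cmod_ge0//.
have main : cmod (f (r%:C%C * z) - psum a N z) <= d * C + 3 * e'.
  apply: (le_of_cvg0 fr); near=> K.
  have NK : (N <= K)%N by near: K; exact: nbhs_infty_ge.
  have -> : f (r%:C%C * z) - psum a N z = (psum a K (r%:C%C * z) - psum a N z)
     - (psum a K (r%:C%C * z) - f (r%:C%C * z)) by ring.
  rewrite (le_trans (ler_cmodB _ _))// lerD2r.
  have -> : r = 1 - d by rewrite /d; ring.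
  apply: abel_partial_sum_le => //.
  - by rewrite dpos /d; lra.
  - by rewrite expn_gt0.
  - by apply: hn0; exact: leq_trans NK.
have -> : f (r%:C%C * z) - L = (f (r%:C%C * z) - psum a N z) + (psum a N z - L) by ring.
rewrite (le_trans (ler_cmodD _ _))//; move: hd2 kL main; rewrite /e'; lra.
Unshelve. all: by end_near. Qed.

End RadialLimit.

(** * Dividing by the kernel: an upper bound by boundary values *)

Section KernelDivision.
Context (R : realType).
Local Notation mu := (@lebesgue_measure R).
Local Notation T := (measurableTypeR R).
Variables (c : nat -> R[i]) (M : R).
Hypothesis hM : forall N, \sum_(n < N) n%:R * cmod (c n) ^+ 2 <= M.
Variable w : R[i].
Hypothesis w1 : cmod w < 1.
Local Notation h := (kernel_div w c).

Lemma psum_kernel_div N z : psum c N.+1 z =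
  (1 - w^*%C * z) * psum h N.+1 z + w^*%C * h N * z ^+ N.+1.
Proof.
elim: N => [|N ih]; first by rewrite /psum !big_ord1 /= expr1 !expr0; ring.
rewrite psumS ih [in RHS]psumS {1}(kernel_divK w c N.+1) /=.
by rewrite (exprS z N.+1); ring.
Qed.

Lemma coef_cvg0 (e : R) : 0 < e -> exists n0, forall n, (n0 <= n)%N -> cmod (c n) <= e.
Proof.
move=> e0; pose n0 := (Num.bound (M / e ^+ 2)).+1; exists n0 => n n0n.
have n0' : 0 < n%:R :> R by rewrite ltr0n (leq_trans _ n0n).
have M0 := weighted_bound_ge0 hM.
have hn : M / e ^+ 2 <= n%:R.
  apply: (@le_trans _ _ (Num.bound (M / e ^+ 2))%:R).
    by apply/ltW/archi_boundP; rewrite divr_ge0 ?exprn_ge0 ?(ltW e0).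
  by rewrite ler_nat (leq_trans _ n0n).
rewrite -(ler_pXn2r (ltn0Sn 1)) ?nnegrE ?cmod_ge0 ?(ltW e0)//.
have : n%:R * cmod (c n) ^+ 2 <= M.
  apply: le_trans (hM n.+1); rewrite big_ord_recr /= lerDr sumr_ge0// => i _.
  by apply: mulr_ge0 => //; exact: sqr_ge0.
move: hn; rewrite ler_pdivrMr ?exprn_gt0// => h1 h2.
by rewrite -(ler_pM2l n0'); exact: le_trans h2 h1.
Qed.

(** The recursion for [h] contracts by [|w| < 1] and its source term tends to
    zero. *)
Lemma kernel_div_cvg0 (e : R) : 0 < e ->
  exists n0, forall n, (n0 <= n)%N -> cmod (h n) <= e.
Proof.
move=> e0; pose e' := e * (1 - cmod w) / 2.
have e'0 : 0 < e' by rewrite /e' !mulr_gt0 ?subr_gt0// invr_gt0.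
have [n0 hn0] := coef_cvg0 e'0.
have rec j : cmod (h (n0 + j)) <= e / 2 + cmod w ^+ j * cmod (h n0).
  elim: j => [|j ih]; first by rewrite addn0 expr0 mul1r lerDr divr_ge0 ?ltW.
  rewrite addnS /= (le_trans (ler_cmodD _ _))// cmodM cmod_conj.
  have h1 := hn0 (n0 + j).+1 (leqW (leq_addr j n0)).
  have h2 := ler_wpM2l (cmod_ge0 w) ih.
  rewrite (le_trans (lerD h1 h2))// /e' exprS -!mulrA; lra.
have w0 := cmod_ge0 w; have H0 := cmod_ge0 (h n0).
have q0 : (fun j => cmod w ^+ j * cmod (h n0)) @ \oo --> (0 : R).
  rewrite -[X in _ --> X](mul0r (cmod (h n0))); apply: cvgMl.
  by apply: cvg_expr; rewrite ger0_norm.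
have e20 : 0 < e / 2 by lra.
have [j0 hj0] := cvg0_lt q0 e20.
exists (n0 + j0)%N => n nn; rewrite -(subnKC (leq_trans (leq_addr j0 n0) nn)).
rewrite (le_trans (rec _))//; have := hj0 (n - n0)%N; rewrite leq_subRL; last first.
  by rewrite (leq_trans _ nn)// leq_addr.
by move=> /(_ nn); lra.
Qed.

Let K := 1 - cmod w ^+ 2.

Let K_ge0 : 0 <= K. Proof. exact: sqr_cmod_lt1. Qed.

Lemma dist_circle_ge z : cmod z = 1 -> 1 - cmod w <= cmod (z - w).
Proof. by move=> z1; rewrite -z1 ler_cmod_dist. Qed.

Lemma sqr_psum_kernel_div_le N z : cmod z = 1 ->
  cmod (psum h N.+1 z) ^+ 2 <=
  (2 * cmod (psum c N.+1 z) ^+ 2 + 2 * cmod (h N) ^+ 2) / cmod (z - w) ^+ 2.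
Proof.
move=> z1; have d0 : 0 < cmod (z - w).
  by rewrite (lt_le_trans _ (dist_circle_ge z1))// subr_gt0.
rewrite ler_pdivlMr ?exprn_gt0// -exprMn mulrC -(cmod_sub_circle w z1) -cmodM.
have -> : (1 - w^*%C * z) * psum h N.+1 z = psum c N.+1 z + - (w^*%C * h N * z ^+ N.+1).
  by rewrite psum_kernel_div; ring.
rewrite (le_trans (sqr_cmodD _ _))// lerD2l ler_pM2l// cmodN !cmodM cmodX z1 expr1n mulr1.
rewrite cmod_conj exprMn ler_piMl ?sqr_ge0// expr_le1 ?cmod_ge0//; exact: ltW.
Qed.

(** Bessel's inequality for [h] on the circle, where [|h| = |f| / |z - w|]; the
    dyadic sums of [f] are compared with the boundary values of [f] by means of
    the dyadic oscillation, whose coefficient tends to zero. *)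
Lemma kernel_div_integral_bound (U : T -> R) (B : R) :
  measurable_fun setT U -> (forall t, 0 <= U t) ->
  (\int[mu]_(t in `[0%R, (2 * pi)%R]) (U t)%:E <= B%:E)%E ->
  {ae mu, forall t : R, t \in `[0, 2 * pi] -> forall L,
    cmod (psum c (4 ^ k) (cis t) - L) @[k --> \oo] --> (0 : R) ->
    K * cmod L ^+ 2 / cmod (cis t - w) ^+ 2 <= U t} ->
  forall N, K * \sum_(n < N) cmod (h n) ^+ 2 <= B.
Proof.
move=> mU U0 hB hae N0.
have p0 := pi_gt0 R; have M0 := weighted_bound_ge0 hM.
have w1' : 0 < 1 - cmod w by rewrite subr_gt0.
have [Pm PmE Pm0] : exists2 Pm, Pm = K / (1 - cmod w) ^+ 2 & 0 < Pm.
  eexists; first exact: erefl.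
  by apply: divr_gt0; [rewrite /K subr_gt0 expr_lt1 ?cmod_ge0|exact: exprn_gt0].
pose H k := cmod (h (4 ^ k).-1) ^+ 2.
have pow4S k : (4 ^ k = (4 ^ k).-1.+1)%N by rewrite prednK// expn_gt0.
have key k : 2 * pi * (K * \sum_(n < 4 ^ k) cmod (h n) ^+ 2) <=
    4 * B + 32 * Pm * pi * M * 2^-1 ^+ k + 4 * Pm * pi * H k.
  rewrite mulrCA -lee_fin EFinM -circle_parseval.
  rewrite -ge0_integralZl//; last 2 first.
  - by apply/measurable_EFinP; exact: measurable_psum_cis.
  - by move=> t _; rewrite lee_fin sqr_ge0.
  pose osc := dyadic_oscillation c.
  have mosc : measurable_fun `[0%R, (2 * pi)%R] (osc : T -> \bar R).
    exact: measurable_dyadic_oscillation.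
  have osc0 t : (0 <= osc t)%E := dyadic_oscillation_ge0 c t.
  pose c1 := 8 * Pm * 2^-1 ^+ k; pose c2 := 2 * Pm * H k.
  have c10 : 0 < c1 by rewrite /c1 !mulr_gt0 ?exprn_gt0 ?invr_gt0.
  have c20 : 0 <= c2.
    by apply: mulr_ge0; [rewrite mulr_ge0// ltW|exact: sqr_ge0].
  have mU' : measurable_fun `[0%R, (2 * pi)%R] (fun t : T => (4 * U t)%:E).
    by apply/measurable_EFinP; apply: measurable_funM => //; exact: measurable_funTS.
  have mc1 : measurable_fun `[0%R, (2 * pi)%R] (fun t : T => c1%:E * osc t)%E.
    exact: measurable_funeM.
  have U4 t : (0 <= (4 * U t)%:E)%E by rewrite lee_fin mulr_ge0.
  have osc4 t : (0 <= c1%:E * osc t)%E by rewrite mule_ge0// lee_fin ltW.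
  apply: (@le_trans _ _ (\int[mu]_(t in `[0%R, (2 * pi)%R])
      ((4 * U t)%:E + c1%:E * osc t + cst c2%:E t))%E).
    apply: ae_ge0_le_integral => //.
    - by move=> t _; rewrite mule_ge0// lee_fin ?sqr_ge0.
    - by apply: measurable_funeM; apply/measurable_EFinP; exact: measurable_psum_cis.
    - by move=> t _; rewrite !adde_ge0// lee_fin.
    - by apply: emeasurable_funD => //; exact: emeasurable_funD.
    move: hae; apply: (@filterS _ _ (ae_filter_ringOfSetsType mu)) => t ht t2pi; have {}ht := ht t2pi.
    have [[g tg]|->] : (exists g, osc t = g%:E) \/ osc t = +oo%E.
    - by case: (osc t) (osc0 t) => [g _|_|//]; [left; exists g|right].
    2: by rewrite gt0_muley ?lte_fin// addey// addye// leey.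
    have [L [hL1 hL2]] := dyadic_cvg tg.
    have {}ht := ht L hL1.
    rewrite tg -!EFinM -!EFinD lee_fin.
    set z : R[i] := cis t; have z1 : cmod z = 1 by exact: cmod_cis.
    have d0 : 0 < cmod (z - w).
      by rewrite (lt_le_trans _ (dist_circle_ge z1))// subr_gt0.
    have S1 := sqr_psum_kernel_div_le (4 ^ k).-1 z1.
    rewrite -pow4S in S1.
    have S2 := sqr_cmodD L (psum c (4 ^ k) z - L); rewrite addrC subrK in S2.
    have S3 := hL2 k; rewrite -/z in S3.
    have P1 : K / cmod (z - w) ^+ 2 <= Pm.
      rewrite PmE ler_wpM2l// lef_pV2 ?posrE ?exprn_gt0//.
      rewrite lerXn2r ?nnegrE ?cmod_ge0 ?(ltW w1')//; exact: dist_circle_ge.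
    have P0 : 0 <= K / cmod (z - w) ^+ 2 by rewrite divr_ge0// sqr_ge0.
    set P := K / _ in P1 P0.
    have g0 : 0 <= g by rewrite -lee_fin -tg.
    have ht' : P * cmod L ^+ 2 <= U t by rewrite /P mulrAC.
    have A1 : K * cmod (psum h (4 ^ k) z) ^+ 2 <=
        P * (2 * cmod (psum c (4 ^ k) z) ^+ 2 + 2 * H k).
      by rewrite /P mulrAC -mulrA; exact: ler_wpM2l K_ge0 _ _ S1.
    apply: (le_trans A1).
    have A2 : P * (2 * cmod (psum c (4 ^ k) z) ^+ 2) <=
        P * (2 * (2 * cmod L ^+ 2 + 2 * (2 * 2^-1 ^+ k * g))).
      apply: ler_wpM2l => //; rewrite ler_pM2l//; apply: (le_trans S2).
      by rewrite lerD2l ler_pM2l.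
    have X0 : 0 <= 2^-1 ^+ k * g :> R by rewrite mulr_ge0// exprn_ge0// invr_ge0.
    have A3 := ler_wpM2r X0 P1.
    have A4 := ler_wpM2r (sqr_ge0 (cmod (h (4 ^ k).-1))) P1.
    rewrite mulrDr /c1 /c2 /H; lra.
  rewrite ge0_integralD//; last 2 first.
  - by move=> t _; rewrite adde_ge0.
  - exact: emeasurable_funD.
  rewrite ge0_integralD// integral_cst//= lebesgue_measure_itv/= lte_fin mulr_gt0//.
  rewrite [X in (_ + X + _)%E]ge0_integralZl//; last by rewrite lee_fin ltW.
  have -> : (\int[mu]_(t in `[0%R, (2 * pi)%R]) (4 * U t)%:E =
      4%:E * \int[mu]_(t in `[0%R, (2 * pi)%R]) (U t)%:E)%E.
    rewrite -ge0_integralZl//.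
    - by apply/measurable_EFinP; exact: measurable_funTS.
    - by move=> t _; rewrite lee_fin.
  have I2 : (c1%:E * \int[mu]_(t in `[0%R, (2 * pi)%R]) osc t <=
      c1%:E * (4 * pi * M)%:E)%E.
    apply: lee_wpmul2l; first by rewrite lee_fin ltW.
    exact: integral_dyadic_oscillation.
  have I1 : (4%:E * \int[mu]_(t in `[0%R, (2 * pi)%R]) (U t)%:E <= 4%:E * B%:E)%E.
    by apply: lee_wpmul2l.
  apply: (le_trans (leeD (leeD I1 I2) (lexx _))).
  rewrite -EFinB -!EFinM -!EFinD lee_fin /c1 /c2; lra.
have B0 : 0 <= B.
  by rewrite -lee_fin (le_trans _ hB)//; apply: integral_ge0 => t _; rewrite lee_fin.
(* Two uses of |u + v|^2 <= 2 |u|^2 + 2 |v|^2 have cost the factor 4 in front of B,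
   which the length 2 pi of the circle absorbs. *)
have pi2 : 2 <= pi :> R by have := pihalf_ge1 R; lra.
apply/ler_addgt0Pr => e e0.
pose e2 := Num.min 1 (e / (4 * Pm)).
have e20 : 0 < e2 by rewrite lt_min ltr01 divr_gt0 ?mulr_gt0.
have [e21 e2e] : e2 <= 1 /\ e2 <= e / (4 * Pm) by apply/andP; rewrite -le_min.
have [n0 hn0] := kernel_div_cvg0 e20.
have T0 : (fun k => 32 * Pm * M * 2^-1 ^+ k) @ \oo --> (0 : R).
  rewrite -[X in _ --> X](mulr0 (32 * Pm * M)); apply: cvgMr.
  by apply: cvg_expr; rewrite ger0_norm ?invr_ge0// invf_lt1// ltr1n.
have [k0 hk0] := cvg0_lt T0 e0.
pose k := maxn k0 (maxn n0 N0).
have k1 : (k0 <= k)%N by exact: leq_maxl.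
have k2 : (n0 <= k)%N by rewrite (leq_trans (leq_maxl n0 N0))// leq_maxr.
have k3 : (N0 <= k)%N by rewrite (leq_trans (leq_maxr n0 N0))// leq_maxr.
have k4 : (k < 4 ^ k)%N by exact: ltn_expl.
have Hk : H k <= e / (4 * Pm).
  have h1 : cmod (h (4 ^ k).-1) <= e2.
    by apply: hn0; rewrite -ltnS -pow4S (leq_ltn_trans k2).
  apply: le_trans e2e; rewrite /H expr2 -[leRHS]mul1r.
  by apply: ler_pM; rewrite ?cmod_ge0// (le_trans h1).
have {}Hk : 4 * Pm * H k <= e by rewrite mulrC -ler_pdivlMr ?mulr_gt0.
have mono : \sum_(n < N0) cmod (h n) ^+ 2 <= \sum_(n < 4 ^ k) cmod (h n) ^+ 2.
  have le : (N0 <= 4 ^ k)%N by rewrite (leq_trans k3)// ltnW.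
  rewrite -!(big_mkord xpredT (fun n => cmod (h n) ^+ 2)).
  by rewrite [leRHS](big_cat_nat (leq0n N0) le)/= lerDl sumr_ge0// => n _; exact: sqr_ge0.
apply: (le_trans (ler_wpM2l K_ge0 mono)).
have := key k; have := hk0 k k1 => /ltW h1.
have A1 := ler_wpM2l (ltW p0) h1; have A2 := ler_wpM2l (ltW p0) Hk.
set Q := K * _ => h2.
have A3 : 2 * pi * Q <= 4 * B + pi * e + pi * e by apply: (le_trans h2); lra.
have A4 := ler_wpM2r B0 pi2.
rewrite -(ler_pM2l (x := 2 * pi)) ?mulr_gt0//; apply: (le_trans A3); lra.
Qed.

End KernelDivision.

(** * Geometry of the circle *)

Section CircleGeometry.
Context (R : realType).
Implicit Types (x y t u : R) (a z : R[i]).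

Lemma sin_MVT y : 0 <= y -> exists2 x, x \in `[0, y]%R & sin y = cos x * y.
Proof.
move=> y0; have ds x : x \in `]0, y[%R -> is_derive x 1 sin (cos x).
  by move=> _; exact: is_derive_sin.
have cs : {within `[0, y], continuous (@sin R)}.
  by apply: continuous_subspaceT => x; exact: continuous_sin.
by have [x xy] := MVT_segment y0 ds cs; rewrite sin0 !subr0 => e; exists x.
Qed.

Lemma sin_le y : 0 <= y -> sin y <= y.
Proof.
move=> y0; have [x _ ->] := sin_MVT y0.
by rewrite -[leRHS]mul1r ler_wpM2r// cos_le1.
Qed.

Lemma cis_sub1_sqr u : cmod (cis u - 1 : R[i]) ^+ 2 = (2 * sin (u / 2)) ^+ 2.
Proof.
rewrite cmod_sqr /cis /= oppr0 addr0.
have cu : cos u = cos (u / 2) * cos (u / 2) - sin (u / 2) * sin (u / 2).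
  by rewrite -cosD; congr cos; lra.
have su : sin u = sin (u / 2) * cos (u / 2) + cos (u / 2) * sin (u / 2).
  by rewrite -sinD; congr sin; lra.
rewrite cu su; move: (cos2Dsin2 (u / 2)).
move: (cos _) (sin _) => c s e; have -> : c * c - s * s - 1 = - 2 * s ^+ 2 by lra.
have -> : (s * c + c * s) ^+ 2 = 4 * s ^+ 2 * c ^+ 2 by ring.
have -> : c ^+ 2 = 1 - s ^+ 2 by lra.
ring.
Qed.

Lemma cis_sub1 u : 0 <= u <= pi -> cmod (cis u - 1 : R[i]) = 2 * sin (u / 2).
Proof.
move=> /andP[u0 upi]; apply/eqP; rewrite -(eqrXn2 (ltn0Sn 1)) ?cmod_ge0//.
  by rewrite cis_sub1_sqr.
by rewrite mulr_ge0// sin_ge0_pi//; have := pi_gt0 R; lra.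
Qed.

Lemma sin_ge_quarter y : 0 <= y <= pi / 2 -> y / 4 <= sin y.
Proof.
move=> /andP[y0 ypi].
have cos1 x : 0 <= x <= 1 -> 2^-1 <= cos x.
  move=> /andP[x0 x1]; have -> : x = x / 2 + x / 2 by lra.
  rewrite cosD; have x2 : 0 <= x / 2 by lra.
  have h1 := sin_le x2; have h2 := cos2Dsin2 (x / 2).
  have h3 : 0 <= sin (x / 2).
    by apply: sin_ge0_pi; have := pihalf_ge1 R; lra.
  by nra.
have small x : 0 <= x <= 1 -> x / 2 <= sin x.
  move=> /andP[x0 x1]; have [v] := sin_MVT x0; rewrite in_itv/= => /andP[v0 vx] ->.
  have : 2^-1 <= cos v by apply: cos1; apply/andP; split; lra.
  by nra.
have [y1|y1] := leP y 1.
  by have : y / 2 <= sin y by [apply: small; rewrite y0]; lra.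
have h1 : 1 / 2 <= sin 1 :> R by apply: small; lra.
have h2 : sin 1 < sin y.
  by rewrite ltr_sin// in_itv/=; have := pi_gt0 R; lra.
by have := pihalf_lt2 R; lra.
Qed.

Lemma cisN_sub1 u : cmod (cis (- u) - 1 : R[i]) = cmod (cis u - 1).
Proof.
by rewrite -[LHS]cmod_conj rmorphB rmorph1 /cis cosN sinN /= opprK.
Qed.

Lemma cis_sub1_bounds u : `|u| <= pi ->
  `|u| / 4 <= cmod (cis u - 1 : R[i]) <= `|u|.
Proof.
move=> upi; have -> : cmod (cis u - 1 : R[i]) = cmod (cis `|u| - 1).
  by case: ger0P => // _; rewrite cisN_sub1.
have u0 := normr_ge0 u; move: `|u| u0 upi => v v0 vpi.
rewrite cis_sub1 ?v0//.
have h1 : v / 2 / 4 <= sin (v / 2) by apply: sin_ge_quarter; lra.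
have h2 : sin (v / 2) <= v / 2 by apply: sin_le; lra.
by apply/andP; split; lra.
Qed.

Lemma circle_cis z : cmod z = 1 -> exists2 t, - pi <= t <= pi & z = cis t.
Proof.
case: z => x y z1; have := cmod_sqr (x +i* y)%C; rewrite z1 expr1n /= => e.
have x1 : -1 <= x <= 1 by apply/andP; split; nra.
have p0 := pi_gt0 R; have a0 := acos_ge0 x1; have a1 := acos_lepi x1.
have cx : cos (acos x) = x by apply: acosK; rewrite in_itv.
have sx : sin (acos x) = `|y|.
  by rewrite sin_acos// -sqrtr_sqr; congr Num.sqrt; lra.
have [y0|y0] := leP 0 y.
  exists (acos x); first by apply/andP; split; lra.
  by rewrite /cis cx sx ger0_norm.
exists (- acos x); first by apply/andP; split; lra.
by rewrite /cis cosN sinN cx sx ltr0_norm// opprK.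
Qed.

Lemma polar_form a : exists2 t, - pi <= t <= pi & a = (cmod a)%:C%C * cis t.
Proof.
have p0 := pi_gt0 R.
have [->|a0] := eqVneq a 0; first by exists 0; [lra|rewrite cmod0 mul0r].
have c0 : (cmod a)%:C%C != 0 :> R[i].
  by rewrite -[0]/((0 : R)%:C%C) (inj_eq (@complexI R)) cmod_eq0.
have [|t tpi e] := @circle_cis (a / (cmod a)%:C%C).
  by rewrite cmodM cmodV cmod_real ger0_norm ?cmod_ge0// mulfV// cmod_eq0.
by exists t => //; rewrite -e mulrCA mulfV// mulr1.
Qed.

(** For [a] of modulus less than one the angle between [z] and [a] is controlled by
    [|z - a|], since [|z - a / |a| | <= |z - a| + (1 - |a|) <= 2 |z - a|]. *)
Lemma cis_dist_bounds a : cmod a < 1 -> exists2 al, - pi <= al <= pi &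
  forall t u, `|u| <= pi -> cis (t - al) = cis u :> R[i] ->
  `|u| / 8 <= cmod (cis t - a) <= `|u| + (1 - cmod a).
Proof.
move=> a1; have [al alpi ea] := polar_form a; exists al => // t u upi etu.
have dz : cmod (cis al - a) = 1 - cmod a.
  have -> : cis al - a = (1 - cmod a)%:C%C * cis al.
    by rewrite {1}ea rmorphB rmorph1 /= mulrBl mul1r.
  by rewrite cmodM cmod_cis mulr1 cmod_real ger0_norm// subr_ge0 ltW.
have du : cmod (cis t - cis al : R[i]) = cmod (cis u - 1 : R[i]).
  have -> : cis t - cis al = cis al * (cis u - 1) :> R[i].
    by rewrite -etu mulrBr mulr1 -cisD; congr (cis _ - _); ring.
  by rewrite cmodM cmod_cis mul1r.
have /andP[b1 b2] := cis_sub1_bounds upi; rewrite -du in b1 b2.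
have low : 1 - cmod a <= cmod (cis t - a).
  by rewrite -(cmod_cis t) ler_cmod_dist.
apply/andP; split.
  have := ler_cmodB (cis t - a) (cis al - a).
  have -> : cis t - a - (cis al - a) = cis t - cis al by ring.
  by rewrite dz; lra.
have := ler_cmodD (cis t - cis al) (cis al - a).
by rewrite addrA subrK dz; lra.
Qed.

End CircleGeometry.

Section Distance.
Context (R : realType).
Variable E : set R[i].
Hypothesis E_circle : E `<=` @unit_circle R.
Hypothesis E_neq0 : E !=set0.

Lemma has_inf_dist z : has_inf [set cmod (z - xi) | xi in E].
Proof.
split; first by case: E_neq0 => x Ex; exists (cmod (z - x)); exists x.
by exists 0 => _ [x _ <-]; exact: cmod_ge0.
Qed.

Lemma dist_triangle z a : dist z E <= cmod (z - a) + dist a E.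
Proof.
rewrite -lerBlDl; apply: lb_le_inf; first by case: (has_inf_dist a).
move=> _ [x Ex <-]; rewrite lerBlDl.
apply: (@le_trans _ _ (cmod (z - x))).
  by apply: ge_inf; [case: (has_inf_dist z)|exists x].
by have -> : z - x = (z - a) + (a - x) by [ring]; exact: ler_cmodD.
Qed.

Lemma dist_ge a : 1 - cmod a <= dist a E.
Proof.
apply: lb_le_inf; first by case: (has_inf_dist a).
move=> _ [x Ex <-]; have <- : cmod x = 1 by exact: E_circle.
by rewrite cmodBC ler_cmod_dist.
Qed.

Lemma dist_le a : dist a E <= 1 + cmod a.
Proof.
case: E_neq0 => x Ex; apply: (@le_trans _ _ (cmod (a - x))).
  by apply: ge_inf; [case: (has_inf_dist a)|exists x].
have <- : cmod x = 1 by exact: E_circle.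
by rewrite [leRHS]addrC ler_cmodB.
Qed.

Lemma dist_ge0 a : 0 <= dist a E.
Proof.
apply: lb_le_inf; first by case: (has_inf_dist a).
by move=> _ [x _ <-]; exact: cmod_ge0.
Qed.

End Distance.

(** * Poisson integrals of the majorant *)

Section PoissonIntegral.
Context (R : realType).
Local Notation mu := (@lebesgue_measure R).
Local Notation T := (measurableTypeR R).

Lemma measurable_inv_sqr_max (s : R) : 0 < s ->
  measurable_fun setT (fun u : T => ((Num.max u s) ^+ 2)^-1 : T).
Proof.
move=> s0; apply: nonincreasing_measurable => // u v uv.
have m0 x : 0 < Num.max x s by rewrite lt_max s0 orbT.
rewrite lef_pV2 ?posrE ?exprn_gt0// lerXn2r ?nnegrE ?(ltW (m0 _))//.
by rewrite ge_max !le_max uv lexx /= orbT.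
Qed.

Variable a : R[i].
Hypothesis a1 : cmod a < 1.

Definition poisson (t : R) : R := (1 - cmod a ^+ 2) / cmod (cis t - a) ^+ 2.

Lemma poisson_ge0 t : 0 <= poisson t.
Proof. by rewrite divr_ge0 ?sqr_ge0 ?sqr_cmod_lt1. Qed.

Lemma cis_dist_ge t : 1 - cmod a <= cmod (cis t - a).
Proof. by rewrite -(cmod_cis t) ler_cmod_dist. Qed.

Lemma measurable_poisson : measurable_fun setT (poisson : T -> R).
Proof.
apply: measurable_funM => //.
have d0 : 0 < (1 - cmod a) by rewrite subr_gt0.
have -> : (fun t => (cmod (cis t - a) ^+ 2)^-1) =
    (fun x : T => (Num.max x ((1 - cmod a) ^+ 2))^-1) \o
    (fun t : T => cmod (cis t - a) ^+ 2).
  apply/funext => t /=; congr (_ ^-1); apply/esym/max_idPl.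
  by rewrite lerXn2r ?nnegrE ?cmod_ge0 ?(ltW d0)// cis_dist_ge.
apply: measurableT_comp.
  apply: nonincreasing_measurable => // u v uv.
  have m0 x : 0 < Num.max x ((1 - cmod a) ^+ 2) by rewrite lt_max exprn_gt0 ?orbT.
  by rewrite lef_pV2 ?posrE// ge_max !le_max uv lexx /= orbT.
apply: measurable_sqr_cmod; apply: measurable_cplxD; first exact: measurable_cis.
exact: measurable_cplx_cst.
Qed.

(** On the circle the kernel is [(1 - |a|^2) / |1 - conj a z|^2], and
    [1 / (1 - conj a z)] is the sum of the powers of [conj a z], to whose partial
    sums Parseval's identity is applied; the truncation index [L] makes the
    contribution of the remainder at most [1]. *)
Lemma integral_poisson :
  (\int[mu]_(t in `[0%R, (2 * pi)%R]) (poisson t)%:E <= (8 * pi)%:E)%E.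
Proof.
have p0 := pi_gt0 R; have c0 := cmod_ge0 a.
have d0 : 0 < 1 - cmod a by rewrite subr_gt0.
pose Kk := 1 - cmod a ^+ 2; have K0 : 0 <= Kk by exact: sqr_cmod_lt1.
have [L hL] : exists L, Kk / (1 - cmod a) ^+ 2 * (cmod a ^+ L.+1) ^+ 2 <= 1.
  have q0 : (fun L => Kk / (1 - cmod a) ^+ 2 * cmod a ^+ L) @ \oo --> (0 : R).
    rewrite -[X in _ --> X](mulr0 (Kk / (1 - cmod a) ^+ 2)); apply: cvgMr.
    by apply: cvg_expr; rewrite ger0_norm.
  have [L hL] := cvg0_lt q0 ltr01; exists L; apply: le_trans (ltW (hL L (leqnn L))).
  apply: ler_wpM2l; first by rewrite divr_ge0 ?sqr_ge0.
  by rewrite -exprM ler_wiXn2l ?(ltW a1)//; rewrite mulnC mulSn mul1n addSn ltnW// ltnS leq_addr.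
pose c (n : nat) : R[i] := if n is 0%N then 1 else 0.
pose h := kernel_div a c.
have hn n : h n = a^*%C ^+ n.
  by elim: n => [|n ih]; rewrite /h /= ?expr0// add0r -/(h n) ih exprS.
have c1 N z : psum c N.+1 z = 1.
  elim: N => [|N ih]; first by rewrite /psum big_ord1 /= mul1r expr0.
  by rewrite psumS ih /= mul0r addr0.
apply: (@le_trans _ _ (\int[mu]_(t in `[0%R, (2 * pi)%R])
   ((2 * Kk)%:E * (cmod (psum h L.+1 (cis t)) ^+ 2)%:E + cst 2%:E t))%E).
  apply: ge0_le_integral => //.
  - by move=> t _; rewrite lee_fin poisson_ge0.
  - by apply/measurable_EFinP; apply: measurable_funTS; exact: measurable_poisson.
  - apply: emeasurable_funD => //; apply: measurable_funeM.
    by apply/measurable_EFinP; exact: measurable_psum_cis.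
  move=> t _; rewrite -EFinM -EFinD lee_fin.
  have z1 := cmod_cis t; set z : R[i] := cis t in z1 *.
  have e0 : 0 < cmod (z - a) by rewrite (lt_le_trans d0)// cis_dist_ge.
  have nz : 1 - a^*%C * z != 0 by rewrite -cmod_eq0 cmod_sub_circle// gt_eqF.
  have id := psum_kernel_div c a L z; rewrite c1 -/h hn in id.
  have id2 : (1 - a^*%C * z)^-1 = psum h L.+1 z + a^*%C ^+ L.+1 * z ^+ L.+1 / (1 - a^*%C * z).
    apply: (mulfI nz); rewrite mulfV// mulrDr [X in _ + X]mulrCA mulfV// mulr1 exprS.
    exact: id.
  have := sqr_cmodD (psum h L.+1 z) (a^*%C ^+ L.+1 * z ^+ L.+1 / (1 - a^*%C * z)).
  rewrite -id2 cmodV cmod_sub_circle// => ineq.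
  have -> : poisson t = Kk * ((cmod (z - a))^-1) ^+ 2 by rewrite /poisson -exprVn.
  have := ler_wpM2l K0 ineq; move=> /le_trans; apply.
  rewrite mulrDr; apply: lerD; first by rewrite mulrCA mulrA.
  rewrite cmodM cmodV cmodM !cmodX z1 expr1n mulr1 cmod_conj cmod_sub_circle//.
  rewrite mulrCA -[leRHS]mulr1 ler_pM2l//; apply: le_trans hL.
  rewrite exprMn mulrCA [leRHS]mulrC; apply: ler_wpM2l; first exact: sqr_ge0.
  rewrite exprVn; apply: ler_wpM2l => //.
  by rewrite lef_pV2 ?posrE ?exprn_gt0// lerXn2r ?nnegrE ?cmod_ge0 ?(ltW d0)// cis_dist_ge.
have mpart : measurable_fun `[0%R, (2 * pi)%R]
    (fun t : T => ((2 * Kk)%:E * (cmod (psum h L.+1 (cis t)) ^+ 2)%:E)%E).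
  by apply: measurable_funeM; apply/measurable_EFinP; exact: measurable_psum_cis.
have part0 (t : T) : (0 <= (2 * Kk)%:E * (cmod (psum h L.+1 (cis t)) ^+ 2)%:E)%E.
  by rewrite mule_ge0 ?lee_fin ?sqr_ge0// mulr_ge0.
rewrite ge0_integralD//; last by move=> t _; rewrite lee_fin.
rewrite integral_cst//= lebesgue_measure_itv/= lte_fin mulr_gt0//.
rewrite ge0_integralZl//; last 3 first.
- by apply/measurable_EFinP; exact: measurable_psum_cis.
- by move=> t _; rewrite lee_fin sqr_ge0.
- by rewrite lee_fin mulr_ge0.
rewrite circle_parseval -EFinB -!EFinM -EFinD lee_fin.
have S1 : Kk * \sum_(n < L.+1) cmod (h n) ^+ 2 <= 1.
  under eq_bigr do rewrite hn cmodX cmod_conj -exprM mulnC exprM.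
  have := subrX1 (cmod a ^+ 2) L.+1; rewrite /Kk.
  by have := exprn_ge0 L.+1 (sqr_ge0 (cmod a)); lra.
have := ler_wpM2l (ltW p0) S1; lra.
Qed.

End PoissonIntegral.

Section Majorant.
Context (R : realType).
Local Notation mu := (@lebesgue_measure R).
Local Notation T := (measurableTypeR R).
Variable omega : R -> R.
Hypothesis omega_ge0 : forall t, t \in `[0, 2] -> 0 <= omega t.
Hypothesis omega_incr : {in `[0, 2] &, {homo omega : s t / s <= t}}.
Hypothesis omega_int :
    (fun delta : R =>
       \int[lebesgue_measure]_(t in `[delta, 2]) (omega t / t ^+ 2))
    =O_ (0^'+) (fun delta : R => 1 + omega delta / delta).

Definition clamped (t : R) : R := omega (Num.min (Num.max t 0) 2).

Let clamp_in (t : R) : Num.min (Num.max t 0) 2 \in `[0, 2].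
Proof. by rewrite in_itv/= le_min !le_max ge_min !lexx !orbT ler0n. Qed.

Lemma clamped_ge0 t : 0 <= clamped t.
Proof. exact/omega_ge0/clamp_in. Qed.

Lemma clamped_homo : {homo clamped : s t / s <= t}.
Proof.
move=> s t st; apply: omega_incr; try exact: clamp_in.
by rewrite le_min !ge_min !lexx orbT andbT ge_max !le_max st !lexx !orbT.
Qed.

Lemma clampedE t : 0 <= t <= 2 -> clamped t = omega t.
Proof. by move=> /andP[t0 t2]; rewrite /clamped (max_idPl t0) (min_idPl t2). Qed.

Lemma clamped_min t : 0 <= t -> clamped t = omega (Num.min t 2).
Proof. by move=> t0; rewrite /clamped (max_idPl t0). Qed.

Lemma clamped_le t : clamped t <= omega 2.
Proof.
rewrite /clamped; apply: omega_incr; first exact: clamp_in.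
  by rewrite in_itv/= ler0n lexx.
by rewrite ge_min lexx orbT.
Qed.

Let omega2_ge0 : 0 <= omega 2.
Proof. exact: le_trans (clamped_ge0 0) (clamped_le 0). Qed.

Lemma measurable_clamped A : measurable_fun A (clamped : T -> T).
Proof.
by apply: measurable_funTS; apply: nondecreasing_measurable => // s t; exact: clamped_homo.
Qed.

Let J delta : R := \int[mu]_(t in `[delta, 2]) (omega t / t ^+ 2).

(** Equal to [omega t / t ^+ 2] for [0 < d <= t <= 2], but measurable and bounded on the
    whole line. *)
Definition weight (d t : R) : R := clamped t / Num.max t d ^+ 2.

Lemma weight_ge0 d t : 0 <= weight d t.
Proof. by rewrite divr_ge0 ?clamped_ge0// sqr_ge0. Qed.

Lemma measurable_weight d A : 0 < d -> measurable_fun A (weight d : T -> T).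
Proof.
move=> d0; apply: measurable_funTS; apply: measurable_funM.
  exact: measurable_clamped.
exact: measurable_inv_sqr_max.
Qed.

Lemma integral_weight_le (d x y : R) : 0 < d -> x <= y -> d <= x ->
  (\int[mu]_(t in `[x, y]) (weight d t)%:E <= (omega 2 / x ^+ 2 * (y - x))%:E)%E.
Proof.
move=> d0 xy dx; have x0 : 0 < x by exact: lt_le_trans dx.
apply: (@le_trans _ _ (\int[mu]_(t in `[x, y]) cst (omega 2 / x ^+ 2)%:E t)%E).
  apply: ge0_le_integral => //.
  - by move=> t _; rewrite lee_fin weight_ge0.
  - by apply/measurable_EFinP; exact: measurable_weight.
  move=> t /=; rewrite in_itv/= => /andP[xt _]; rewrite lee_fin.
  have dt : d <= t by exact: le_trans dx xt.
  apply: ler_pM; rewrite ?clamped_ge0 ?invr_ge0 ?sqr_ge0 ?clamped_le//.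
  rewrite (max_idPl dt) lef_pV2 ?posrE ?exprn_gt0//; last exact: lt_le_trans xt.
  by rewrite lerXn2r// nnegrE ltW//; exact: lt_le_trans xt.
rewrite integral_cst//= lebesgue_measure_itv/= lte_fin.
case: ifPn => h; first by rewrite -EFinB -EFinM.
by rewrite mule0 lee_fin mulr_ge0 ?subr_ge0// divr_ge0// sqr_ge0.
Qed.

Lemma integral_weightJ d : 0 < d <= 2 ->
  (\int[mu]_(t in `[d, 2%R]) (weight d t)%:E = (J d)%:E)%E.
Proof.
move=> /andP[d0 d2]; rewrite /J /Rintegral fineK.
  apply: eq_integral => t; rewrite inE/= in_itv/= => /andP[dt t2].
  rewrite /weight clampedE ?(max_idPl dt)// t2 andbT.
  exact: le_trans (ltW d0) dt.
have -> : (\int[mu]_(t in `[d, 2%R]) (omega t / t ^+ 2)%:E)%E =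
    (\int[mu]_(t in `[d, 2%R]) (weight d t)%:E)%E.
  apply: eq_integral => t; rewrite inE/= in_itv/= => /andP[dt t2].
  rewrite /weight clampedE ?(max_idPl dt)// t2 andbT.
  exact: le_trans (ltW d0) dt.
rewrite ge0_fin_numE.
  by apply: (le_lt_trans (integral_weight_le d0 d2 (lexx d))); rewrite ltry.
by apply: integral_ge0 => t _; rewrite lee_fin weight_ge0.
Qed.

(** The growth condition is asymptotic; away from zero the integral is bounded by
    monotonicity, which makes the estimate uniform. *)
Lemma J_bound : exists2 C, 0 <= C & forall d, 0 < d <= 2 ->
  J d <= C * (1 + clamped d / d).
Proof.
have /eqOP h := omega_int.
have [k k0 hk] : exists2 k : R, 0 < k & \forall x \near 0^'+,
    `|\int[mu]_(t in `[x, 2]) (omega t / t ^+ 2)| <= k * `|1 + omega x / x|.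
  near (pinfty_nbhs R) => k; exists k.
    by near: k; exact: nbhs_pinfty_gt.
  by near: k; exact: h.
case: hk => e /= e0 he.
pose e1 := Num.min e 2; have e10 : 0 < e1 by rewrite lt_min e0 ltr0n.
exists (k + omega 2 / e1 ^+ 2 * 2).
  by rewrite addr_ge0 ?(ltW k0)// mulr_ge0// divr_ge0// sqr_ge0.
move=> d d02; case/andP: (d02) => d0 d2.
have od : 0 <= clamped d / d by rewrite divr_ge0 ?clamped_ge0 ?(ltW d0).
have E2 : 0 <= omega 2 / e1 ^+ 2 * 2 by rewrite mulr_ge0// divr_ge0// sqr_ge0.
have [de|de] := ltP d e1.
  have := he d; rewrite /ball /= sub0r normrN gtr0_norm// => /(_ _ d0).
  rewrite -/(J d) -(clampedE (t := d)); last by rewrite (ltW d0).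
  rewrite [X in _ <= k * X]ger0_norm; last by rewrite addr_ge0.
  move=> hd; apply: (le_trans (ler_norm _)).
  apply: (le_trans (hd _)); first by apply: lt_le_trans de _; rewrite ge_min lexx.
  by rewrite ler_wpM2r ?addr_ge0// lerDl.
have Jd : J d <= omega 2 / d ^+ 2 * (2 - d).
  by rewrite -lee_fin -integral_weightJ// integral_weight_le.
apply: (le_trans Jd).
apply: (@le_trans _ _ (omega 2 / e1 ^+ 2 * 2)).
  apply: ler_pM.
  - by rewrite divr_ge0// sqr_ge0.
  - by rewrite subr_ge0.
  - by rewrite ler_wpM2l// lef_pV2 ?posrE ?exprn_gt0// lerXn2r// nnegrE ltW.
  - by rewrite gerBl ltW.
have kk := ltW k0; nra.
Unshelve. all: by end_near. Qed.

(** In terms of the angle [u] between [z] and [a], a bound up to a constant for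
    [omega (d (z, E)) / |z - a| ^+ 2] at the points with [|z - a| > s = d (a, E)]:
    there [d (z, E) <= |z - a| + s], and [|z - a|] is comparable to [max u s]. *)
Definition far (s u : R) : R := clamped (4 * Num.max u s) / Num.max u s ^+ 2.

Lemma far_ge0 s u : 0 <= far s u.
Proof. by rewrite divr_ge0 ?clamped_ge0// sqr_ge0. Qed.

Lemma measurable_far s A : 0 < s -> measurable_fun A (far s : T -> T).
Proof.
move=> s0; apply: measurable_funTS; apply: measurable_funM; last first.
  exact: measurable_inv_sqr_max.
apply: nondecreasing_measurable => // u v uv; apply: clamped_homo.
by rewrite ler_pM2l// ge_max !le_max uv !lexx orbT.
Qed.

Let mfarE s A : 0 < s -> measurable_fun A (fun u : T => (far s u)%:E).
Proof. by move=> s0; apply/measurable_EFinP; exact: measurable_far. Qed.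

Let far_ge0E s u : (0 <= (far s u)%:E)%E.
Proof. by rewrite lee_fin far_ge0. Qed.

Lemma integral_far_scale s : 0 < s ->
  (\int[mu]_(u in `[s, 16%R]) (far s u)%:E =
   4%:E * \int[mu]_(t in `[(4 * s)%R, 64%R]) (weight (4 * s) t)%:E)%E.
Proof.
move=> s0; have s40 : 0 < 4 * s by rewrite mulr_gt0.
have mw A : measurable_fun A (fun t : T => (weight (4 * s) t)%:E).
  by apply/measurable_EFinP; exact: measurable_weight.
have mp : measurable_fun setT
    ((fun t : T => (weight (4 * s) t)%:E) \_ `[(4 * s)%R, 64%R]).
  apply: (proj1 (measurable_restrictT _ (measurable_itv _))); exact: mw.
rewrite [in RHS]integral_mkcond (@ge0_integral_affine R 4 0)//; last first.
  by move=> t; rewrite patchE; case: ifP => // _; rewrite lee_fin weight_ge0.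
rewrite integral_mkcond muleA -EFinM -ge0_integralZl//; last 2 first.
- exact: (measurableT_comp mp (measurable_affine 4 0)).
- by move=> t _; rewrite patchE; case: ifP => // _; rewrite lee_fin weight_ge0.
apply: eq_integral => u _; rewrite !patchE addr0.
have -> : (4 * u \in `[4 * s, 64]%classic) = (u \in `[s, 16]%classic).
  apply/idP/idP; rewrite !inE /= !in_itv/= ler_pM2l// => /andP[-> h] /=.
    by rewrite -(ler_pM2l (x := 4))//; apply: (le_trans h); lra.
  by lra.
case: ifPn => [|_]; last by rewrite mule0.
rewrite inE /= in_itv/= => /andP[su _]; rewrite -EFinM /far /weight.
have us : 4 * s <= 4 * u by rewrite ler_pM2l.
rewrite (max_idPl su) (max_idPl us); congr EFin.
by field; rewrite gt_eqF//; exact: lt_le_trans su.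
Qed.

(** The growth condition is applied at [min (2 s) 2]; beyond [2], where [omega] is
    constant, the integral is at most a multiple of [omega 2]. *)
Lemma integral_far_tail C s : 0 <= C -> (forall d, 0 < d <= 2 ->
    J d <= C * (1 + clamped d / d)) -> 0 < s <= 2 ->
  (\int[mu]_(u in `[s, 16%R]) (far s u)%:E <=
   (4 * (C * (1 + clamped (2 * s) / Num.min (2 * s) 2) + 16 * omega 2))%:E)%E.
Proof.
move=> C0 hC /andP[s0 s2]; rewrite integral_far_scale//.
have s40 : 0 < 4 * s by rewrite mulr_gt0.
set d := Num.min (2 * s) 2.
have d0 : 0 < d by rewrite lt_min mulr_gt0// ltr0n.
have d2 : d <= 2 by rewrite ge_min lexx orbT.
have ds : d <= 4 * s by rewrite ge_min; apply/orP; left; lra.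
have mw A : measurable_fun A (fun t : T => (weight d t)%:E).
  by apply/measurable_EFinP; exact: measurable_weight.
have w0 t : (0 <= (weight d t)%:E)%E by rewrite lee_fin weight_ge0.
rewrite EFinM; apply: lee_wpmul2l => //.
apply: (@le_trans _ _ (\int[mu]_(t in `[d, 2%R] `|` `[2%R, 64%R]) (weight d t)%:E)%E).
  apply: (@le_trans _ _ (\int[mu]_(t in `[(4 * s)%R, 64%R]) (weight d t)%:E)%E).
    apply: ge0_le_integral => //.
    - by move=> t _; rewrite lee_fin weight_ge0.
    - by apply/measurable_EFinP; exact: measurable_weight.
    move=> t /=; rewrite in_itv/= => /andP[st _]; rewrite lee_fin /weight.
    by rewrite (max_idPl st) (max_idPl (le_trans ds st)).
  apply: ge0_subset_integral => //; first exact: measurableU.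
  move=> t /=; rewrite !in_itv/= => /andP[st t64].
  have [t2|t2] := leP t 2; [left|right].
    by rewrite (le_trans ds st).
  by rewrite ltW.
apply: (@le_trans _ _ (\int[mu]_(t in `[d, 2%R]) (weight d t)%:E +
    \int[mu]_(t in `[2%R, 64%R]) (weight d t)%:E)%E).
  have -> : `[d, 2%R] `|` `[2%R, 64%R] = `[d, 2%R] `|` `]2%R, 64%R] :> set R.
    apply/seteqP; split => t /= [h|h]; [by left| |by left|right].
      have [t2|t2] := leP t 2; [left|right].
        by move: h; rewrite !in_itv/= t2 => /andP[h _]; rewrite (le_trans d2).
      by move: h; rewrite !in_itv/= t2 => /andP[_ ->].
    by move: h; rewrite !in_itv/= => /andP[/ltW -> ->].
  rewrite ge0_integral_setU//.
  - by rewrite leeD2l//; apply: ge0_subset_integral => // t /=; rewrite !in_itv/= => /andP[/ltW -> ->].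
  - by apply/disj_setPS => t [] /=; rewrite !in_itv/= => /andP[_ h1] /andP[h2 _]; move: (le_lt_trans h1 h2); rewrite ltxx.
rewrite integral_weightJ ?d0//.
have h64 : 2 <= 64 :> R by lra.
apply: (le_trans (leeD2l _ (integral_weight_le d0 h64 d2))).
rewrite -EFinD lee_fin; apply: lerD.
  have -> : clamped (2 * s) = clamped d by rewrite !clamped_min ?(ltW d0) ?mulr_ge0 ?(ltW s0)// (min_idPl d2).
  by apply: hC; rewrite d0.
by have := omega2_ge0; lra.
Qed.

(** [far] is constant on [0, s], and at least a quarter of that constant on
    [s, 2s] by monotonicity of [omega]. *)
Lemma integral_far s : 0 < s <= 2 ->
  (\int[mu]_(u in `[0%R, 16%R]) (far s u)%:E <=
   5%:E * \int[mu]_(u in `[s, 16%R]) (far s u)%:E)%E.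
Proof.
move=> /andP[s0 s2]; set X := (\int[mu]_(u in `[s, 16%R]) _)%E.
have first_le : (\int[mu]_(u in `[0%R, s]) (far s u)%:E <= 4%:E * X)%E.
  apply: (@le_trans _ _ (\int[mu]_(u in `[0%R, s]) cst (far s s)%:E u)%E).
    apply: ge0_le_integral => //; first exact: mfarE.
    move=> u /=; rewrite in_itv/= => /andP[_ us].
    by rewrite /far (max_idPr us) maxxx.
  rewrite integral_cst//= lebesgue_measure_itv/= lte_fin s0 -EFinB -EFinM subr0.
  have : (\int[mu]_(u in `[s, (2 * s)%R]) cst (far s s / 4)%:E u <= X)%E.
    apply: (@le_trans _ _ (\int[mu]_(u in `[s, (2 * s)%R]) (far s u)%:E)%E).
      apply: ge0_le_integral => //.
      - by move=> u _; rewrite lee_fin divr_ge0// far_ge0.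
      - exact: mfarE.
      move=> u /=; rewrite in_itv/= => /andP[su us]; rewrite lee_fin /far maxxx (max_idPl su).
      have u0 : 0 < u by exact: lt_le_trans su.
      rewrite -mulrA; apply: ler_pM; rewrite ?clamped_ge0//.
      - by rewrite divr_ge0// invr_ge0 sqr_ge0.
      - by apply: clamped_homo; rewrite ler_pM2l.
      rewrite -invfM lef_pV2 ?posrE ?mulr_gt0 ?exprn_gt0//.
      have -> : s ^+ 2 * 4 = (2 * s) ^+ 2 by ring.
      by rewrite lerXn2r// nnegrE ltW// mulr_gt0.
    apply: ge0_subset_integral => //; first exact: mfarE.
    move=> u /=; rewrite !in_itv/= => /andP[-> us] /=.
    by apply: (le_trans us); lra.
  rewrite integral_cst//= lebesgue_measure_itv/= lte_fin.
  rewrite ifT; last by lra.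
  rewrite -EFinB -EFinM => h.
  apply: (@le_trans _ _ (4%:E * (far s s / 4 * (2 * s - s))%:E)%E); last exact: lee_wpmul2l.
  by rewrite -EFinM lee_fin; lra.
have -> : `[0%R, 16%R]%classic = `[0%R, s] `|` `]s, 16%R] :> set R.
  by rewrite -itv_bndbnd_setU// bnd_simp; lra.
rewrite ge0_integral_setU//; last 2 first.
- exact: mfarE.
- by apply/disj_setPS => t [] /=; rewrite !in_itv/= => /andP[_ h1] /andP[h2 _]; move: (le_lt_trans h1 h2); rewrite ltxx.
have h2 : (\int[mu]_(u in `]s, 16%R]) (far s u)%:E <= X)%E.
  apply: ge0_subset_integral => //; first exact: mfarE.
  by move=> u /=; rewrite !in_itv/= => /andP[/ltW -> ->].
have X0 : (0 <= X)%E by apply: integral_ge0 => u _.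
apply: (le_trans (leeD first_le h2)).
have -> : 5%:E = (4%:E + 1%:E)%E :> \bar R by rewrite -EFinD; congr EFin; lra.
by rewrite ge0_muleDl// mul1e.
Qed.

End Majorant.

Section PoissonMajorant.
Context (R : realType).
Local Notation mu := (@lebesgue_measure R).
Local Notation T := (measurableTypeR R).
Variable omega : R -> R.
Hypothesis omega_ge0 : forall t, t \in `[0, 2] -> 0 <= omega t.
Hypothesis omega_incr : {in `[0, 2] &, {homo omega : s t / s <= t}}.
Local Notation Om := (clamped omega).
Local Notation far := (far omega).

(** The factor is the square of the constant [8] in [cis_dist_bounds]; the support
    contains all angles in [- pi, pi]. *)
Definition far_even (s u : R) : R := 64 * far s `|u| * \1_(`[-16, 16]%classic : set R) u.
Local Notation G := far_even.

Lemma far_even_ge0 s u : 0 <= G s u.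
Proof.
apply: mulr_ge0; last by rewrite indicE ler0n.
by apply: mulr_ge0 => //; exact: far_ge0.
Qed.

Lemma measurable_far_even s A : 0 < s -> measurable_fun A (G s : T -> T).
Proof.
move=> s0; apply: measurable_funTS; apply: measurable_funM; last first.
  exact: measurable_indic.
apply: measurable_funM => //.
apply: (measurableT_comp (f := far s : T -> T)); first exact: measurable_far.
exact: normr_measurable.
Qed.

Lemma integral_far_even s : 0 < s ->
  (\int[mu]_u (G s u)%:E <= (8 * 16)%:E * \int[mu]_(u in `[0%R, 16%R]) (far s u)%:E)%E.
Proof.
move=> s0.
have mG A : measurable_fun A (fun u : T => (G s u)%:E).
  by apply/measurable_EFinP; exact: measurable_far_even.
have G0 u : (0 <= (G s u)%:E)%E by rewrite lee_fin far_even_ge0.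
have mf A : measurable_fun A (fun u : T => (far s u)%:E).
  by apply/measurable_EFinP; exact: measurable_far.
have f0 u : (0 <= (far s u)%:E)%E by rewrite lee_fin far_ge0.
have Gpos : (\int[mu]_(u in `[0%R, +oo[) (G s u)%:E =
    64%:E * \int[mu]_(u in `[0%R, 16%R]) (far s u)%:E)%E.
  rewrite -ge0_integralZl// [LHS]integral_mkcond [RHS]integral_mkcond.
  apply: eq_integral => u _; rewrite !patchE.
  have [u0|u0] := leP 0 u; last first.
    by rewrite !ifF//; apply/negP; rewrite inE /= in_itv/= leNgt u0.
  rewrite ifT; last by rewrite inE /= in_itv/= u0.
  have [u16|u16] := leP u 16.
    rewrite ifT; last by rewrite inE /= in_itv/= u0 u16.
    rewrite /G ger0_norm// indicE mem_set /= ?mulr1//.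
    by rewrite in_itv/= u16 andbT; lra.
  rewrite ifF; last by apply/negP; rewrite inE /= in_itv/= u0 leNgt u16.
  rewrite /G indicE memNset ?mulr0// /= in_itv/= => /andP[_].
  by rewrite leNgt u16.
have Gneg : (\int[mu]_(u in `]-oo, 0%R]) (G s u)%:E =
    \int[mu]_(u in `[0%R, +oo[) (G s u)%:E)%E.
  rewrite ge0_integration_by_substitution0//; last exact: mG.
  apply: eq_integral => u _; congr EFin; rewrite /G normrN; congr (_ * _).
  by rewrite !indicE; congr (nat_of_bool _)%:R; apply/idP/idP;
    rewrite !inE /= !in_itv/= => /andP[h1 h2]; apply/andP; split; lra.
apply: (@le_trans _ _ (\int[mu]_(u in `]-oo, 0%R] `|` `]0%R, +oo[) (G s u)%:E)%E).
  apply: ge0_subset_integral => //; first exact: measurableU.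
  move=> u _; have [u0|u0] := leP u 0; [left|right];
  by rewrite /= in_itv/= ?u0.
rewrite ge0_integral_setU//; last first.
  apply/disj_setPS => t [] /=; rewrite !in_itv/= => h1; rewrite andbT => h2.
  by move: (le_lt_trans h1 h2); rewrite ltxx.
have -> : (8 * 16)%:E = (64%:E + 64%:E)%E :> \bar R by rewrite -EFinD; congr EFin; lra.
rewrite ge0_muleDl// -Gpos Gneg leeD2l//.
apply: ge0_subset_integral => //.
by move=> u /=; rewrite !in_itv/= => /andP[/ltW -> _].
Qed.

Lemma integral_far_even_shift s b (A : set R) : 0 < s -> measurable A ->
  (\int[mu]_(t in A) (G s (t + b))%:E <= \int[mu]_u (G s u)%:E)%E.
Proof.
move=> s0 mA.
have mG : measurable_fun setT (fun u : T => (G s u)%:E).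
  by apply/measurable_EFinP; exact: measurable_far_even.
have G0 u : (0 <= (G s u)%:E)%E by rewrite lee_fin far_even_ge0.
rewrite -[leRHS](@ge0_integral_translate R b)//.
apply: ge0_subset_integral => //.
by apply: measurableT_comp mG _; exact: measurable_funD.
Qed.

Hypothesis omega_int :
    (fun delta : R =>
       \int[lebesgue_measure]_(t in `[delta, 2]) (omega t / t ^+ 2))
    =O_ (0^'+) (fun delta : R => 1 + omega delta / delta).

(** Near [a], that is for [|z - a| <= s] with [s = d(a, E)], the value
    [omega (2 s)] is multiplied by the Poisson kernel, whose integral is bounded;
    elsewhere [far] applies. In its integral the growth condition produces the terms
    [1] and [omega (2 s) / min (2 s) 2], and the factor [1 - |a|^2], which is at most
    [2 min (2 s) 2], turns them into [1 - |a|] and [omega (2 s)]. *)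
Lemma poisson_majorant : exists2 C, 0 <= C & forall (E : set R[i]) (a : R[i]),
  E `<=` @unit_circle R -> E !=set0 -> cmod a < 1 ->
  exists U : T -> R, [/\ measurable_fun setT U, forall t, 0 <= U t,
    (\int[mu]_(t in `[0%R, (2 * pi)%R]) (U t)%:E <=
       (C * (omega (Num.min (2 * dist a E) 2) + (1 - cmod a)))%:E)%E &
    forall t x, t \in `[0, 2 * pi] -> x <= omega (dist (cis t) E) ->
      (1 - cmod a ^+ 2) * x / cmod (cis t - a) ^+ 2 <= U t].
Proof.
have [C0 C00 hC0] := J_bound omega_ge0 omega_incr omega_int.
have Om0 := clamped_ge0 omega_ge0; have Omm := clamped_homo omega_incr.
have o2 : 0 <= omega 2 by apply: omega_ge0; rewrite in_itv/= lexx ler0n.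
have p0 := pi_gt0 R.
(* The factors are 16 * 16 for the two translates of far_even, 5 from integral_far and
   8 from KF below. *)
have [N N0 NE] : exists2 N : R, 0 <= N & N = 16 * (16 * 40).
  by eexists; [|exact: erefl]; lra.
have C1 : 0 <= C0 + 16 * omega 2 by lra.
exists (8 * pi + N * (C0 + 16 * omega 2)).
  by rewrite addr_ge0 ?mulr_ge0 ?(ltW p0).
move=> E a hE E0 a1; set s := dist a E.
have c0 := cmod_ge0 a; have s1 : 1 - cmod a <= s by exact: dist_ge.
have s0 : 0 < s by rewrite (lt_le_trans _ s1)// subr_gt0.
have s2 : s <= 2 by rewrite (le_trans (dist_le hE E0 a))//; lra.
rewrite -(clamped_min omega (_ : 0 <= 2 * s)); last by rewrite mulr_ge0// ltW.
have [al /andP[al1 al2] hal] := cis_dist_bounds a1.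
set K := 1 - cmod a ^+ 2; have K0 : 0 <= K by exact: sqr_cmod_lt1.
(* t ranges over [0, 2 pi] and al over [- pi, pi]: one of t - al and
   t - al - 2 pi lies in [- pi, pi]. *)
pose U (t : T) : R := Om (2 * s) * poisson a t +
  K * (G s (t + - al) + G s (t + (- al - 2 * pi))).
have mshift b A : measurable_fun A (fun t : T => G s ((t : R) + b) : T).
  apply: measurable_funTS; apply: (measurableT_comp (f := G s : T -> T)).
    exact: measurable_far_even.
  exact: measurable_funD.
have mU1 A : measurable_fun A (fun t : T => Om (2 * s) * poisson a t : T).
  apply: measurable_funM => //; apply: measurable_funTS; exact: measurable_poisson.
have mU2 A : measurable_fun A (fun t : T =>
    K * (G s ((t : R) + - al) + G s ((t : R) + (- al - 2 * pi))) : T).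
  by apply: measurable_funM => //; apply: measurable_funD; exact: mshift.
have U10 (t : R) : 0 <= Om (2 * s) * poisson a t by rewrite mulr_ge0 ?poisson_ge0.
have G0 u : 0 <= G s u by exact: far_even_ge0.
have U20 (t : R) : 0 <= K * (G s (t + - al) + G s (t + (- al - 2 * pi))).
  by apply: mulr_ge0 => //; apply: addr_ge0; exact: G0.
exists U; split.
- by apply: measurable_funD; [exact: mU1|exact: mU2].
- by move=> t; apply: addr_ge0; [exact: U10|exact: U20].
- under eq_integral do rewrite EFinD.
  rewrite ge0_integralD//; last 4 first.
  - by move=> t _; rewrite lee_fin; exact: U10.
  - by apply/measurable_EFinP; exact: mU1.
  - by move=> t _; rewrite lee_fin; exact: U20.
  - by apply/measurable_EFinP; exact: mU2.
  set d := Num.min (2 * s) 2.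
  have d0 : 0 < d by rewrite lt_min mulr_gt0// ltr0n.
  have ad : 1 - cmod a <= d.
    by rewrite le_min; apply/andP; split; lra.
  set F := 4 * (C0 * (1 + Om (2 * s) / d) + 16 * omega 2).
  have F0 : 0 <= F.
    by rewrite /F mulr_ge0// addr_ge0 ?mulr_ge0// addr_ge0// divr_ge0// ltW.
  have hG : (\int[mu]_u (G s u)%:E <= (8 * 16 * (5 * F))%:E)%E.
    apply: (le_trans (integral_far_even s0)); rewrite (EFinM (8 * 16)) (EFinM 5).
    apply: lee_wpmul2l => //; apply: (le_trans (integral_far omega_ge0 omega_incr _)).
      by rewrite s0.
    apply: lee_wpmul2l => //.
    by apply: (integral_far_tail omega_ge0 omega_incr C00 hC0); rewrite s0.
  have I1 : (\int[mu]_(t in `[0%R, (2 * pi)%R]) (Om (2 * s) * poisson a t)%:E <=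
      (Om (2 * s) * (8 * pi))%:E)%E.
    under eq_integral do rewrite EFinM.
    have mP : measurable_fun `[0%R, (2 * pi)%R] (fun t : T => (poisson a t)%:E).
      by apply/measurable_EFinP; apply: measurable_funTS; exact: measurable_poisson.
    have P0 (t : R) : (0 <= (poisson a t)%:E)%E by rewrite lee_fin poisson_ge0.
    have E0' : (0 <= (Om (2 * s))%:E)%E by rewrite lee_fin.
    rewrite ge0_integralZl//.
    rewrite EFinM; apply: lee_wpmul2l; first by rewrite lee_fin.
    exact: integral_poisson.
  have I2 : (\int[mu]_(t in `[0%R, (2 * pi)%R])
      (K * (G s (t + - al) + G s (t + (- al - 2 * pi))))%:E <=
      (K * (16 * 16 * (5 * F)))%:E)%E.
    under eq_integral do rewrite EFinM EFinD.
    have mE b : measurable_fun `[0%R, (2 * pi)%R] (fun t : T => (G s ((t : R) + b))%:E).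
      by apply/measurable_EFinP; exact: mshift.
    have GE0 b (t : R) : (0 <= (G s (t + b))%:E)%E by rewrite lee_fin.
    have mEE : measurable_fun `[0%R, (2 * pi)%R] (fun t : T =>
        ((G s ((t : R) + - al))%:E + (G s ((t : R) + (- al - 2 * pi)))%:E)%E).
      exact: emeasurable_funD.
    have EE0 (t : R) : (0 <= (G s (t + - al))%:E + (G s (t + (- al - 2 * pi)))%:E)%E.
      exact: adde_ge0.
    have K0' : (0 <= K%:E)%E by rewrite lee_fin.
    rewrite ge0_integralZl//; last by move=> t _; exact: EE0.
    rewrite EFinM; apply: lee_wpmul2l; first by rewrite lee_fin.
    under eq_integral do rewrite EFinD.
    rewrite ge0_integralD//; [|exact: mE..].
    have -> : 16 * 16 * (5 * F) = 8 * 16 * (5 * F) + 8 * 16 * (5 * F) by lra.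
    rewrite EFinD; apply: leeD; apply: (le_trans _ hG);
    exact: integral_far_even_shift.
  apply: (le_trans (leeD I1 I2)); rewrite -EFinD lee_fin.
  have Om20 := Om0 (2 * s).
  have KK : K <= 2 * (1 - cmod a) by rewrite /K; nra.
  have KF : K * F <= 8 * ((1 - cmod a) * (C0 + 16 * omega 2) + C0 * Om (2 * s)).
    apply: (le_trans (ler_wpM2r F0 KK)).
    have q : (1 - cmod a) * (Om (2 * s) / d) <= Om (2 * s).
      by rewrite mulrCA ler_piMr// ler_pdivrMr// mul1r.
    have := ler_wpM2l C00 q; rewrite /F; lra.
  have t1 : 0 <= (1 - cmod a) * pi by rewrite mulr_ge0 ?subr_ge0// ltW.
  have t2 : 0 <= omega 2 * Om (2 * s) by rewrite mulr_ge0.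
  have -> : K * (16 * 16 * (5 * F)) = 16 * (16 * 5) * (K * F) by ring.
  have t3 : 0 <= (1 - cmod a) * (C0 + 16 * omega 2) by rewrite mulr_ge0// subr_ge0 ltW.
  rewrite NE; move: t1 t2 t3 KF; lra.
- move=> t x; rewrite in_itv/= => /andP[t0 tpi] hx.
  have d00 : 0 <= dist (cis t) E by exact: dist_ge0.
  have d2 : dist (cis t) E <= 2.
    by rewrite (le_trans (dist_le hE E0 _))// cmod_cis; lra.
  rewrite -(clampedE omega (_ : 0 <= dist (cis t) E <= 2)) in hx; last by rewrite d00.
  pose u := if t - al <= pi then t - al else t - al - 2 * pi.
  have upi : `|u| <= pi.
    by rewrite ler_norml /u; have [h|h] := leP (t - al) pi; apply/andP; split; lra.
  have cu : cis (t - al) = cis u :> R[i].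
    rewrite /u; have [//|_] := leP (t - al) pi.
    by rewrite -[t - al in LHS](subrK (2 * pi)) cisD cis2pi mulr1.
  have /andP[b1 b2] := hal t u upi cu.
  have GU : 64 * far s `|u| <= G s (t + - al) + G s (t + (- al - 2 * pi)).
    have -> : 64 * far s `|u| = G s u.
      rewrite /G indicE mem_set ?mulr1//= in_itv/= -ler_norml.
      by rewrite (le_trans upi)//; have := pihalf_lt2 R; lra.
    rewrite /u; have [_|_] := leP (t - al) pi; first by rewrite lerDl.
    by rewrite addrA lerDr.
  set tau := cmod (cis t - a) in b1 b2 *.
  have tau0 : 0 < tau by rewrite (lt_le_trans _ (cis_dist_ge _ _))// subr_gt0.
  have dtau := dist_triangle E0 (cis t) a; rewrite -/tau -/s in dtau.
  have [ts|st] := leP tau s.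
    apply: (@le_trans _ _ (Om (2 * s) * poisson a t)); last by rewrite lerDl.
    rewrite /poisson -/tau -/K mulrA [Om _ * _]mulrC.
    rewrite ler_pM2r ?invr_gt0 ?exprn_gt0//; apply: ler_wpM2l => //.
    by apply: (le_trans hx); apply: Omm; lra.
  apply: (@le_trans _ _ (K * (64 * far s `|u|))); last first.
    apply: (@le_trans _ _ (K * (G s (t + - al) + G s (t + (- al - 2 * pi))))).
      exact: ler_wpM2l.
    by rewrite lerDr.
  rewrite -mulrA; apply: ler_wpM2l => //; rewrite /far mulrCA.
  set v := Num.max `|u| s.
  have uv : `|u| <= v by rewrite le_max lexx.
  have sv : s <= v by rewrite le_max lexx orbT.
  have v0 : 0 < v by exact: lt_le_trans sv.
  have vt : v / 8 <= tau.
    by rewrite ler_pdivrMr// ge_max; apply/andP; split; lra.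
  apply: (@le_trans _ _ (Om (4 * v) / tau ^+ 2)).
    rewrite ler_pM2r ?invr_gt0 ?exprn_gt0//; apply: (le_trans hx); apply: Omm; lra.
  apply: ler_wpM2l => //.
  have -> : 64 * (v ^+ 2)^-1 = ((v / 8) ^+ 2)^-1.
    by field; rewrite gt_eqF.
  by rewrite lef_pV2 ?posrE ?exprn_gt0 ?divr_gt0// lerXn2r// nnegrE ltW// divr_gt0.
Qed.

End PoissonMajorant.

(** * Infinite Blaschke products *)

Section UltraLimit.
Context (R : realType) (F : set_system nat) {UF : UltraFilter F}.

Let FF : ProperFilter F := ultra_proper.
Local Existing Instance FF.

(** The limit is the supremum of the [x] such that the sequence is at least [x] on
    a set of the ultrafilter. *)
Lemma ultra_cvg (u : nat -> R) A : (forall k, `|u k| <= A) ->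
  exists l : R, u k @[k --> F] --> l.
Proof.
move=> hA; pose S := [set x : R | F [set k | x <= u k]].
have S0 : has_sup S.
  split; first by exists (- A); apply: filterS filterT => k _ /=; case/ler_normlP: (hA k); lra.
  exists A => x /filter_ex[k /= xk]; apply: (le_trans xk).
  exact: le_trans (ler_norm _) (hA k).
exists (sup S); apply/cvgrPdist_le => e e0.
have lo : F [set k | sup S - e <= u k].
  have [x Sx lt] := sup_adherent e0 S0.
  by apply: filterS Sx => k /=; apply: le_trans; exact: ltW.
have hi : F [set k | u k <= sup S + e].
  have [h|h] := in_ultra_setVsetC [set k | sup S + e <= u k] UF.
    have : sup S + e <= sup S by apply: ub_le_sup => //; case: S0.
    by rewrite gerDl leNgt e0.
  by apply: filterS h => k /= /negP; rewrite -ltNge => /ltW.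
apply: filterS2 lo hi => k /= h1 h2.
by rewrite ler_distl; apply/andP; split; lra.
Qed.

Lemma ultra_cplx_cvg (u : nat -> R[i]) A : (forall k, cmod (u k) <= A) ->
  exists l, cmod (u k - l) @[k --> F] --> (0 : R).
Proof.
move=> hA.
have [x hx] : exists x : R, complex.Re (u k) @[k --> F] --> x.
  by apply: (@ultra_cvg _ A) => k; rewrite (le_trans (Re_le_cmod _)).
have [y hy] : exists y : R, complex.Im (u k) @[k --> F] --> y.
  by apply: (@ultra_cvg _ A) => k; rewrite (le_trans (Im_le_cmod _)).
by exists (x +i* y)%C; exact: cvg_Re_Im.
Qed.

(** Closed conditions on finitely many coefficients pass to the limit. *)
Lemma ultra_sum_le N (v : nat -> nat -> R[i]) (G w : nat -> R[i]) (B : R) :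
  (forall n, cmod (v k n - G n) @[k --> F] --> (0 : R)) ->
  (\forall k \near F, cmod (\sum_(n < N) v k n * w n) <= B) ->
  cmod (\sum_(n < N) G n * w n) <= B.
Proof.
move=> hv hB.
have h : \sum_(n < N) cmod (v k n - G n) * cmod (w n) @[k --> F] --> (0 : R).
  have ht n : cmod (v k n - G n) * cmod (w n) @[k --> F] --> (0 : R).
    by rewrite -[X in _ --> X](mul0r (cmod (w n))); apply: cvgMl; exact: hv.
  have H := @cvg_sum_ord R nat F _ (fun n k => cmod (v k n - G n) * cmod (w n))
    (fun=> 0) N ht.
  have S0 : \sum_(n < N) (0 : R) = 0 by rewrite big1.
  by rewrite S0 in H; exact: H.
apply: (le_of_cvg0 h); apply: filterS hB => k hk.
have -> : \sum_(n < N) G n * w n =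
    \sum_(n < N) v k n * w n - \sum_(n < N) (v k n - G n) * w n.
  by rewrite -sumrB; apply: eq_bigr => n _; ring.
rewrite (le_trans (ler_cmodB _ _))// lerD// (le_trans (ler_cmod_sum _ _ _))//.
by apply: ler_sum => n _; rewrite cmodM.
Qed.

Lemma ultra_weighted_le N (v : nat -> nat -> R[i]) (G : nat -> R[i]) (B : R) :
  (forall n, cmod (v k n - G n) @[k --> F] --> (0 : R)) ->
  (forall k, \sum_(n < N) n%:R * cmod (v k n) ^+ 2 <= B) ->
  \sum_(n < N) n%:R * cmod (G n) ^+ 2 <= B.
Proof.
move=> hv hB.
have h : \sum_(n < N) n%:R * cmod (v k n) ^+ 2 @[k --> F] -->
    \sum_(n < N) n%:R * cmod (G n) ^+ 2.
  have ht n : n%:R * cmod (v k n) ^+ 2 @[k --> F] --> n%:R * cmod (G n) ^+ 2.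
    by apply: cvgMr; exact: cvg_sqr_cmod.
  exact: (@cvg_sum_ord R nat F _ (fun n k => n%:R * cmod (v k n) ^+ 2)
    (fun n => n%:R * cmod (G n) ^+ 2) N ht).
rewrite -(cvg_lim (@Rhausdorff R) h); apply: limr_le; first exact: cvgP h.
exact: nearW.
Qed.

End UltraLimit.

Section Vanishing.
Context (R : realType).
Implicit Types (g : nat -> R[i]) (a w : R[i]).

Lemma kernel_div_bounded a g A : cmod a < 1 -> (forall n, cmod (g n) <= A) ->
  forall n, cmod (kernel_div a g n) <= A / (1 - cmod a).
Proof.
move=> a1 hA; have d0 : 0 < 1 - cmod a by rewrite subr_gt0.
have A0 : 0 <= A by exact: le_trans (cmod_ge0 _) (hA 0).
have e : A / (1 - cmod a) = A + cmod a * (A / (1 - cmod a)).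
  by field; rewrite gt_eqF.
elim=> [|n ih] /=.
  by rewrite (le_trans (hA 0))// e lerDl mulr_ge0 ?cmod_ge0// divr_ge0// ltW.
rewrite (le_trans (ler_cmodD _ _))// e lerD// cmodM cmod_conj.
by rewrite ler_wpM2l ?cmod_ge0.
Qed.

Lemma bounded_pow_cvg0 (u : nat -> R[i]) A w : cmod w < 1 ->
  (forall n, cmod (u n) <= A) -> cmod (u n * w ^+ n.+1) @[n --> \oo] --> (0 : R).
Proof.
move=> w1 hA; have w0 := cmod_ge0 w.
have h : A * cmod w ^+ n @[n --> \oo] --> (0 : R).
  rewrite -[X in _ --> X](mulr0 A); apply: cvgMr.
  by apply: cvg_expr; rewrite ger0_norm.
apply: cvg0_squeeze h => n.
rewrite cmod_ge0 /= cmodM cmodX; apply: ler_pM; rewrite ?cmod_ge0 ?exprn_ge0//.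
by rewrite exprS ler_piMl ?exprn_ge0// ltW.
Qed.

Lemma psum_blaschke_mul a g N z : psum (blaschke_mul a g) N.+1 z =
  (z - a) * psum (kernel_div a g) N.+1 z - kernel_div a g N * z ^+ N.+1.
Proof.
elim: N => [|N ih].
  by rewrite /psum !big_ord1 /blaschke_mul /= expr1 !expr0; ring.
rewrite psumS ih [in RHS]psumS /blaschke_mul /=.
by rewrite (exprS z N.+1); ring.
Qed.

Lemma psum_cvgS g w l : psum_cvg g w l <->
  cmod (psum g N.+1 w - l) @[N --> \oo] --> (0 : R).
Proof.
rewrite /psum_cvg -(cvg_shiftS (fun N => cmod (psum g N w - l))); split; exact.
Qed.

Lemma blaschke_mul_vanish_at a g A : cmod a < 1 -> (forall n, cmod (g n) <= A) ->
  psum_cvg (blaschke_mul a g) a 0.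
Proof.
move=> a1 hA; apply/psum_cvgS.
have h := bounded_pow_cvg0 a1 (kernel_div_bounded a1 hA).
apply: cvg_trans h; apply: near_eq_cvg; apply: nearW => N.
by rewrite psum_blaschke_mul subrr mul0r sub0r subr0 cmodN.
Qed.

(** By [psum_kernel_div] the partial sums of [g / (1 - conj a z)] times
    [1 - conj a z] are those of [g] up to a vanishing remainder, hence tend to zero
    at [w]. *)
Lemma blaschke_mul_vanish a g A w : cmod a < 1 -> cmod w < 1 ->
  (forall n, cmod (g n) <= A) -> psum_cvg g w 0 -> psum_cvg (blaschke_mul a g) w 0.
Proof.
move=> a1 w1 hA /psum_cvgS hg; apply/psum_cvgS.
have h := bounded_pow_cvg0 w1 (kernel_div_bounded a1 hA).
have aw : cmod (a^*%C * w) < 1.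
  by rewrite cmodM cmod_conj mulr_ilt1 ?cmod_ge0.
have nz : 1 - a^*%C * w != 0.
  rewrite subr_eq0; apply/eqP => e; move: aw.
  by rewrite -e cmod1 ltxx.
pose q := cmod ((w - a) / (1 - a^*%C * w)).
have lim0 : q * (cmod (psum g N.+1 w - 0) + cmod a * cmod (kernel_div a g N * w ^+ N.+1)) +
    cmod (kernel_div a g N * w ^+ N.+1) @[N --> \oo] --> (0 : R).
  have -> : 0 = q * (0 + cmod a * 0) + 0 :> R by ring.
  by apply: cvgD => //; apply: cvgMr; apply: cvgD => //; exact: cvgMr.
apply: cvg0_squeeze lim0 => N.
rewrite cmod_ge0 /= !subr0 psum_blaschke_mul.
rewrite (le_trans (ler_cmodB _ _))// lerD2r.
have -> : (w - a) * psum (kernel_div a g) N.+1 w = ((w - a) / (1 - a^*%C * w)) *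
    (psum g N.+1 w - a^*%C * (kernel_div a g N * w ^+ N.+1)).
  by rewrite (psum_kernel_div g a N w); field.
rewrite cmodM ler_wpM2l ?cmod_ge0// (le_trans (ler_cmodB _ _))//.
by rewrite cmodM cmod_conj.
Qed.

End Vanishing.

Section BlaschkeProduct.
Context (R : realType).
Variables (c : nat -> R[i]) (z : nat -> R[i]).
Hypothesis z1 : forall k, cmod (z k) < 1.

(** A zero at the origin would shift the coefficients at each of its occurrences,
    so it is skipped; it is restored by a final multiplication by the variable. *)
Fixpoint blaschke_prod k : nat -> R[i] :=
  if k is j.+1 then
    if z j == 0 then blaschke_prod j else blaschke_mul (z j) (blaschke_prod j)
  else c.

Local Notation B := blaschke_prod.

Lemma sum_sqr_blaschke_prod_le k N :
  \sum_(n < N) cmod (B k n) ^+ 2 <= \sum_(n < N) cmod (c n) ^+ 2.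
Proof.
elim: k => [//|k ih] /=; case: ifP => // _.
exact: le_trans (sum_sqr_blaschke_mul_le _ _ (z1 k)) ih.
Qed.

Lemma sum_sqr_kernel_div_blaschke_prod_le w k N :
  \sum_(n < N) cmod (kernel_div w (B k) n) ^+ 2 <=
  \sum_(n < N) cmod (kernel_div w c n) ^+ 2.
Proof.
elim: k => [//|k ih] /=; case: ifP => // _.
exact: le_trans (sum_sqr_kernel_div_blaschke_mul_le _ _ _ (z1 k)) ih.
Qed.

(** The correction of the [k]-th factor is computed from the product of the previous
    ones, but bounded by the one computed from [c]; the corrections therefore add
    up. *)
Lemma sum_weighted_sqr_blaschke_prod_le (q : nat -> R) M k N :
  (forall j, 0 <= q j) ->
  (forall j N, (1 - cmod (z j) ^+ 2) * \sum_(n < N) cmod (kernel_div (z j) c n) ^+ 2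
     <= q j) ->
  (forall N, \sum_(n < N) n%:R * cmod (c n) ^+ 2 <= M) ->
  \sum_(n < N.+1) n%:R * cmod (B k n) ^+ 2 <= M + \sum_(j < k) q j.
Proof.
move=> q0 hq hM; elim: k => [|k ih]; first by rewrite big_ord0 addr0; exact: hM.
rewrite [in leRHS]big_ord_recr /= addrA; case: ifP => _.
  by rewrite (le_trans ih)// lerDl.
apply: (le_trans (sum_weighted_sqr_blaschke_mul_le _ _ (z1 k))).
apply: lerD => //; apply: le_trans (hq k N).
by rewrite ler_wpM2l ?sqr_cmod_lt1// sum_sqr_kernel_div_blaschke_prod_le.
Qed.

Lemma kernel_div_low a (g : nat -> R[i]) m : (forall i, (i < m)%N -> g i = 0) ->
  (forall i, (i < m)%N -> kernel_div a g i = 0) /\ kernel_div a g m = g m.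
Proof.
move=> h; have low i : (i < m)%N -> kernel_div a g i = 0.
  by elim: i => [|i ih] im /=; rewrite h// ih ?mulr0 ?addr0// ltnW.
split => //; case: m h low => [//|m] h low /=.
by rewrite low ?ltnSn// mulr0 addr0.
Qed.

Lemma blaschke_prod_low m : (forall i, (i < m)%N -> c i = 0) -> forall k,
  (forall i, (i < m)%N -> B k i = 0) /\
  cmod (B k m) = cmod (c m) * \prod_(j < k) (if z j == 0 then 1 else cmod (z j)).
Proof.
move=> hm; elim=> [|k [ih1 ih2]]; first by rewrite big_ord0 mulr1.
rewrite big_ord_recr /=; case: ifP => _; first by rewrite mulr1.
have [K1 K2] := kernel_div_low (z k) ih1.
split=> [i im|]; rewrite /blaschke_mul.
  have -> : shift_seq (kernel_div (z k) (B k)) i = 0.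
    by case: i im => [//|i] im /=; rewrite K1// ltnW.
  by rewrite K1// mulr0 subr0.
have -> : shift_seq (kernel_div (z k) (B k)) m = 0.
  by case: m K1 {ih1 ih2 K2 hm} => [//|m] K1 /=; rewrite K1.
by rewrite sub0r cmodN cmodM K2 ih2 mulrC mulrA.
Qed.

Lemma blaschke_prod_vanish A j k : (forall k n, cmod (B k n) <= A) -> z j != 0 ->
  (j < k)%N -> psum_cvg (B k) (z j) 0.
Proof.
move=> hA zj; elim: k => [//|k ih]; rewrite ltnS leq_eqVlt => /orP[/eqP <-|jk] /=.
  by rewrite (negPf zj); exact: blaschke_mul_vanish_at.
case: ifP => _; first exact: ih.
by apply: (@blaschke_mul_vanish _ _ _ A) => //; exact: ih.
Qed.

End BlaschkeProduct.

Section ProductBound.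
Context (R : realType).

Lemma prod_ge_one_sub_sum (x : nat -> R) N M : (forall n, 0 < x n <= 1) ->
  1 - \sum_(N <= n < M) (1 - x n) <= \prod_(N <= n < M) x n <= 1.
Proof.
move=> hx; have [MN|] := leqP M N; first by rewrite !big_geq// subr0 lexx.
elim: M => [//|M ih]; rewrite ltnS => NM.
have /andP[x0 x1] := hx M.
rewrite !big_nat_recr//=; case: (ltngtP N M) NM => // [NM _|-> _]; last first.
  by rewrite !big_geq// mul1r x1 andbT; lra.
have /andP[h1 h2] := ih NM.
have p0 : 0 <= \prod_(N <= n < M) x n.
  by apply: prodr_ge0 => n _; case/andP: (hx n) => /ltW.
by apply/andP; split; nra.
Qed.

(** Past the index where the remaining sum is at most one half, the remaining product
    is at least one half. *)
Lemma prod_lower_bound (x : nat -> R) S : (forall n, 0 < x n <= 1) ->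
  (forall N, \sum_(0 <= n < N) (1 - x n) <= S) ->
  exists2 d, 0 < d & forall N, d <= \prod_(n < N) x n.
Proof.
move=> hx hS.
have t0 n : 0 <= 1 - x n by rewrite subr_ge0; case/andP: (hx n).
have h0 : 0 < 2^-1 :> R by rewrite invr_gt0.
have [n0 hn0] := bounded_sum_tail t0 hS h0.
have p0 N : 0 < \prod_(0 <= n < N) x n.
  by apply: prodr_gt0 => n _; case/andP: (hx n).
exists ((\prod_(0 <= n < n0) x n) * 2^-1); first by rewrite mulr_gt0// invr_gt0.
move=> N; rewrite -(big_mkord xpredT x).
have [nN|Nn] := leqP n0 N.
  rewrite [leRHS](big_cat_nat (leq0n n0) nN)/= ler_pM2l//.
  have /andP[h1 _] := prod_ge_one_sub_sum n0 N hx.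
  by apply: le_trans h1; have := hn0 N nN; lra.
rewrite (big_cat_nat (leq0n N) (ltnW Nn))/= -mulrA -[leRHS]mulr1 ler_pM2l//.
have /andP[_ h2] := prod_ge_one_sub_sum N n0 hx.
have q0 : 0 <= \prod_(N <= n < n0) x n.
  by apply: prodr_ge0 => n _; case/andP: (hx n) => /ltW.
nra.
Qed.

End ProductBound.

Section ShiftedSum.
Context (R : realType).

Lemma psum_shift_seq (g : nat -> R[i]) N w :
  psum (shift_seq g) N.+1 w = w * psum g N w.
Proof.
rewrite /psum big_ord_recl /= mul0r add0r mulr_sumr.
by apply: eq_bigr => n _; rewrite /bump /= add1n exprS; ring.
Qed.

(** At small positive points the lowest term dominates the geometric bound on the
    others. *)
Lemma taylor_nonzero (g : nat -> R[i]) f A m : (forall n, cmod (g n) <= A) ->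
  is_taylor g f -> (forall i, (i < m)%N -> g i = 0) -> g m != 0 ->
  nonzero_on_disk f.
Proof.
move=> hA hf low gm; have d0 : 0 < cmod (g m) by rewrite cmod_gt0.
have A0 : 0 <= A by exact: le_trans (cmod_ge0 _) (hA 0).
set d := cmod (g m) in d0.
pose t := Num.min (2^-1) (d / (4 * (A + 1))).
have q0 : 0 < 4 * (A + 1) by rewrite mulr_gt0//; lra.
have t0 : 0 < t by rewrite lt_min invr_gt0 ltr0n divr_gt0.
have [t1 t2] : t <= 2^-1 /\ t <= d / (4 * (A + 1)).
  by apply/andP; rewrite -le_min.
have ct : cmod (t%:C%C : R[i]) = t by rewrite cmod_real gtr0_norm.
exists (t%:C%C); first by rewrite /unit_disk /= ct; lra.
have hA1 : coef_bounded g 1 A by move=> n; rewrite expr1n mulr1.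
have cvg : psum_cvg g t%:C%C (f t%:C%C) by apply: hf; rewrite ct; lra.
have ct' : cmod (t%:C%C : R[i]) <= t by rewrite ct.
have t11 : t < 1 by lra.
have := psum_cvg_tail m.+1 ltr01 hA1 ct' t11 cvg; rewrite divr1 psumS.
have -> : psum g m t%:C%C = 0.
  by rewrite /psum big1// => i _; rewrite low// mul0r.
rewrite add0r => tail; apply/eqP => f0; move: tail.
rewrite f0 sub0r cmodN cmodM cmodX ct -/d exprS.
have tm : 0 < t ^+ m by rewrite exprn_gt0.
move: (t ^+ m) tm => T T0; rewrite mulrA ler_pdivlMr; last by lra.
have h1 : A * t <= d / 4.
  by move: t2; rewrite ler_pdivlMr//; lra.
have h2 := ler_wpM2r (ltW T0) h1.
have h3 : 0 < d * T by rewrite mulr_gt0.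
have h4 : d * T * t <= d * T * 2^-1 by rewrite ler_pM2l.
by rewrite leNgt => /negP; apply; lra.
Qed.

End ShiftedSum.

(** * Passing to the limit *)

Section Assembly.
Context (R : realType).

Lemma taylor_coef_neq0 (c : nat -> R[i]) f : is_taylor c f -> nonzero_on_disk f ->
  exists2 m, c m != 0 & forall i, (i < m)%N -> c i = 0.
Proof.
move=> tc [w w1 fw].
have ex : exists n, c n != 0.
  apply: contrapT => h; move/negP: fw; apply; apply/eqP.
  apply: (cplx_cvg_unique (tc w w1)).
  rewrite (_ : (fun N => _) = fun=> 0); first exact: cvg_cst.
  apply/funext => N; rewrite /psum big1 ?subr0 ?cmod0// => i _.
  have [->|ci] := eqVneq (c i) 0; first by rewrite mul0r.
  by case: h; exists (i : nat).
case: (ex_minnP ex) => m cm mmin; exists m => // i im.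
by apply/eqP/negPn/negP => /mmin; rewrite leqNgt im.
Qed.

(** The function whose Taylor coefficients are those of the infinite Blaschke
    product times [f], obtained as a limit of finite products along an
    ultrafilter. The bound on the Dirichlet sum passes to the limit; the lowest
    coefficient is multiplied by the convergent product of the nonzero [|z k|], so that
    the limit does not vanish identically; and the zeros survive because the partial sums
    of the products at [z j] tend to zero at a rate that does not depend on the
    product. *)
Lemma blaschke_limit (c : nat -> R[i]) (z : nat -> R[i]) M Q (q : nat -> R) m :
  (forall k, cmod (z k) < 1) ->
  (forall N, \sum_(n < N) n%:R * cmod (c n) ^+ 2 <= M) ->
  (forall k, 0 <= q k) -> (forall N, \sum_(k < N) q k <= Q) ->
  (forall k N, (1 - cmod (z k) ^+ 2) *
     \sum_(n < N) cmod (kernel_div (z k) c n) ^+ 2 <= q k) ->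
  cvgn (series (fun n => 1 - cmod (z n))) ->
  c m != 0 -> (forall i, (i < m)%N -> c i = 0) ->
  exists g : nat -> R[i], exists A : R, [/\ forall n, cmod (g n) <= A,
    forall N, \sum_(n < N) n%:R * cmod (g n) ^+ 2 <= M + Q,
    g m != 0, forall i, (i < m)%N -> g i = 0 &
    forall k, z k != 0 -> psum_cvg g (z k) 0].
Proof.
move=> z1 hM q0 hQ hq zs cm low.
pose B := blaschke_prod c z.
pose A := cmod (c 0) ^+ 2 + M + 1.
have hA k n : cmod (B k n) <= A.
  have h1 : cmod (B k n) ^+ 2 <= cmod (c 0) ^+ 2 + M.
    apply: (@le_trans _ _ (\sum_(i < n.+1) cmod (B k i) ^+ 2)).
      by rewrite big_ord_recr /= lerDr sumr_ge0// => i _; exact: sqr_ge0.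
    apply: (le_trans (sum_sqr_blaschke_prod_le c z1 k _)).
    rewrite big_ord_recl lerD2l; apply: le_trans (hM n.+1).
    rewrite big_ord_recl /= mul0r add0r; apply: ler_sum => i _.
    by rewrite /bump /= add1n ler_peMl ?sqr_ge0// ler1n.
  have := sqr_ge0 (cmod (B k n) - 2^-1); rewrite /A; nra.
have [F [UF Foo]] := ultraFilterLemma (F := \oo) _.
have /choice[g hg] : forall n, exists l, cmod (B k n - l) @[k --> F] --> (0 : R).
  by move=> n; apply: (ultra_cplx_cvg (A := A)) => k; exact: hA.
have FP : ProperFilter F by exact: ultra_proper.
(* The lowest coefficient is untouched by the factors that blaschke_prod skips. *)
pose x k : R := if z k == 0 then 1 else cmod (z k).
have hx k : 0 < x k <= 1.
  rewrite /x; case: ifPn => zk; first by rewrite ltr01 lexx.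
  by rewrite cmod_gt0 zk ltW.
have hS N : \sum_(0 <= k < N) (1 - x k) <= limn (series (fun n => 1 - cmod (z n))).
  rewrite big_mkord; apply: le_trans (series_bounded _ zs N).
    apply: ler_sum => k _; rewrite /x; case: ifP => // _.
    by rewrite subrr subr_ge0 ltW.
  by move=> k; rewrite subr_ge0 ltW.
have [d d0 hd] := prod_lower_bound hx hS.
have le_coef n b : (\forall k \near F, cmod (B k n) <= b) -> cmod (g n) <= b.
  move=> h; apply: (le_of_cvg0 (hg n)); apply: filterS h => k hk.
  have {1}-> : g n = B k n - (B k n - g n) by ring.
  by apply: (le_trans (ler_cmodB _ _)); rewrite lerD2r.
exists g; exists A; split.
- by move=> n; apply: le_coef; apply: nearW => k; exact: hA.
- move=> N; apply: (ultra_weighted_le (v := B) hg) => k.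
  apply: (@le_trans _ _ (\sum_(n < N.+1) n%:R * cmod (B k n) ^+ 2)).
    by rewrite big_ord_recr /= lerDl; apply: mulr_ge0 => //; exact: sqr_ge0.
  apply: (le_trans (sum_weighted_sqr_blaschke_prod_le z1 k N q0 hq hM)).
  by rewrite lerD2l.
- rewrite -cmod_gt0; apply: (@lt_le_trans _ _ (cmod (c m) * d)).
    by rewrite mulr_gt0 ?cmod_gt0.
  apply: (le_of_cvg0 (hg m)); apply: nearW => k.
  apply: (@le_trans _ _ (cmod (B k m))).
    have [_ ->] := blaschke_prod_low z low k.
    by rewrite ler_wpM2l ?cmod_ge0//; exact: hd.
  have {1}-> : B k m = g m + (B k m - g m) by ring.
  exact: ler_cmodD.
- move=> i im; apply/eqP; rewrite -cmod_eq0 eq_le cmod_ge0 andbT.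
  apply: le_coef; apply: nearW => k.
  by have [B0 _] := blaschke_prod_low z low k; rewrite /B B0// cmod0.
- move=> j zj; have zj1 := z1 j; have zj0 := cmod_ge0 (z j).
  have t01 : 0 <= cmod (z j) < 1 by rewrite zj0 zj1.
  apply: cvg0_squeeze (geo_bound_cvg0 A t01) => N.
  rewrite cmod_ge0 subr0 /=.
  apply: (ultra_sum_le (v := B) hg (N := N) (w := fun n => z j ^+ n)).
  apply: Foo; exists j.+1 => // k /= jk.
  have hB : coef_bounded (B k) 1 A by move=> n; rewrite expr1n mulr1.
  have := psum_cvg_tail N ltr01 hB (lexx _) zj1 (blaschke_prod_vanish z1 hA zj jk).
  by rewrite divr1 sub0r cmodN.
Qed.

(** The function is multiplied by the variable, so that it also vanishes at those
    [z k] that are zero; as multiplicities do not count, one such factor is enough. *)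
Lemma zero_set_of_coef (g : nat -> R[i]) (z : nat -> R[i]) A M m :
  (forall k, cmod (z k) < 1) -> (forall n, cmod (g n) <= A) ->
  (forall N, \sum_(n < N) n%:R * cmod (g n) ^+ 2 <= M) ->
  g m != 0 -> (forall i, (i < m)%N -> g i = 0) ->
  (forall k, z k != 0 -> psum_cvg g (z k) 0) -> zero_set z.
Proof.
move=> z1 hA hM gm low hz; split; first exact: z1.
pose f w := xget 0 [set l | psum_cvg (shift_seq g) w l].
have A0 : 0 <= A by exact: le_trans (cmod_ge0 _) (hA 0).
have hsA n : cmod (shift_seq g n) <= A by case: n => [|n] //=; rewrite cmod0.
have tf : is_taylor (shift_seq g) f.
  move=> w w1; apply: (@xgetPex _ 0 [set l | psum_cvg (shift_seq g) w l]).
  apply: (@psum_is_cvg _ _ 1 A) => // n.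
  by rewrite expr1n mulr1.
exists f; split.
- split; first by exists (shift_seq g) => w w1; apply/psum_cvgP; exact: tf.
  apply: (dirichlet_of_coef (M := 2 * M + cmod (g 0) ^+ 2) tf); case=> [|N].
    rewrite big_ord0 addr_ge0 ?sqr_ge0// mulr_ge0//.
    by have := hM 0; rewrite big_ord0.
  rewrite big_ord_recl /= mul0r add0r.
  apply: (@le_trans _ _ (\sum_(n < N.+1) n.+1%:R * cmod (g n) ^+ 2)).
    by rewrite [leRHS]big_ord_recr /= lerDl; apply: mulr_ge0 => //; exact: sqr_ge0.
  rewrite big_ord_recl /= mul1r addrC lerD2r.
  apply: (@le_trans _ _ (2 * \sum_(n < N.+1) n%:R * cmod (g n) ^+ 2)); last first.
    by rewrite ler_pM2l.
  rewrite [in leRHS]big_ord_recl /= mul0r add0r mulr_sumr; apply: ler_sum => n _.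
  rewrite mulrA; apply: ler_wpM2r; first exact: sqr_ge0.
  by rewrite /bump /= add1n -natrM ler_nat mul2n doubleS !ltnS -addnn leq_addl.
- apply: (taylor_nonzero (m := m.+1) hsA tf) => //.
  by case=> [//|i] /=; rewrite ltnS; exact: low.
- move=> k; apply: (cplx_cvg_unique (tf _ (z1 k))); apply/psum_cvgS.
  have [z0|z0] := eqVneq (z k) 0.
    rewrite (_ : (fun N => _) = fun=> 0); first exact: cvg_cst.
    by apply/funext => N; rewrite psum_shift_seq z0 mul0r subr0 cmod0.
  rewrite -[X in _ --> X](mulr0 (cmod (z k))).
  rewrite (_ : (fun N => _) = fun N => cmod (z k) * cmod (psum g N (z k) - 0)).
    by apply: cvgMr; exact: hz.
  by apply/funext => N; rewrite psum_shift_seq !subr0 cmodM.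
Qed.

End Assembly.

Theorem theorem1p1 (R : realType) (omega : R -> R)
  (omega_ge0 : forall t, t \in `[0, 2] -> 0 <= omega t)
  (omega_cont : {within `[0, 2], continuous omega})
  (omega_incr : {in `[0, 2] &, {homo omega : s t / s <= t}})
  (omega0 : omega 0 = 0)
  (omega_int :
    (fun delta : R =>
       \int[lebesgue_measure]_(t in `[delta, 2]) (omega t / t ^+ 2))
    =O_ (0^'+) (fun delta : R => 1 + omega delta / delta))
  (E : set R[i]) (E_circle : E `<=` @unit_circle R) (E_neq0 : E !=set0)
  (hE : exists f : R[i] -> R[i],
    [/\ dirichlet_space f,
        nonzero_on_disk f
      & ae_circle (fun zeta =>
          cmod (radial_limit f zeta) ^+ 2 <= omega (dist zeta E))]) :
  forall z : nat -> R[i],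
    blaschke_sequence z ->
    cvgn (series (fun n => omega (Num.min (2 * dist (z n) E) 2))) ->
    zero_set z.
Proof.
move=> z [z1 zs] zw.
case: hE => f [[[c hc] fD] fnz fae].
have tc : is_taylor c f by move=> w w1; apply/psum_cvgP; exact: hc.
have [M hM] := dirichlet_coef_bound tc fD.
have [C C0 hC] := poisson_majorant omega_ge0 omega_incr omega_int.
have [m cm low] := taylor_coef_neq0 tc fnz.
pose u k := omega (Num.min (2 * dist (z k) E) 2).
pose q k := C * (u k + (1 - cmod (z k))).
have u0 k : 0 <= u k.
  apply: omega_ge0; rewrite in_itv/= le_min ge_min lexx orbT andbT ler0n andbT.
  by rewrite mulr_ge0// dist_ge0.
have v0 k : 0 <= 1 - cmod (z k) by rewrite subr_ge0 ltW// z1.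
have q0 k : 0 <= q k by rewrite mulr_ge0// addr_ge0.
have hQ N : \sum_(k < N) q k <=
    C * (limn (series u) + limn (series (fun k => 1 - cmod (z k)))).
  rewrite -mulr_sumr ler_wpM2l// big_split /=.
  by apply: lerD; exact: series_bounded.
have hq k N : (1 - cmod (z k) ^+ 2) *
    \sum_(n < N) cmod (kernel_div (z k) c n) ^+ 2 <= q k.
  have [U [mU U0 IU hU]] := hC E (z k) E_circle E_neq0 (z1 k).
  apply: (kernel_div_integral_bound hM (z1 k) mU U0 IU).
  move: fae; apply: (@filterS _ _ (ae_filter_ringOfSetsType lebesgue_measure)).
  move=> t ht tI L hL; apply: (hU t _ tI).
  by rewrite -(radial_limitE hM tc (cmod_cis t) hL); exact: ht.
have [g [A [gA gM gm glow gz]]] := blaschke_limit z1 hM q0 hQ hq zs cm low.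
exact: zero_set_of_coef z1 gA gM gm glow gz.
Qed.
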